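(* Let $z_1=r_1e^{i\theta_1}$ ($r_1>0$, $0<\theta_1<\pi$) be the zero of $e^z-1-z$ in the open upper half-plane of smallest modulus (numerically $\theta_1\approx1.2978$). Then for every $s\in\mathbb{C}$ with $\Re(s)<0$, $$|\zeta_2(s)|<2(2\pi)^{\Re(s)}\,|\Gamma(-s)|\,e^{|\Im(s)|(\pi-\theta_1)}\,\zeta(1-\Re(s)),$$ where $\zeta$ is the Riemann zeta function.
   Context: $\zeta_2$ is defined for $\Re(s)>1$ by $$\zeta_2(s)=\frac{1}{\Gamma(s+1)}\int_0^\infty \frac{x^{s}}{e^x-1-x}\,dx,$$ and $\zeta_2$ also denotes its meromorphic continuation to the whole complex plane (with poles only at $s=0$ and $s=1$). *)

(* Defs.v *)
From Stdlib Require Import Reals.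
From Coquelicot Require Import Coquelicot.
Open Scope R_scope.

Definition Cexp (z : C) : C :=
  (exp (Re z) * cos (Im z), exp (Re z) * sin (Im z)).

(* The principal power x^s of a positive real x. *)
Definition RCpower (x : R) (s : C) : C := Cexp (s * ln x)%C.

(* Integral over (0, +oo), improper at both ends. *)
Definition CInt_0_infty (f : R -> C) : C :=
  RInt_gen (V := C_R_CompleteNormedModule) f
    (at_right 0) (Rbar_locally p_infty).

(* Euler's integral: this is the Gamma function on the half-plane
   0 < Re z only, and is meaningless elsewhere. *)
Definition CGamma (z : C) : C :=
  CInt_0_infty (fun t => (RCpower t (z - 1) * exp (- t))%C).

(* The Riemann zeta function at real arguments x > 1 only. *)
Definition zeta (x : R) : R := Series (fun n => / Rpower (INR (S n)) x).

Definition zeta2_integral (s : C) : C :=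
  (/ CGamma (s + 1) *
   CInt_0_infty (fun x => RCpower x s / RtoC (exp x - 1 - x)))%C.

Definition holomorphic_at (f : C -> C) (a : C) : Prop :=
  locally a (fun z => ex_derive (K := C_AbsRing) (V := C_NormedModule) f z).

(* At worst a pole at a; the value of f at a itself is irrelevant. *)
Definition meromorphic_at (f : C -> C) (a : C) : Prop :=
  exists (n : nat) (g : C -> C), holomorphic_at g a /\
    locally' a (fun z => f z = (g z / (z - a) ^ n)%C).

(* zeta_2 as a function on C, its (arbitrary) values at 0 and 1 being ignored;
   by the identity theorem these conditions determine it everywhere else. *)
Record is_zeta2 (zeta2 : C -> C) : Prop := {
  zeta2_eq_integral : forall s : C, 1 < Re s -> zeta2 s = zeta2_integral s;
  zeta2_meromorphic : forall s : C, meromorphic_at zeta2 s;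
  zeta2_holomorphic : forall s : C, s <> 0 -> s <> 1 -> holomorphic_at zeta2 s
}.

Definition upper_zero (z : C) : Prop :=
  0 < Im z /\ (Cexp z - 1 - z)%C = 0.

Definition smallest_upper_zero (z : C) : Prop :=
  upper_zero z /\ forall w : C, upper_zero w -> Cmod z <= Cmod w.

(* Main.v *)
(* For -1 < Re s < 0 one has Gamma(s+1) zeta_2(s) = int_0^oo x^s h(x) dx, where
   h(x) = 1/(e^x-1-x) - 2/x^2 + 2/(3x).  The Mittag-Leffler expansion of h runs over the zeros z_k
   and conj z_k of q(z) = e^z-1-z, with simple poles of residue 1/z_k; integrating it term by term,
   with int_0^oo x^s/(x+e^l) dx = Gamma(s+1) Gamma(-s) e^(s l), gives
     zeta_2(s) = - Gamma(-s) sum_k ((-z_k)^(s-1) + (-conj z_k)^(s-1)),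
   which persists on Re s < 0 by the identity theorem.  There is exactly one zero z_k with
   2 pi k < Im z_k < 2 pi k + pi/2 for each k >= 1 and none elsewhere in the upper half-plane.
   All of them lie on the curve y^2 = e^(2x) - (1+x)^2, along which both modulus and argument
   increase, so that arg z_k >= theta_1, and |z_k| > 2 pi k bounds the sum.  The resulting bound has
   a factor 2 pi to spare; strictness only needs Gamma(-s) <> 0. *)

(* Slow convergence over the zeros shapes the proof. On [x > 0] the poles of index [k] contribute
   [O(k^(-3/2))], with a further factor [x^(-1/2)] for large [x], so after [n] pairs the remainder
   is at most [8 n^(-1/2) min(1, x^(-1/2))]. Against [x^s] this is integrable only if
   [-1 < Re s < -1/2]. Termwise integration is therefore carried out on one small disc about [-3/4],
   and the identity theorem is applied twice: from [Re s > 1] to that disc, along a broken line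
   around the poles 1 and 0, and from the disc to the whole half-plane [Re s < 0]. The expansion
   itself comes from Cauchy's formula on circles of radius [2 pi n + 5], which run between the
   zeros. All of the complex analysis is local to discs: Goursat's theorem gives primitives, these
   give Cauchy's formula on circles, and that gives the identity theorem and removable
   singularities. Gamma enters through Euler's integral alone, written [Gm s] for [Gamma(s+1)];
   since the formula for [zeta_2] is reached by dividing by [Gm s], its freedom from zeros on
   [Re s > -1] has to be proved from the integral. *)
Require Import Defs.
From Stdlib Require Import Reals.
From Coquelicot Require Import Coquelicot.
From Stdlib Require Import Lra Lia ClassicalEpsilon List.
Open Scope R_scope.

(** * Complex-valued derivatives *)

(* [T] stands for [R] or [C], with its embedding [j] into [C], so that real and
   complex derivatives of complex-valued functions share their rules. *)
Definition Der {T : Type} (add : T -> T -> T) (j : T -> C) (f : T -> C) (z : T) (l : C) : Prop :=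
  forall eps, 0 < eps -> exists d, 0 < d /\ forall h, Cmod (j h) < d ->
    Cmod (f (add z h) - f z - l * j h)%C <= eps * Cmod (j h).

Definition Cder : (C -> C) -> C -> C -> Prop := Der Cplus (fun z => z).
Definition Rder : (R -> C) -> R -> C -> Prop := Der Rplus RtoC.

Lemma lt_Rmin_l a b c : a < Rmin b c -> a < b.
Proof. intros H. apply (Rlt_le_trans _ _ _ H), Rmin_l. Qed.

Lemma lt_Rmin_r a b c : a < Rmin b c -> a < c.
Proof. intros H. apply (Rlt_le_trans _ _ _ H), Rmin_r. Qed.

Lemma Cmod_triangle3 (a b c : C) : Cmod (a + b + c) <= Cmod a + Cmod b + Cmod c.
Proof.
  eapply Rle_trans; [apply Cmod_triangle|]. generalize (Cmod_triangle a b); lra.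
Qed.

Lemma Cmod_sub_le (a b : C) : Cmod (a - b) <= Cmod a + Cmod b.
Proof. rewrite <- (Cmod_opp b). apply Cmod_triangle. Qed.

Lemma Cmod_sub_ge (a b : C) : Cmod a - Cmod b <= Cmod (a - b).
Proof.
  replace a with ((a - b) + b)%C at 1 by ring.
  generalize (Cmod_triangle (a - b) b); lra.
Qed.

Lemma Cmod_sub_sym (a b : C) : Cmod (a - b) = Cmod (b - a).
Proof. rewrite <- Cmod_opp. f_equal; ring. Qed.

Section DerRules.
Context {T : Type} (add : T -> T -> T) (j : T -> C).

Lemma Der_lip (f : T -> C) z l : Der add j f z l ->
  exists d, 0 < d /\ forall h, Cmod (j h) < d ->
    Cmod (f (add z h) - f z)%C <= (Cmod l + 1) * Cmod (j h).
Proof.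
  intros H. destruct (H 1 Rlt_0_1) as (d & Hd & Hf). exists d; split; [exact Hd|].
  intros h Hh. specialize (Hf h Hh).
  replace (f (add z h) - f z)%C with ((f (add z h) - f z - l * j h) + l * j h)%C by ring.
  eapply Rle_trans; [apply Cmod_triangle|]. rewrite Cmod_mult. lra.
Qed.

Lemma Der_cont (f : T -> C) z l : Der add j f z l ->
  forall eps, 0 < eps -> exists d, 0 < d /\ forall h, Cmod (j h) < d ->
    Cmod (f (add z h) - f z)%C < eps.
Proof.
  intros H eps He. destruct (Der_lip f z l H) as (d & Hd & Hf).
  pose proof (Cmod_ge_0 l) as Hl.
  exists (Rmin d (eps / (Cmod l + 1))). split.
  - apply Rmin_pos; [exact Hd|]. apply Rdiv_lt_0_compat; lra.
  - intros h Hh. eapply Rle_lt_trans.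
    + apply Hf. exact (lt_Rmin_l _ _ _ Hh).
    + assert (Hh2 : Cmod (j h) < eps / (Cmod l + 1))
        by exact (lt_Rmin_r _ _ _ Hh).
      apply Rmult_lt_compat_l with (r := Cmod l + 1) in Hh2; [|lra].
      replace ((Cmod l + 1) * (eps / (Cmod l + 1))) with eps in Hh2 by (field; lra).
      exact Hh2.
Qed.

Lemma Der_const (c : C) z : Der add j (fun _ => c) z 0.
Proof.
  intros eps He. exists 1; split; [lra|]. intros h _.
  replace (c - c - 0 * j h)%C with (RtoC 0) by ring. rewrite Cmod_0.
  apply Rmult_le_pos; [lra|apply Cmod_ge_0].
Qed.

Lemma Der_plus (f g : T -> C) z l m : Der add j f z l -> Der add j g z m ->
  Der add j (fun x => f x + g x)%C z (l + m)%C.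
Proof.
  intros Hf Hg eps He.
  destruct (Hf (eps/2)) as (d1 & Hd1 & H1); [lra|].
  destruct (Hg (eps/2)) as (d2 & Hd2 & H2); [lra|].
  exists (Rmin d1 d2). split; [now apply Rmin_pos|]. intros h Hh.
  specialize (H1 h (Rlt_le_trans _ _ _ Hh (Rmin_l _ _))).
  specialize (H2 h (Rlt_le_trans _ _ _ Hh (Rmin_r _ _))).
  replace (f (add z h) + g (add z h) - (f z + g z) - (l + m) * j h)%C with
    ((f (add z h) - f z - l * j h) + (g (add z h) - g z - m * j h))%C by ring.
  eapply Rle_trans; [apply Cmod_triangle|]. lra.
Qed.

Lemma Der_ext_loc (f g : T -> C) z l d0 : 0 < d0 ->
  (forall h, Cmod (j h) < d0 -> f (add z h) = g (add z h)) -> f z = g z ->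
  Der add j f z l -> Der add j g z l.
Proof.
  intros Hd0 He Hz Hf eps Heps. destruct (Hf eps Heps) as (d & Hd & H).
  exists (Rmin d d0). split; [now apply Rmin_pos|]. intros h Hh.
  rewrite <- He by exact (lt_Rmin_r _ _ _ Hh).
  rewrite <- Hz. apply H. exact (lt_Rmin_l _ _ _ Hh).
Qed.

Lemma Der_comp (F : C -> C) (f : T -> C) z l m :
  Cder F (f z) l -> Der add j f z m -> Der add j (fun x => F (f x)) z (l * m)%C.
Proof.
  intros HF Hf eps He.
  pose proof (Cmod_ge_0 l) as Hl. pose proof (Cmod_ge_0 m) as Hm.
  destruct (HF (eps / (2 * (Cmod m + 1)))) as (d1 & Hd1 & H1).
  { apply Rdiv_lt_0_compat; lra. }
  destruct (Hf (eps / (2 * (Cmod l + 1)))) as (d2 & Hd2 & H2).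
  { apply Rdiv_lt_0_compat; lra. }
  destruct (Der_lip f z m Hf) as (d3 & Hd3 & H3).
  destruct (Der_cont f z m Hf d1 Hd1) as (d4 & Hd4 & H4).
  exists (Rmin d2 (Rmin d3 d4)). split; [repeat apply Rmin_pos; assumption|].
  intros h Hh.
  assert (Hh2 : Cmod (j h) < d2) by exact (lt_Rmin_l _ _ _ Hh).
  assert (Hh34 : Cmod (j h) < Rmin d3 d4) by exact (lt_Rmin_r _ _ _ Hh).
  assert (Hh3 : Cmod (j h) < d3) by exact (lt_Rmin_l _ _ _ Hh34).
  assert (Hh4 : Cmod (j h) < d4) by exact (lt_Rmin_r _ _ _ Hh34).
  specialize (H2 h Hh2). specialize (H3 h Hh3). specialize (H4 h Hh4).
  set (k := (f (add z h) - f z)%C) in *.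
  specialize (H1 k H4).
  replace (f z + k)%C with (f (add z h)) in H1 by (unfold k; ring).
  replace (F (f (add z h)) - F (f z) - l * m * j h)%C with
    ((F (f (add z h)) - F (f z) - l * k) + l * (k - m * j h))%C by ring.
  eapply Rle_trans; [apply Cmod_triangle|]. rewrite Cmod_mult.
  assert (A : eps / (2 * (Cmod m + 1)) * Cmod k <= eps / 2 * Cmod (j h)).
  { replace (eps / 2 * Cmod (j h)) with
      (eps / (2 * (Cmod m + 1)) * ((Cmod m + 1) * Cmod (j h))) by (field; lra).
    apply Rmult_le_compat_l; [|exact H3].
    apply Rlt_le, Rdiv_lt_0_compat; lra. }
  assert (B : Cmod l * Cmod (k - m * j h) <= eps / 2 * Cmod (j h)).
  { apply Rle_trans with ((Cmod l + 1) * (eps / (2 * (Cmod l + 1)) * Cmod (j h))).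
    - apply Rmult_le_compat; [exact Hl|apply Cmod_ge_0|lra|exact H2].
    - right. field. lra. }
  lra.
Qed.

Lemma Der_sqr_aux (z : C) : Cder (fun x => x * x)%C z (2 * z)%C.
Proof.
  intros eps He. exists eps; split; [exact He|]. intros h Hh.
  replace ((z + h) * (z + h) - z * z - 2 * z * h)%C with (h * h)%C by ring.
  rewrite Cmod_mult. apply Rmult_le_compat_r; [apply Cmod_ge_0|lra].
Qed.

Lemma Cder_scal_aux (c z : C) : Cder (fun x => c * x)%C z c.
Proof.
  intros eps He. exists 1; split; [lra|]. intros h Hh.
  replace (c * (z + h) - c * z - c * h)%C with (RtoC 0) by ring. rewrite Cmod_0.
  apply Rmult_le_pos; [lra|apply Cmod_ge_0].
Qed.

Lemma Der_scal (c : C) (f : T -> C) z l : Der add j f z l -> Der add j (fun x => c * f x)%C z (c * l)%C.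
Proof. intros H. apply (Der_comp (fun y => c * y)%C); [apply Cder_scal_aux|exact H]. Qed.

Lemma Der_minus (f g : T -> C) z l m : Der add j f z l -> Der add j g z m ->
  Der add j (fun x => f x - g x)%C z (l - m)%C.
Proof.
  intros Hf Hg.
  assert (H := Der_plus _ _ _ _ _ Hf (Der_scal (-(1))%C _ _ _ Hg)).
  assert (E : (l - m = l + -(1) * m)%C) by ring. rewrite E.
  apply (Der_ext_loc (fun x => f x + - (1) * g x)%C) with (d0 := 1); [lra| | |exact H];
    intros; ring.
Qed.

(* Polarisation reduces products to squares, i.e. to the chain rule. *)
Lemma Der_mult (f g : T -> C) z l m : Der add j f z l -> Der add j g z m ->
  Der add j (fun x => f x * g x)%C z (l * g z + f z * m)%C.
Proof.
  intros Hf Hg.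
  assert (H1 := Der_comp (fun x => x * x)%C _ _ _ _ (Der_sqr_aux _) (Der_plus _ _ _ _ _ Hf Hg)).
  assert (H2 := Der_comp (fun x => x * x)%C _ _ _ _ (Der_sqr_aux _) (Der_minus _ _ _ _ _ Hf Hg)).
  assert (H := Der_scal (/ 4)%C _ _ _ (Der_minus _ _ _ _ _ H1 H2)). cbv beta in H.
  assert (N4 : (4 <> 0 :> C)%C).
  { intros E. apply RtoC_inj in E. lra. }
  assert (E : (l * g z + f z * m = / 4 * (2 * (f z + g z) * (l + m) - 2 * (f z - g z) * (l - m)))%C)
    by (field; exact N4).
  rewrite E.
  refine (Der_ext_loc _ _ _ _ 1 Rlt_0_1 _ _ H); intros; field; exact N4.
Qed.

Lemma Cder_inv_aux (z : C) : z <> 0 -> Cder Cinv z (- / (z * z))%C.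
Proof.
  intros Hz eps He. pose proof (proj1 (Cmod_gt_0 z) Hz) as Hp.
  set (r := Cmod z) in *.
  exists (Rmin (r / 2) (eps * (r * r * r) / 2)). split.
  { apply Rmin_pos; [lra|]. apply Rdiv_lt_0_compat; [|lra].
    apply Rmult_lt_0_compat; [exact He|]. repeat apply Rmult_lt_0_compat; exact Hp. }
  intros h Hh.
  assert (Hh1 : Cmod h < r / 2) by exact (lt_Rmin_l _ _ _ Hh).
  assert (Hh2 : Cmod h < eps * (r * r * r) / 2) by exact (lt_Rmin_r _ _ _ Hh).
  assert (Hs : r / 2 <= Cmod (z + h)).
  { generalize (Cmod_sub_ge (z + h) h). replace (z + h - h)%C with z by ring.
    generalize (Cmod_sub_ge z (- h)). rewrite Cmod_opp.
    replace (z - - h)%C with (z + h)%C by ring. fold r. lra. }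
  assert (Hzh : (z + h <> 0)%C) by (apply Cmod_gt_0; lra).
  replace (/ (z + h) - / z - - / (z * z) * h)%C with (h * h / (z * z * (z + h)))%C
    by (field; auto).
  rewrite Cmod_div by (repeat apply Cmult_neq_0; assumption).
  rewrite !Cmod_mult. fold r.
  apply Rle_trans with (Cmod h * (eps * (r * r * r) / 2) / (r * r * (r / 2))).
  - unfold Rdiv at 1 3. apply Rmult_le_compat.
    + apply Rmult_le_pos; apply Cmod_ge_0.
    + apply Rlt_le, Rinv_0_lt_compat. repeat apply Rmult_lt_0_compat; lra.
    + apply Rmult_le_compat_l; [apply Cmod_ge_0|lra].
    + apply Rinv_le_contravar; [repeat apply Rmult_lt_0_compat; lra|].
      apply Rmult_le_compat_l; [apply Rmult_le_pos; lra|exact Hs].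
  - right. field. lra.
Qed.

Lemma Der_inv (f : T -> C) z l : f z <> 0 -> Der add j f z l ->
  Der add j (fun x => / f x)%C z (- l / (f z * f z))%C.
Proof.
  intros Hz H. replace (- l / (f z * f z))%C with (- / (f z * f z) * l)%C
    by (field; exact Hz).
  apply Der_comp; [now apply Cder_inv_aux|exact H].
Qed.

Lemma Der_div (f g : T -> C) z l m : g z <> 0 -> Der add j f z l -> Der add j g z m ->
  Der add j (fun x => f x / g x)%C z ((l * g z - f z * m) / (g z * g z))%C.
Proof.
  intros Hz Hf Hg.
  replace ((l * g z - f z * m) / (g z * g z))%C with (l * / g z + f z * (- m / (g z * g z)))%C
    by (field; exact Hz).
  apply (Der_mult f (fun x => / g x)%C); [exact Hf|now apply Der_inv].
Qed.

End DerRules.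

Lemma Cder_id z : Cder (fun x => x) z 1.
Proof.
  intros eps He. exists 1; split; [lra|]. intros h Hh.
  replace (z + h - z - 1 * h)%C with (RtoC 0) by ring. rewrite Cmod_0.
  apply Rmult_le_pos; [lra|apply Cmod_ge_0].
Qed.

(** [is_derive] asks for a little-o estimate at every filter limit of the neighbourhoods of [z];
    once such limits are identified with [z], this is the epsilon-delta form. The equivalence is the
    link through which the hypotheses on zeta_2 and the uniqueness of complex derivatives enter. *)
Lemma Cder_is_derive (f : C -> C) z l :
  Cder f z l <-> is_derive (K := C_AbsRing) (V := C_NormedModule) f z l.
Proof.
  assert (Eq : forall h : C, norm (V := C_NormedModule)
     (minus (minus (f (z + h)%C) (f z)) (scal (minus (z + h)%C z) l)) = Cmod (f (z + h) - f z - l * h)%C).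
  { intros h. apply (f_equal Cmod).
    change ((f (z + h) - f z - (z + h - z) * l = f (z + h) - f z - l * h)%C). ring. }
  assert (Es : forall h : C, (z + h - z)%C = h) by (intros; ring).
  assert (Es' : forall y : C, (z + (y - z))%C = y) by (intros; ring).
  split.
  - intros H. split; [apply is_linear_scal_l|].
    intros y Hy. assert (Ey : y = z).
    { symmetry. apply (is_filter_lim_locally_unique (K := C_AbsRing) (V := AbsRing_NormedModule C_AbsRing)), Hy. }
    subst y. intros eps. destruct (H eps (cond_pos eps)) as (d & Hd & Hf).
    exists (mkposreal d Hd). intros y Hy2.
    specialize (Hf (y - z)%C Hy2). rewrite <- Eq in Hf. rewrite Es' in Hf. exact Hf.
  - intros [_ H] eps He.
    specialize (H z (fun P HP => HP) (mkposreal eps He)).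
    destruct H as [d Hd]. exists d. split; [apply cond_pos|]. intros h Hh.
    specialize (Hd (z + h)%C). rewrite Eq in Hd.
    assert (B : Cmod ((z + h) - z)%C < d) by (rewrite Es; exact Hh).
    specialize (Hd B).
    change (Cmod (f (z + h) - f z - l * h)%C <= eps * Cmod ((z + h) - z)%C) in Hd.
    rewrite Es in Hd. exact Hd.
Qed.

(** The product norm on [C] as a real module is already Euclidean, so norm bounds for integrals
    transfer to [Cmod] without losing a constant. *)
Lemma norm_C_R (x : C) : norm (V := C_R_NormedModule) x = Cmod x.
Proof.
  unfold norm; simpl. unfold prod_norm, Cmod, norm; simpl. f_equal. unfold abs; simpl.
  rewrite !Rmult_1_r. generalize (Rsqr_abs (fst x)) (Rsqr_abs (snd x)). unfold Rsqr. lra.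
Qed.

Lemma Rder_is_derive (f : R -> C) t l :
  Rder f t l <-> is_derive (K := R_AbsRing) (V := C_R_NormedModule) f t l.
Proof.
  assert (Eq : forall h : R, norm (V := C_R_NormedModule)
     (minus (minus (f (t + h)) (f t)) (scal (t + h - t) l)) = Cmod (f (t + h)%R - f t - l * h)%C).
  { intros h. rewrite norm_C_R. apply f_equal.
    rewrite scal_R_Cmult. replace (t + h - t) with h by ring.
    change ((f (t + h)%R - f t - h * l = f (t + h)%R - f t - l * h)%C). ring. }
  assert (Es : forall h : R, (t + h - t) = h) by (intros; ring).
  assert (Es' : forall y : R, (t + (y - t)) = y) by (intros; ring).
  split.
  - intros H. split; [apply is_linear_scal_l|].
    intros y Hy. assert (Ey : y = t).
    { symmetry. apply (is_filter_lim_locally_unique (K := R_AbsRing) (V := R_NormedModule)), Hy. }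
    subst y. intros eps. destruct (H eps (cond_pos eps)) as (d & Hd & Hf).
    exists (mkposreal d Hd). intros y Hy2.
    change (Rabs (y - t) < d) in Hy2.
    specialize (Hf (y - t)). rewrite Cmod_R in Hf. specialize (Hf Hy2).
    rewrite <- Eq in Hf. rewrite Es' in Hf. exact Hf.
  - intros [_ H] eps He.
    specialize (H t (fun P HP => HP) (mkposreal eps He)).
    destruct H as [d Hd]. exists d. split; [apply cond_pos|]. intros h Hh.
    specialize (Hd (t + h)). rewrite Cmod_R in *.
    assert (B : Rabs ((t + h) - t) < d) by (rewrite Es; exact Hh).
    specialize (Hd B).
    change (norm (V := C_R_NormedModule) (minus (minus (f (t + h)) (f t)) (scal (t + h - t) l))
      <= eps * Rabs ((t + h) - t)) in Hd.
    rewrite Eq, Es in Hd. exact Hd.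
Qed.

Lemma Rder_id t : Rder RtoC t 1.
Proof.
  intros eps He. exists 1; split; [lra|]. intros h Hh.
  replace (RtoC (t + h) - RtoC t - 1 * RtoC h)%C with (RtoC 0)
    by (rewrite RtoC_plus; ring).
  rewrite Cmod_0. apply Rmult_le_pos; [lra|apply Cmod_ge_0].
Qed.

Lemma Rder_RtoC (f : R -> R) t l : is_derive f t l -> Rder (fun x => RtoC (f x)) t l.
Proof.
  intros H eps He. apply is_derive_Reals in H. destruct (H eps He) as [d Hd].
  exists d; split; [apply cond_pos|]. intros h Hh. rewrite Cmod_R in *.
  rewrite <- !RtoC_minus, <- RtoC_mult, <- RtoC_minus, Cmod_R.
  destruct (Req_dec h 0) as [->|Nh].
  - rewrite Rplus_0_r. replace (f t - f t - l * 0) with 0 by ring. rewrite Rabs_R0; lra.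
  - specialize (Hd h Nh Hh).
    replace (f (t + h) - f t - l * h) with (((f (t + h) - f t) / h - l) * h) by (field; exact Nh).
    rewrite Rabs_mult. apply Rmult_le_compat_r; [apply Rabs_pos|lra].
Qed.

Lemma Cmod_le_abs (z : C) : Cmod z <= Rabs (Re z) + Rabs (Im z).
Proof.
  destruct z as [a b]. unfold Re, Im; simpl.
  replace (a, b) with (RtoC a + Ci * RtoC b)%C
    by (unfold RtoC, Ci, Cplus, Cmult; simpl; f_equal; ring).
  eapply Rle_trans; [apply Cmod_triangle|].
  rewrite Cmod_mult, Cmod_Ci, !Cmod_R. lra.
Qed.

Lemma Rabs_Re_le (z : C) : Rabs (Re z) <= Cmod z.
Proof. apply re_le_Cmod. Qed.

Lemma Rabs_Im_le (z : C) : Rabs (Im z) <= Cmod z.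
Proof.
  generalize (Rmax_Cmod z) (Rmax_r (Rabs (fst z)) (Rabs (snd z))). unfold Im. lra.
Qed.

Lemma Rder_pair (f g : R -> R) t l m : is_derive f t l -> is_derive g t m ->
  Rder (fun x => (f x, g x)) t (l, m).
Proof.
  intros Hf Hg.
  assert (E : forall a b : R, (a, b) = (RtoC a + Ci * RtoC b)%C)
    by (intros; unfold RtoC, Ci, Cplus, Cmult; simpl; f_equal; ring).
  rewrite E.
  refine (Der_ext_loc _ _ _ _ _ _ 1 Rlt_0_1 _ _
    (Der_plus _ _ _ _ _ _ _ (Rder_RtoC _ _ _ Hf) (Der_scal _ _ Ci _ _ _ (Rder_RtoC _ _ _ Hg))));
  intros; cbv beta; now rewrite E.
Qed.

Lemma Rder_Re (f : R -> C) t l : Rder f t l -> is_derive (fun x => Re (f x)) t (Re l).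
Proof.
  intros H. apply is_derive_Reals. intros eps He.
  destruct (H (eps / 2)) as (d & Hd & Hf); [lra|].
  exists (mkposreal d Hd). intros h Nh Hh. simpl in Hh.
  specialize (Hf h). rewrite Cmod_R in Hf. specialize (Hf Hh).
  replace ((Re (f (t + h)) - Re (f t)) / h - Re l)
    with (Re (f (t + h)%R - f t - l * h)%C / h).
  2:{ destruct (f (t+h)), (f t), l. unfold Re, Cminus, Cplus, Copp, Cmult, RtoC; simpl. field; exact Nh. }
  unfold Rdiv. rewrite Rabs_mult, Rabs_inv.
  assert (0 < Rabs h) by now apply Rabs_pos_lt.
  apply Rmult_lt_reg_r with (Rabs h); [assumption|].
  rewrite Rmult_assoc, Rinv_l by lra. rewrite Rmult_1_r.
  eapply Rle_lt_trans; [apply Rabs_Re_le|]. eapply Rle_lt_trans; [exact Hf|].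
  apply Rmult_lt_compat_r; lra.
Qed.

(* The real mean value theorem applied to [Re (conj (f b - f a) * f)]. *)
Lemma Rder_mean_value (f f' : R -> C) (a b M : R) : a <= b ->
  (forall t, a <= t <= b -> Rder f t (f' t)) ->
  (forall t, a <= t <= b -> Cmod (f' t) <= M) ->
  Cmod (f b - f a) <= M * (b - a).
Proof.
  intros Hab Hd HM. set (c := Cconj (f b - f a)).
  destruct (MVT_gen (fun t => Re (c * f t)%C) a b (fun t => Re (c * f' t)%C)) as (x & Hx & E).
  - intros x Hx. rewrite Rmin_left, Rmax_right in Hx by lra.
    apply Rder_Re, Der_scal, Hd. lra.
  - intros x Hx. rewrite Rmin_left, Rmax_right in Hx by lra.
    apply continuity_pt_filterlim, (ex_derive_continuous (fun t => Re (c * f t)%C)).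
    eexists. apply Rder_Re, Der_scal, Hd. lra.
  - rewrite Rmin_left, Rmax_right in Hx by lra.
    assert (E2 : Re (c * f b)%C - Re (c * f a)%C = Cmod (f b - f a) * Cmod (f b - f a)).
    { replace (Cmod (f b - f a) * Cmod (f b - f a)) with (Cmod (f b - f a) ^ 2) by ring.
      unfold c. rewrite Cmod2_alt. destruct (f b), (f a).
      unfold Cconj, Re, Im, Cminus, Cplus, Copp, Cmult; simpl. ring. }
    rewrite E2 in E.
    assert (B : Re (c * f' x)%C <= Cmod (f b - f a) * M).
    { eapply Rle_trans; [apply Rle_abs|]. eapply Rle_trans; [apply Rabs_Re_le|].
      rewrite Cmod_mult. unfold c. rewrite Cmod_conj.
      apply Rmult_le_compat_l; [apply Cmod_ge_0|now apply HM]. }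
    assert (M0 : 0 <= M) by (eapply Rle_trans; [apply Cmod_ge_0|apply (HM x Hx)]).
    destruct (Req_dec (Cmod (f b - f a)) 0) as [->|N].
    + apply Rmult_le_pos; lra.
    + pose proof (Cmod_ge_0 (f b - f a)).
      apply Rmult_le_reg_l with (Cmod (f b - f a)); [lra|]. rewrite E.
      rewrite <- Rmult_assoc. apply Rmult_le_compat_r; lra.
Qed.

Lemma Rder_line (a b : C) t : Rder (fun t => a + t * b)%C t b.
Proof.
  assert (H := Der_plus _ _ _ _ t _ _ (Der_const Rplus RtoC a t) (Der_scal _ _ b _ _ _ (Rder_id t))).
  cbv beta in H. replace (0 + b * 1)%C with b in H by ring.
  refine (Der_ext_loc _ _ _ _ _ _ 1 Rlt_0_1 _ _ H); intros; cbv beta; ring.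
Qed.

(** Restriction to the segment reduces this to the real parameter. With [M = 0] it becomes the
    principle that a vanishing derivative along the segment forces equal end values, and it is used
    several times in that form. *)
Lemma Cder_mean_value (F f : C -> C) (a b : C) (M : R) :
  (forall t, 0 <= t <= 1 -> Cder F (a + t * (b - a))%C (f (a + t * (b - a))%C)) ->
  (forall t, 0 <= t <= 1 -> Cmod (f (a + t * (b - a))%C) <= M) ->
  Cmod (F b - F a) <= M * Cmod (b - a).
Proof.
  intros Hd HM.
  assert (H := Rder_mean_value (fun t => F (a + t * (b - a))%C)
    (fun t => f (a + t * (b - a))%C * (b - a))%C 0 1 (M * Cmod (b - a)) Rle_0_1).
  cbv beta in H. rewrite Rminus_0_r, Rmult_1_r in H.
  replace (a + 1 * (b - a))%C with b in H by ring.
  replace (a + 0 * (b - a))%C with a in H by ring.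
  apply H.
  - intros t Ht. apply (Der_comp _ _ F); [now apply Hd|apply Rder_line].
  - intros t Ht. rewrite Cmod_mult. apply Rmult_le_compat_r; [apply Cmod_ge_0|now apply HM].
Qed.

(** * The complex exponential and its Taylor remainders *)

Lemma Cexp_add (a b : C) : Cexp (a + b) = (Cexp a * Cexp b)%C.
Proof.
  destruct a as [x y], b as [u v]. unfold Cexp, Cplus, Cmult, Re, Im; simpl.
  rewrite exp_plus, cos_plus, sin_plus. f_equal; ring.
Qed.

Lemma Cexp_0 : Cexp 0 = 1.
Proof. unfold Cexp, RtoC, Re, Im; simpl. rewrite exp_0, cos_0, sin_0. f_equal; ring. Qed.

Lemma Cmod_Cexp (z : C) : Cmod (Cexp z) = exp (Re z).
Proof.
  unfold Cmod, Cexp; simpl.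
  replace (_ + _) with (Rsqr (exp (Re z)) * (Rsqr (sin (Im z)) + Rsqr (cos (Im z)))) by (unfold Rsqr; ring).
  rewrite sin2_cos2, Rmult_1_r. apply sqrt_Rsqr, Rlt_le, exp_pos.
Qed.

Lemma Cexp_neq_0 (z : C) : Cexp z <> 0.
Proof. apply Cmod_gt_0. rewrite Cmod_Cexp. apply exp_pos. Qed.

Lemma Cexp_opp (z : C) : Cexp (- z) = (/ Cexp z)%C.
Proof.
  assert (E : (Cexp (- z) * Cexp z)%C = 1).
  { rewrite <- Cexp_add. replace (- z + z)%C with (RtoC 0) by ring. apply Cexp_0. }
  pose proof (Cexp_neq_0 z) as N.
  replace (Cexp (- z)) with (Cexp (- z) * Cexp z * / Cexp z)%C by (field; exact N).
  rewrite E. ring.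
Qed.

Lemma Cexp_RtoC (x : R) : Cexp x = RtoC (exp x).
Proof. unfold Cexp, RtoC, Re, Im; simpl. rewrite cos_0, sin_0. f_equal; ring. Qed.

Lemma Rder_Cexp_line (w : C) t : Rder (fun t => Cexp (t * w)%C) t (w * Cexp (t * w))%C.
Proof.
  destruct w as [u v].
  assert (H : Rder (fun t => (exp (t * u) * cos (t * v), exp (t * u) * sin (t * v))) t
     (u * (exp (t * u) * cos (t * v)) - v * (exp (t * u) * sin (t * v)),
      u * (exp (t * u) * sin (t * v)) + v * (exp (t * u) * cos (t * v)))).
  { apply Rder_pair; auto_derive; trivial; ring. }
  assert (E : forall t : R, Cexp (t * (u, v))%C = (exp (t * u) * cos (t * v), exp (t * u) * sin (t * v))).
  { intros s. unfold Cexp, Cmult, RtoC, Re, Im; simpl.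
    replace (s * u - 0 * v) with (s * u) by ring. replace (s * v + 0 * u) with (s * v) by ring. reflexivity. }
  replace ((u, v) * Cexp (t * (u, v)))%C with
     (u * (exp (t * u) * cos (t * v)) - v * (exp (t * u) * sin (t * v)),
      u * (exp (t * u) * sin (t * v)) + v * (exp (t * u) * cos (t * v)))
    by (rewrite E; reflexivity).
  refine (Der_ext_loc _ _ _ _ _ _ 1 Rlt_0_1 _ _ H); intros; symmetry; apply E.
Qed.

Lemma Re_le_Cmod (z : C) : Re z <= Cmod z.
Proof. eapply Rle_trans; [apply Rle_abs|apply Rabs_Re_le]. Qed.

Lemma Cmod_scal_le (t : R) (w : C) : 0 <= t <= 1 -> Cmod (t * w) <= Cmod w.
Proof.
  intros Ht. rewrite Cmod_mult, Cmod_R, Rabs_pos_eq by lra.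
  generalize (Cmod_ge_0 w). nra.
Qed.

Lemma exp_le (x y : R) : x <= y -> exp x <= exp y.
Proof. intros [H|H]; [now apply Rlt_le, exp_increasing|subst; lra]. Qed.

Lemma Cexp_sub1_le (w : C) : Cmod (Cexp w - 1) <= Cmod w * exp (Cmod w).
Proof.
  assert (H := Rder_mean_value (fun t => Cexp (t * w)%C) (fun t => w * Cexp (t * w))%C 0 1
    (Cmod w * exp (Cmod w)) Rle_0_1 (fun t _ => Rder_Cexp_line w t)).
  cbv beta in H. rewrite Rminus_0_r, Rmult_1_r in H.
  replace (1 * w)%C with w in H by ring. replace (0 * w)%C with (RtoC 0) in H by ring.
  rewrite Cexp_0 in H. apply H. intros t Ht.
  rewrite Cmod_mult, Cmod_Cexp. apply Rmult_le_compat_l; [apply Cmod_ge_0|].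
  apply exp_le. eapply Rle_trans; [apply Re_le_Cmod|now apply Cmod_scal_le].
Qed.

(** * Integrals of complex-valued functions *)

(** Argued along the real parameter [t] in [Cexp (t * w)], because the complex derivative of [Cexp]
    is itself deduced from this quadratic bound. *)
Lemma Cexp_sub2_le (w : C) : Cmod (Cexp w - 1 - w) <= Cmod w ^ 2 * exp (Cmod w).
Proof.
  assert (H := Rder_mean_value (fun t => Cexp (t * w)%C - t * w)%C
    (fun t => w * Cexp (t * w) - w)%C 0 1 (Cmod w ^ 2 * exp (Cmod w)) Rle_0_1).
  cbv beta in H. rewrite Rminus_0_r, Rmult_1_r in H.
  replace (1 * w)%C with w in H by ring. replace (0 * w)%C with (RtoC 0) in H by ring.
  rewrite Cexp_0 in H. replace (Cexp w - w - (1 - 0))%C with (Cexp w - 1 - w)%C in H by ring.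
  apply H.
  - intros t _. apply Der_minus; [apply Rder_Cexp_line|].
    assert (L := Rder_line 0 w t).
    refine (Der_ext_loc _ _ _ _ _ _ 1 Rlt_0_1 _ _ L); intros; cbv beta; ring.
  - intros t Ht. replace (w * Cexp (t * w) - w)%C with (w * (Cexp (t * w) - 1))%C by ring.
    rewrite Cmod_mult. simpl. rewrite Rmult_1_r, Rmult_assoc.
    apply Rmult_le_compat_l; [apply Cmod_ge_0|].
    eapply Rle_trans; [apply Cexp_sub1_le|].
    pose proof (Cmod_scal_le t w Ht).
    apply Rmult_le_compat; [apply Cmod_ge_0|apply Rlt_le, exp_pos|assumption|now apply exp_le].
Qed.

Lemma Cder_Cexp (z : C) : Cder Cexp z (Cexp z).
Proof.
  intros eps He. pose proof (proj1 (Cmod_gt_0 _) (Cexp_neq_0 z)) as Hp.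
  set (r := Cmod (Cexp z)) in *. pose proof (exp_pos 1) as He1.
  exists (Rmin 1 (eps / (r * exp 1))). split.
  { apply Rmin_pos; [lra|]. apply Rdiv_lt_0_compat; [lra|]. now apply Rmult_lt_0_compat. }
  intros h Hh.
  assert (Hh1 : Cmod h < 1) by exact (lt_Rmin_l _ _ _ Hh).
  assert (Hh2 : Cmod h < eps / (r * exp 1)) by exact (lt_Rmin_r _ _ _ Hh).
  replace (Cexp (z + h) - Cexp z - Cexp z * h)%C with (Cexp z * (Cexp h - 1 - h))%C
    by (rewrite Cexp_add; ring).
  rewrite Cmod_mult. fold r.
  apply Rle_trans with (r * (Cmod h ^ 2 * exp 1)).
  - apply Rmult_le_compat_l; [lra|]. eapply Rle_trans; [apply Cexp_sub2_le|].
    apply Rmult_le_compat_l; [apply pow2_ge_0|]. apply exp_le. lra.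
  - apply Rmult_lt_compat_l with (r := r * exp 1) in Hh2; [|now apply Rmult_lt_0_compat].
    replace (r * exp 1 * (eps / (r * exp 1))) with eps in Hh2 by (field; lra).
    replace (r * (Cmod h ^ 2 * exp 1)) with ((r * exp 1 * Cmod h) * Cmod h) by ring.
    apply Rmult_le_compat_r; [apply Cmod_ge_0|lra].
Qed.

Lemma Cder_div_const (F : C -> C) z l (c : C) : c <> 0 -> Cder F z l -> Cder (fun x => F x / c)%C z (l / c)%C.
Proof.
  intros Hc H. replace (l / c)%C with (/ c * l)%C by (field; exact Hc).
  refine (Der_ext_loc _ _ _ _ _ _ 1 Rlt_0_1 _ _ (Der_scal _ _ (/ c)%C _ _ _ H));
  intros; cbv beta; field; exact Hc.
Qed.

Lemma RtoC_neq_0 (x : R) : x <> 0 -> RtoC x <> 0.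
Proof. intros H E. apply RtoC_inj in E. lra. Qed.

(** Each Taylor remainder of [Cexp] is the derivative of the next, so the mean value inequality on
    the segment from 0 to [w] raises the order by one. The factorials are given up, and
    [exp (Cmod w)] covers all intermediate points. *)
Lemma Taylor_step (F f : C -> C) (n : nat) (w : C) :
  (forall z, Cder F z (f z)) -> F 0 = 0 ->
  (forall z, Cmod (f z) <= Cmod z ^ n * exp (Cmod z)) ->
  Cmod (F w) <= Cmod w ^ S n * exp (Cmod w).
Proof.
  intros Hd H0 Hf.
  assert (H := Cder_mean_value F f 0 w (Cmod w ^ n * exp (Cmod w)) (fun t _ => Hd _)).
  rewrite H0 in H. replace (F w - 0)%C with (F w) in H by ring.
  replace (w - 0)%C with w in H by ring.
  replace (Cmod w ^ S n * exp (Cmod w)) with (Cmod w ^ n * exp (Cmod w) * Cmod w) by (simpl; ring).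
  apply H. intros t Ht. eapply Rle_trans; [apply Hf|].
  replace (0 + t * w)%C with (t * w)%C by ring.
  pose proof (Cmod_scal_le t w Ht).
  apply Rmult_le_compat; [apply pow_le, Cmod_ge_0|apply Rlt_le, exp_pos| |now apply exp_le].
  apply pow_incr. split; [apply Cmod_ge_0|assumption].
Qed.

Lemma Cder_Cexp_sub2 z : Cder (fun z => Cexp z - 1 - z)%C z (Cexp z - 1)%C.
Proof.
  replace (Cexp z - 1)%C with (Cexp z - 0 - 1)%C by ring.
  apply Der_minus; [|apply Cder_id]. apply Der_minus; [apply Cder_Cexp|apply Der_const].
Qed.

Lemma Cexp_sub3_le (w : C) : Cmod (Cexp w - 1 - w - w * w / 2) <= Cmod w ^ 3 * exp (Cmod w).
Proof.
  apply (Taylor_step (fun w => Cexp w - 1 - w - w * w / 2)%C (fun z => Cexp z - 1 - z)%C).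
  - intros z. replace (Cexp z - 1 - z)%C with (Cexp z - 1 - (1 * z + z * 1) / 2)%C.
    2:{ field. }
    apply Der_minus; [apply Cder_Cexp_sub2|].
    apply Cder_div_const; [apply RtoC_neq_0; lra|]. apply Der_mult; apply Cder_id.
  - rewrite Cexp_0. field.
  - intros; apply Cexp_sub2_le.
Qed.

Lemma Cexp_sub4_le (w : C) :
  Cmod (Cexp w - 1 - w - w * w / 2 - w * w * w / 6) <= Cmod w ^ 4 * exp (Cmod w).
Proof.
  assert (N2 : RtoC 2 <> 0) by (apply RtoC_neq_0; lra).
  assert (N6 : RtoC 6 <> 0) by (apply RtoC_neq_0; lra).
  assert (E62 : RtoC 6 = (3 * 2)%C) by (rewrite <- RtoC_mult; f_equal; ring).
  assert (N3 : RtoC 3 <> 0) by (apply RtoC_neq_0; lra).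
  apply (Taylor_step (fun w => Cexp w - 1 - w - w * w / 2 - w * w * w / 6)%C
           (fun z => Cexp z - 1 - z - z * z / 2)%C).
  - intros z.
    replace (Cexp z - 1 - z - z * z / 2)%C
      with (Cexp z - 1 - (1 * z + z * 1) / 2 - ((1 * z + z * 1) * z + z * z * 1) / 6)%C.
    2:{ field. }
    apply Der_minus; [apply Der_minus; [apply Cder_Cexp_sub2|]|].
    + apply Cder_div_const; [exact N2|]. apply Der_mult; apply Cder_id.
    + apply Cder_div_const; [exact N6|]. apply (Der_mult _ _ (fun z => z * z)%C (fun z => z)); [|apply Cder_id].
      apply Der_mult; apply Cder_id.
  - rewrite Cexp_0. field.
  - intros; apply Cexp_sub3_le.
Qed.

(** * Differentiability predicates and integrals over compact intervals *)

Definition CI (f : R -> C) (a b : R) : C := RInt (V := C_R_CompleteNormedModule) f a b.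

(** Differentiability with the derivative left unnamed takes the place of continuity as the
    regularity condition on integrands: all of them are differentiable, and closure under algebra
    and composition comes from the rules for [Der]. *)
Definition Rdb (f : R -> C) (t : R) : Prop := exists l, Rder f t l.
Definition Rdb_on (f : R -> C) (a b : R) : Prop := forall t, a <= t <= b -> Rdb f t.
Definition Cdb (f : C -> C) (z : C) : Prop := exists l, Cder f z l.

Lemma Rdb_continuous (f : R -> C) t : Rdb f t -> continuous (U := C_R_NormedModule) f t.
Proof.
  intros [l H]. apply (ex_derive_continuous (V := C_R_NormedModule)). exists l. now apply Rder_is_derive.
Qed.

Lemma Rdb_ext (f g : R -> C) t : (forall x, f x = g x) -> Rdb f t -> Rdb g t.
Proof.
  intros E [l H]. exists l.
  refine (Der_ext_loc _ _ _ _ _ _ 1 Rlt_0_1 _ _ H); intros; apply E.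
Qed.

Lemma Rdb_ext_loc (f g : R -> C) t d : 0 < d -> (forall x, Rabs (x - t) < d -> f x = g x) -> Rdb f t -> Rdb g t.
Proof.
  intros Hd E [l H]. exists l.
  refine (Der_ext_loc _ _ _ _ _ _ d Hd _ _ H).
  - intros h Hh. rewrite Cmod_R in Hh. apply E. replace (t + h - t) with h by ring. exact Hh.
  - apply E. replace (t - t) with 0 by ring. now rewrite Rabs_R0.
Qed.

Lemma Rdb_const (c : C) t : Rdb (fun _ => c) t.
Proof. eexists; apply Der_const. Qed.
Lemma Rdb_RtoC t : Rdb RtoC t.
Proof. eexists; apply Rder_id. Qed.
Lemma Rdb_real (f : R -> R) t : ex_derive f t -> Rdb (fun t => RtoC (f t)) t.
Proof. intros [l H]; eexists; apply Rder_RtoC, H. Qed.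
Lemma Rdb_plus (f g : R -> C) t : Rdb f t -> Rdb g t -> Rdb (fun t => f t + g t)%C t.
Proof. intros [l H] [m K]; eexists; apply Der_plus; eassumption. Qed.
Lemma Rdb_minus (f g : R -> C) t : Rdb f t -> Rdb g t -> Rdb (fun t => f t - g t)%C t.
Proof. intros [l H] [m K]; eexists; apply Der_minus; eassumption. Qed.
Lemma Rdb_mult (f g : R -> C) t : Rdb f t -> Rdb g t -> Rdb (fun t => f t * g t)%C t.
Proof. intros [l H] [m K]; eexists; apply Der_mult; eassumption. Qed.
Lemma Rdb_inv (f : R -> C) t : f t <> 0 -> Rdb f t -> Rdb (fun t => / f t)%C t.
Proof. intros N [l H]; eexists; apply Der_inv; eassumption. Qed.
Lemma Rdb_div (f g : R -> C) t : g t <> 0 -> Rdb f t -> Rdb g t -> Rdb (fun t => f t / g t)%C t.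
Proof. intros N [l H] [m K]; eexists; apply Der_div; eassumption. Qed.
Lemma Rdb_comp (F : C -> C) (f : R -> C) t : Cdb F (f t) -> Rdb f t -> Rdb (fun t => F (f t)) t.
Proof. intros [l H] [m K]; eexists; apply (Der_comp _ _ F); eassumption. Qed.

Lemma Cdb_const (c : C) t : Cdb (fun _ => c) t.
Proof. eexists; apply Der_const. Qed.
Lemma Cdb_id t : Cdb (fun z => z) t.
Proof. eexists; apply Cder_id. Qed.
Lemma Cdb_plus (f g : C -> C) t : Cdb f t -> Cdb g t -> Cdb (fun t => f t + g t)%C t.
Proof. intros [l H] [m K]; eexists; apply Der_plus; eassumption. Qed.
Lemma Cdb_minus (f g : C -> C) t : Cdb f t -> Cdb g t -> Cdb (fun t => f t - g t)%C t.
Proof. intros [l H] [m K]; eexists; apply Der_minus; eassumption. Qed.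
Lemma Cdb_mult (f g : C -> C) t : Cdb f t -> Cdb g t -> Cdb (fun t => f t * g t)%C t.
Proof. intros [l H] [m K]; eexists; apply Der_mult; eassumption. Qed.
Lemma Cdb_inv (f : C -> C) t : f t <> 0 -> Cdb f t -> Cdb (fun t => / f t)%C t.
Proof. intros N [l H]; eexists; apply Der_inv; eassumption. Qed.
Lemma Cdb_div (f g : C -> C) t : g t <> 0 -> Cdb f t -> Cdb g t -> Cdb (fun t => f t / g t)%C t.
Proof. intros N [l H] [m K]; eexists; apply Der_div; eassumption. Qed.
Lemma Cdb_comp (F f : C -> C) t : Cdb F (f t) -> Cdb f t -> Cdb (fun t => F (f t)) t.
Proof. intros [l H] [m K]; eexists; apply (Der_comp _ _ F); eassumption. Qed.
Lemma Cdb_ext (f g : C -> C) t : (forall x, f x = g x) -> Cdb f t -> Cdb g t.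
Proof.
  intros E [l H]. exists l.
  refine (Der_ext_loc _ _ _ _ _ _ 1 Rlt_0_1 _ _ H); intros; apply E.
Qed.
Lemma Cdb_ext_loc (f g : C -> C) z d : 0 < d -> (forall x, Cmod (x - z) < d -> f x = g x) -> Cdb f z -> Cdb g z.
Proof.
  intros Hd E [l H]. exists l.
  refine (Der_ext_loc _ _ _ _ _ _ d Hd _ _ H).
  - intros h Hh. apply E. replace (z + h - z)%C with h by ring. exact Hh.
  - apply E. replace (z - z)%C with (RtoC 0) by ring. now rewrite Cmod_0.
Qed.
Lemma Cdb_Cexp z : Cdb Cexp z.
Proof. eexists; apply Cder_Cexp. Qed.

Lemma CI_correct f a b : a <= b -> Rdb_on f a b ->
  is_RInt (V := C_R_NormedModule) f a b (CI f a b).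
Proof.
  intros Hab H. apply (RInt_correct (V := C_R_CompleteNormedModule)).
  apply (ex_RInt_continuous (V := C_R_CompleteNormedModule)). intros z Hz.
  rewrite Rmin_left, Rmax_right in Hz by lra. apply Rdb_continuous, H, Hz.
Qed.

Lemma CI_unique f a b l : is_RInt (V := C_R_NormedModule) f a b l -> CI f a b = l.
Proof. apply (is_RInt_unique (V := C_R_CompleteNormedModule)). Qed.

Lemma CI_ext f g a b : a <= b -> (forall t, a < t < b -> f t = g t) -> CI f a b = CI g a b.
Proof.
  intros Hab E. apply (RInt_ext (V := C_R_CompleteNormedModule)). intros x Hx.
  rewrite Rmin_left, Rmax_right in Hx by lra. now apply E.
Qed.

Lemma CI_plus f g a b : a <= b -> Rdb_on f a b -> Rdb_on g a b ->
  CI (fun t => f t + g t)%C a b = (CI f a b + CI g a b)%C.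
Proof.
  intros Hab Hf Hg. apply CI_unique. apply (is_RInt_plus (V := C_R_NormedModule)); now apply CI_correct.
Qed.

Lemma CI_minus f g a b : a <= b -> Rdb_on f a b -> Rdb_on g a b ->
  CI (fun t => f t - g t)%C a b = (CI f a b - CI g a b)%C.
Proof.
  intros Hab Hf Hg. apply CI_unique. apply (is_RInt_minus (V := C_R_NormedModule)); now apply CI_correct.
Qed.

(** The underlying integral is linear over the reals, so a complex factor is treated through real
    and imaginary parts. *)
Lemma CI_scal (c : C) f a b : a <= b -> Rdb_on f a b ->
  CI (fun t => c * f t)%C a b = (c * CI f a b)%C.
Proof.
  intros Hab Hf. apply CI_unique. pose proof (CI_correct f a b Hab Hf) as H.
  pose proof (is_RInt_fct_extend_fst (U := R_NormedModule) (V := R_NormedModule) _ _ _ _ H) as H1.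
  pose proof (is_RInt_fct_extend_snd (U := R_NormedModule) (V := R_NormedModule) _ _ _ _ H) as H2.
  apply (is_RInt_fct_extend_pair (U := R_NormedModule) (V := R_NormedModule)).
  - apply (is_RInt_minus (V := R_NormedModule)); apply (is_RInt_scal (V := R_NormedModule)); assumption.
  - apply (is_RInt_plus (V := R_NormedModule)); apply (is_RInt_scal (V := R_NormedModule)); assumption.
Qed.

Lemma CI_bound f a b M : a <= b -> Rdb_on f a b ->
  (forall t, a <= t <= b -> Cmod (f t) <= M) -> Cmod (CI f a b) <= (b - a) * M.
Proof.
  intros Hab Hf HM. rewrite <- norm_C_R.
  apply (norm_RInt_le_const (V := C_R_NormedModule) f a b); [exact Hab| |now apply CI_correct].
  intros x Hx. rewrite norm_C_R. now apply HM.
Qed.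

Lemma CI_le f g a b lg : a <= b -> Rdb_on f a b ->
  (forall t, a <= t <= b -> Cmod (f t) <= g t) -> is_RInt g a b lg -> Cmod (CI f a b) <= lg.
Proof.
  intros Hab Hf HM Hg. rewrite <- norm_C_R.
  apply (norm_RInt_le (V := C_R_NormedModule) f g a b); [exact Hab| |now apply CI_correct|exact Hg].
  intros x Hx. rewrite norm_C_R. now apply HM.
Qed.

Lemma CI_chasles f a b c : a <= b <= c -> Rdb_on f a c ->
  CI f a c = (CI f a b + CI f b c)%C.
Proof.
  intros Hab Hf. apply CI_unique. apply (is_RInt_Chasles (V := C_R_NormedModule)) with b;
  apply CI_correct; try lra; intros t Ht; apply Hf; lra.
Qed.

Lemma CI_FTC F f a b : a <= b -> (forall t, a <= t <= b -> Rder F t (f t)) -> Rdb_on f a b ->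
  CI f a b = (F b - F a)%C.
Proof.
  intros Hab HF Hf. apply CI_unique. apply (is_RInt_derive (V := C_R_CompleteNormedModule)); intros x Hx;
  rewrite Rmin_left, Rmax_right in Hx by lra.
  - now apply Rder_is_derive, HF.
  - apply Rdb_continuous, Hf, Hx.
Qed.

Lemma CI_const (c : C) a b : CI (fun _ => c) a b = ((b - a)%R * c)%C.
Proof.
  apply CI_unique. rewrite <- scal_R_Cmult. apply (is_RInt_const (V := C_R_NormedModule)).
Qed.

Lemma CI_comp_lin f u v a b : 0 < u -> a <= b -> Rdb_on f (u * a + v) (u * b + v) ->
  CI (fun t => u * f (u * t + v)%R)%C a b = CI f (u * a + v) (u * b + v).
Proof.
  intros Hu Hab Hf. apply CI_unique.
  eapply is_RInt_ext; [|apply (is_RInt_comp_lin (V := C_R_NormedModule) f u v a b)].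
  - intros x _. cbv beta. apply scal_R_Cmult.
  - apply CI_correct; [nra|exact Hf].
Qed.

(** * Goursat's theorem *)

Lemma real_Cauchy_limit (u : nat -> R) (e : nat -> R) :
  is_lim_seq e 0 -> (forall n m, (n <= m)%nat -> Rabs (u m - u n) <= e n) ->
  exists p : R, is_lim_seq u p.
Proof.
  intros He H.
  assert (X : ex_finite_lim_seq u).
  { apply ex_lim_seq_cauchy_corr. intros eps.
    apply is_lim_seq_spec in He. destruct (He (pos_div_2 eps)) as [N HN].
    exists N. intros n m Hn Hm.
    specialize (HN N (Nat.le_refl _)). simpl in HN. rewrite Rminus_0_r in HN.
    pose proof (H N n Hn). pose proof (H N m Hm). pose proof (Rle_abs (e N)).
    replace (u n - u m) with ((u n - u N) - (u m - u N)) by ring.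
    eapply Rle_lt_trans; [apply Rabs_triang|]. rewrite Rabs_Ropp. lra. }
  destruct X as [p Hp]. now exists p.
Qed.

Lemma Cmod_dist_lim (u : nat -> C) (p q : C) (B : R) :
  is_lim_seq (fun n => Re (u n)) (Re p) -> is_lim_seq (fun n => Im (u n)) (Im p) ->
  (exists N, forall n, (N <= n)%nat -> Cmod (u n - q) <= B) -> Cmod (p - q) <= B.
Proof.
  intros Hr Hi [N H].
  destruct (Rle_or_lt (Cmod (p - q)) B) as [|L]; [assumption|exfalso].
  set (d := (Cmod (p - q) - B) / 2). assert (Hd : 0 < d) by (unfold d; lra).
  apply is_lim_seq_spec in Hr, Hi.
  destruct (Hr (mkposreal d Hd)) as [N1 H1]. destruct (Hi (mkposreal d Hd)) as [N2 H2].
  set (n := (N + N1 + N2)%nat).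
  specialize (H1 n ltac:(unfold n; lia)). specialize (H2 n ltac:(unfold n; lia)).
  specialize (H n ltac:(unfold n; lia)). simpl in H1, H2.
  assert (A : Cmod (p - u n) < 2 * d).
  { eapply Rle_lt_trans; [apply Cmod_le_abs|].
    replace (Re (p - u n)) with (- (Re (u n) - Re p)) by (unfold Re; simpl; ring).
    replace (Im (p - u n)) with (- (Im (u n) - Im p)) by (unfold Im; simpl; ring).
    rewrite !Rabs_Ropp. lra. }
  generalize (Cmod_triangle (p - u n) (u n - q)).
  replace (p - u n + (u n - q))%C with (p - q)%C by ring. unfold d in *. lra.
Qed.

(** The error sequence is kept explicit so that the limit inherits the rate [e n]. This rate locates
    the limit point in Goursat's argument and bounds the value of an improper integral. *)
Lemma C_Cauchy_limit (u : nat -> C) (e : nat -> R) :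
  is_lim_seq e 0 -> (forall n m, (n <= m)%nat -> Cmod (u m - u n) <= e n) ->
  exists p : C, forall n, Cmod (p - u n) <= e n.
Proof.
  intros He H.
  destruct (real_Cauchy_limit (fun n => Re (u n)) e He) as [a Ha].
  { intros n m Hnm. specialize (H n m Hnm). generalize (Rabs_Re_le (u m - u n)).
    replace (Re (u m - u n)) with (Re (u m) - Re (u n)) by (unfold Re; simpl; ring). lra. }
  destruct (real_Cauchy_limit (fun n => Im (u n)) e He) as [b Hb].
  { intros n m Hnm. specialize (H n m Hnm). generalize (Rabs_Im_le (u m - u n)).
    replace (Im (u m - u n)) with (Im (u m) - Im (u n)) by (unfold Im; simpl; ring). lra. }
  exists (a, b). intros n. apply (Cmod_dist_lim u); [exact Ha|exact Hb|].
  exists n. intros m Hm. now apply H.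
Qed.

Definition cdisc (c : C) (r : R) (z : C) : Prop := Cmod (z - c) < r.
Definition holo_on (D : C -> Prop) (f : C -> C) : Prop := forall z, D z -> Cdb f z.

Lemma seg_dist (a b c : C) (t M : R) : 0 <= t <= 1 ->
  Cmod (a - c) <= M -> Cmod (b - c) <= M -> Cmod (a + t * (b - a) - c) <= M.
Proof.
  intros Ht Ha Hb.
  replace (a + t * (b - a) - c)%C with ((1 - t)%R * (a - c) + t * (b - c))%C
    by (rewrite RtoC_minus; ring).
  eapply Rle_trans; [apply Cmod_triangle|]. rewrite !Cmod_mult, !Cmod_R, !Rabs_pos_eq by lra.
  nra.
Qed.

Lemma disc_seg (a b c : C) (t r : R) : 0 <= t <= 1 ->
  cdisc c r a -> cdisc c r b -> cdisc c r (a + t * (b - a)).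
Proof.
  unfold cdisc. intros Ht Ha Hb. eapply Rle_lt_trans.
  - apply seg_dist; [exact Ht|apply Rmax_l|apply Rmax_r].
  - now apply Rmax_lub_lt.
Qed.

Definition on_seg (P : C -> Prop) (a b : C) : Prop :=
  forall t, 0 <= t <= 1 -> P (a + t * (b - a))%C.

Definition Iseg (f : C -> C) (a b : C) : C :=
  ((b - a) * CI (fun t => f (a + t * (b - a))%C) 0 1)%C.

Lemma Rdb_line (a b : C) t : Rdb (fun t => a + t * b)%C t.
Proof. eexists; apply Rder_line. Qed.

Lemma Rdb_seg (f : C -> C) a b : on_seg (Cdb f) a b -> Rdb_on (fun t => f (a + t * (b - a))%C) 0 1.
Proof.
  intros H t Ht. apply (Rdb_comp f); [now apply H|apply Rdb_line].
Qed.

Lemma Iseg_split f a b : on_seg (Cdb f) a b ->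
  Iseg f a b = (Iseg f a ((a + b) / 2) + Iseg f ((a + b) / 2) b)%C.
Proof.
  intros H. assert (Hs := Rdb_seg f a b H). unfold Iseg.
  set (g := fun t : R => f (a + t * (b - a))%C) in *.
  rewrite (CI_chasles g 0 (1/2) 1) by (try exact Hs; lra).
  assert (E1 := CI_comp_lin g (1/2) 0 0 1 ltac:(lra) ltac:(lra)).
  assert (E2 := CI_comp_lin g (1/2) (1/2) 0 1 ltac:(lra) ltac:(lra)).
  replace (1/2*0+0) with 0 in E1 by ring. replace (1/2*1+0) with (1/2) in E1 by field.
  replace (1/2*0+1/2) with (1/2) in E2 by ring. replace (1/2*1+1/2) with 1 in E2 by field.
  rewrite <- E1 by (intros t Ht; apply Hs; lra).
  rewrite <- E2 by (intros t Ht; apply Hs; lra).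
  rewrite !CI_scal; try lra.
  2:{ intros t Ht. unfold g. apply (Rdb_ext (fun t : R => f ((a + / 2 * (b - a)) + t * (/ 2 * (b - a)))%C)).
      - intros x. f_equal. rewrite RtoC_plus, RtoC_mult, RtoC_div by lra. field.
      - apply (Rdb_comp f); [|apply Rdb_line].
        replace (a + / 2 * (b - a) + t * (/ 2 * (b - a)))%C with (a + (1/2*t+1/2)%R * (b - a))%C.
        + apply H. lra.
        + rewrite RtoC_plus, RtoC_mult, RtoC_div by lra. field. }
  2:{ intros t Ht. unfold g. apply (Rdb_ext (fun t : R => f (a + t * (/ 2 * (b - a)))%C)).
      - intros x. f_equal. rewrite RtoC_plus, RtoC_mult, RtoC_div by lra. field.
      - apply (Rdb_comp f); [|apply Rdb_line].
        replace (a + t * (/ 2 * (b - a)))%C with (a + (1/2*t)%R * (b - a))%C.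
        + apply H. lra.
        + rewrite RtoC_mult, RtoC_div by lra. field. }
  rewrite Cmult_plus_distr_l. f_equal.
  - rewrite Cmult_assoc. f_equal.
    + rewrite RtoC_div by lra. field.
    + apply CI_ext; [lra|]. intros t _. unfold g. f_equal.
      rewrite RtoC_plus, RtoC_mult, RtoC_div by lra. field.
  - rewrite Cmult_assoc. f_equal.
    + rewrite RtoC_div by lra. field.
    + apply CI_ext; [lra|]. intros t _. unfold g. f_equal.
      rewrite RtoC_plus, RtoC_mult, RtoC_div by lra. field.
Qed.

Lemma Iseg_swap f a b : on_seg (Cdb f) a b -> Iseg f b a = (- Iseg f a b)%C.
Proof.
  intros H. assert (Hs := Rdb_seg f a b H). unfold Iseg.
  set (g := fun t : R => f (a + t * (b - a))%C) in *.
  assert (E : CI (fun t : R => f (b + t * (a - b))%C) 0 1 = CI g 0 1).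
  { apply CI_unique.
    assert (X := is_RInt_comp_lin (V := C_R_NormedModule) g (-1) 1 0 1 (opp (CI g 0 1))).
    replace (-1 * 0 + 1) with 1 in X by ring. replace (-1 * 1 + 1) with 0 in X by ring.
    assert (Y := X (is_RInt_swap (V := C_R_NormedModule) _ _ _ _ (CI_correct g 0 1 Rle_0_1 Hs))).
    apply (is_RInt_opp (V := C_R_NormedModule)) in Y.
    replace (CI g 0 1) with (- - CI g 0 1)%C by ring.
    eapply is_RInt_ext; [|exact Y].
    intros x _. cbv beta. rewrite scal_R_Cmult.
    change ((- ((-1)%R * g (-1 * x + 1)%R) = f (b + x * (a - b)))%C).
    unfold g. replace (a + (-1 * x + 1)%R * (b - a))%C with (b + x * (a - b))%C.
    - ring.
    - rewrite RtoC_plus, RtoC_mult. ring. }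
  rewrite E. ring.
Qed.

Lemma on_seg_mono (P Q : C -> Prop) a b : (forall z, P z -> Q z) -> on_seg P a b -> on_seg Q a b.
Proof. intros H K t Ht. apply H, K, Ht. Qed.

Lemma Iseg_bound f a b M : on_seg (Cdb f) a b ->
  (forall t, 0 <= t <= 1 -> Cmod (f (a + t * (b - a))%C) <= M) ->
  Cmod (Iseg f a b) <= Cmod (b - a) * M.
Proof.
  intros H HM. unfold Iseg. rewrite Cmod_mult. apply Rmult_le_compat_l; [apply Cmod_ge_0|].
  eapply Rle_trans; [apply (CI_bound _ 0 1 M Rle_0_1)|lra]; [now apply Rdb_seg|exact HM].
Qed.

Lemma Iseg_plus f g a b : on_seg (Cdb f) a b -> on_seg (Cdb g) a b ->
  Iseg (fun z => f z + g z)%C a b = (Iseg f a b + Iseg g a b)%C.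
Proof.
  intros Hf Hg. unfold Iseg. rewrite CI_plus; [ring|lra|now apply Rdb_seg|now apply Rdb_seg].
Qed.

Lemma Iseg_FTC F f a b : on_seg (fun z => Cder F z (f z)) a b -> on_seg (Cdb f) a b ->
  Iseg f a b = (F b - F a)%C.
Proof.
  intros HF Hf. assert (Hs := Rdb_seg f a b Hf). unfold Iseg.
  rewrite <- CI_scal by (try lra; exact Hs).
  rewrite (CI_FTC (fun t => F (a + t * (b - a))%C)); [|lra| |].
  - replace (a + 1 * (b - a))%C with b by ring. replace (a + 0 * (b - a))%C with a by ring. reflexivity.
  - intros t Ht. rewrite Cmult_comm. apply (Der_comp _ _ F); [now apply HF|apply Rder_line].
  - intros t Ht. apply Rdb_mult; [apply Rdb_const|now apply Hs].
Qed.

Definition Tri (f : C -> C) (a b c : C) : C := (Iseg f a b + Iseg f b c + Iseg f c a)%C.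

Lemma half_seg (P : C -> Prop) a b : on_seg P a b -> P ((a + b) / 2)%C.
Proof.
  intros H. specialize (H (1/2)). replace (a + (1 / 2)%R * (b - a))%C with ((a + b) / 2)%C in H.
  - apply H; lra.
  - rewrite RtoC_div by lra. field.
Qed.

Lemma disc_on_seg c r a b : cdisc c r a -> cdisc c r b -> on_seg (cdisc c r) a b.
Proof. intros Ha Hb t Ht. now apply disc_seg. Qed.

Lemma Tri_split f (o : C) (r : R) a b c : holo_on (cdisc o r) f ->
  cdisc o r a -> cdisc o r b -> cdisc o r c ->
  Tri f a b c = (Tri f a ((a + b) / 2) ((c + a) / 2) + Tri f ((a + b) / 2) b ((b + c) / 2)
    + Tri f ((c + a) / 2) ((b + c) / 2) c + Tri f ((a + b) / 2) ((b + c) / 2) ((c + a) / 2))%C.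
Proof.
  intros Hf Ha Hb Hc. unfold Tri.
  assert (S : forall x y, cdisc o r x -> cdisc o r y -> on_seg (Cdb f) x y).
  { intros x y Hx Hy. apply (on_seg_mono (cdisc o r)); [exact Hf|now apply disc_on_seg]. }
  assert (M : forall x y, cdisc o r x -> cdisc o r y -> cdisc o r ((x + y) / 2)).
  { intros x y Hx Hy. apply half_seg. now apply disc_on_seg. }
  rewrite (Iseg_split f a b), (Iseg_split f b c), (Iseg_split f c a) by auto.
  rewrite (Iseg_swap f ((a + b) / 2) ((c + a) / 2)) by auto.
  rewrite (Iseg_swap f ((a + b) / 2) ((b + c) / 2)) by auto.
  rewrite (Iseg_swap f ((b + c) / 2) ((c + a) / 2)) by auto.
  ring.
Qed.

Definition triple : Type := (C * C * C)%type.

(** The triangle is cut into four by the midpoints, and a part is kept whose integral has at least a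
    quarter of the modulus. Three parts are tested and the medial triangle is the default;
    [largest_of_four] shows that it qualifies when the other three fail. *)
Definition tri_step (f : C -> C) (T : triple) : triple :=
  let '(a, b, c) := T in
  let m1 := ((a + b) / 2)%C in let m2 := ((b + c) / 2)%C in let m3 := ((c + a) / 2)%C in
  let K := Cmod (Tri f a b c) / 4 in
  if Rle_dec K (Cmod (Tri f a m1 m3)) then (a, m1, m3)
  else if Rle_dec K (Cmod (Tri f m1 b m2)) then (m1, b, m2)
  else if Rle_dec K (Cmod (Tri f m3 m2 c)) then (m3, m2, c)
  else (m1, m2, m3).

Definition tri_in (P : C -> Prop) (T : triple) : Prop :=
  let '(a, b, c) := T in P a /\ P b /\ P c.
Definition tri_side (L : R) (T : triple) : Prop :=
  let '(a, b, c) := T in Cmod (a - b) <= L /\ Cmod (b - c) <= L /\ Cmod (c - a) <= L.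
Definition tri_int (f : C -> C) (T : triple) : C := let '(a, b, c) := T in Tri f a b c.
Definition tri_fst (T : triple) : C := fst (fst T).

Ltac case_Rle := match goal with |- context [Rle_dec ?x ?y] => destruct (Rle_dec x y) end.

Lemma tri_step_in f (P : C -> Prop) T :
  (forall x y, P x -> P y -> P ((x + y) / 2)%C) -> tri_in P T -> tri_in P (tri_step f T).
Proof.
  intros M. destruct T as [[a b] c]. intros (Ha & Hb & Hc). unfold tri_step.
  case_Rle; [unfold tri_in; auto|]. case_Rle; [unfold tri_in; auto|].
  case_Rle; unfold tri_in; auto.
Qed.

Lemma Cmod_half (z : C) : Cmod (z / 2) = Cmod z / 2.
Proof.
  rewrite Cmod_div by (apply RtoC_neq_0; lra). rewrite Cmod_R, Rabs_pos_eq; lra.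
Qed.

Lemma tri_step_side f L T : tri_side L T ->
  tri_side (L / 2) (tri_step f T) /\ Cmod (tri_fst (tri_step f T) - tri_fst T) <= L.
Proof.
  destruct T as [[a b] c]. intros (Ha & Hb & Hc).
  assert (L0 : 0 <= L) by (eapply Rle_trans; [apply Cmod_ge_0|apply Ha]).
  assert (X : forall x y z : C, (x = (y - z) / 2)%C \/ (x = (z - y) / 2)%C -> Cmod (y - z) <= L -> Cmod x <= L / 2).
  { intros x y z [->| ->] H; rewrite Cmod_half; [|rewrite Cmod_sub_sym]; lra. }
  unfold tri_step, tri_fst.
  case_Rle; [|case_Rle; [|case_Rle]];
  unfold tri_side, fst; repeat split;
  try (apply (X _ a b); [first [left; field | right; field]|assumption]);
  try (apply (X _ b c); [first [left; field | right; field]|assumption]);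
  try (apply (X _ c a); [first [left; field | right; field]|assumption]).
  - replace (a - a)%C with (RtoC 0) by ring. rewrite Cmod_0; lra.
  - apply Rle_trans with (L / 2); [|lra]. apply (X _ a b); [right; field|assumption].
  - apply Rle_trans with (L / 2); [|lra]. apply (X _ c a); [left; field|assumption].
  - apply Rle_trans with (L / 2); [|lra]. apply (X _ a b); [right; field|assumption].
Qed.

Lemma largest_of_four (s a b c d : C) : s = (a + b + c + d)%C ->
  ~ Cmod s / 4 <= Cmod a -> ~ Cmod s / 4 <= Cmod b -> ~ Cmod s / 4 <= Cmod c ->
  Cmod s / 4 <= Cmod d.
Proof.
  intros E Ha Hb Hc.
  assert (Cmod s <= Cmod a + Cmod b + Cmod c + Cmod d).
  { rewrite E. eapply Rle_trans; [apply Cmod_triangle|]. generalize (Cmod_triangle3 a b c). lra. }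
  lra.
Qed.

Lemma tri_step_int (f : C -> C) (o : C) (r : R) (T : triple) : holo_on (cdisc o r) f -> tri_in (cdisc o r) T ->
  Cmod (tri_int f T) / 4 <= Cmod (tri_int f (tri_step f T)).
Proof.
  intros Hf. destruct T as [[a b] c]. intros (Ha & Hb & Hc).
  pose proof (Tri_split f o r a b c Hf Ha Hb Hc) as E. unfold tri_step.
  case_Rle; [assumption|]. case_Rle; [assumption|].
  case_Rle; [assumption|]. unfold tri_int.
  apply (largest_of_four _ _ _ _ _ E); assumption.
Qed.

(** A quadratic primitive exists, so the integral over the closed polygon telescopes. *)
Lemma affine_Tri (p q : C) (a b c : C) : Tri (fun z => p + q * z)%C a b c = 0.
Proof.
  assert (D : forall z, Cder (fun z => p * z + q * (z * z) / 2)%C z (p + q * z)%C).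
  { intros z. replace (p + q * z)%C with (p * 1 + q * (1 * z + z * 1) / 2)%C by field.
    apply Der_plus; [apply Der_scal, Cder_id|].
    apply Cder_div_const; [apply RtoC_neq_0; lra|].
    apply Der_scal, Der_mult; apply Cder_id. }
  assert (B : forall z, Cdb (fun z => p + q * z)%C z).
  { intros z. apply Cdb_plus; [apply Cdb_const|apply Cdb_mult; [apply Cdb_const|apply Cdb_id]]. }
  unfold Tri. rewrite !(Iseg_FTC (fun z => p * z + q * (z * z) / 2)%C) by (intros t _; auto). ring.
Qed.

Lemma Cdb_affine p q z : Cdb (fun z => p + q * z)%C z.
Proof. apply Cdb_plus; [apply Cdb_const|apply Cdb_mult; [apply Cdb_const|apply Cdb_id]]. Qed.

Lemma pow2_lim (L : R) : is_lim_seq (fun n => L * (/ 2) ^ n) 0.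
Proof.
  replace (Finite 0) with (Rbar_mult L 0) by (simpl; f_equal; ring).
  apply is_lim_seq_scal_l. apply is_lim_seq_geom. rewrite Rabs_pos_eq; lra.
Qed.

(** Bisection gives triangles of side at most [L / 2^n] that carry at least [4^(-n)] of the modulus
    of the integral. Near their limit point [f] differs from an affine function by [o(2^(-n))];
    multiplied by a perimeter of order [2^(-n)] this is [o(4^(-n))]. *)
Lemma Goursat (f : C -> C) (o : C) (r : R) (a b c : C) : holo_on (cdisc o r) f ->
  cdisc o r a -> cdisc o r b -> cdisc o r c -> Tri f a b c = 0.
Proof.
  intros Hf Ha Hb Hc.
  set (L := Cmod (a - b) + Cmod (b - c) + Cmod (c - a)).
  pose proof (Cmod_ge_0 (a - b)); pose proof (Cmod_ge_0 (b - c)); pose proof (Cmod_ge_0 (c - a)).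
  (* All vertices stay in the closed disc of radius [M < r], so the limit point lies in the open
     disc on which [f] is differentiable. *)
  set (M := Rmax (Cmod (a - o)) (Rmax (Cmod (b - o)) (Cmod (c - o)))).
  assert (HM : M < r) by (repeat apply Rmax_lub_lt; assumption).
  set (P := fun z => Cmod (z - o) <= M).
  assert (PD : forall z, P z -> cdisc o r z) by (intros z Hz; unfold cdisc, P in *; lra).
  assert (Pm : forall x y, P x -> P y -> P ((x + y) / 2)%C).
  { intros x y Hx Hy. apply half_seg. intros t Ht. now apply seg_dist. }
  set (T := fun n => Nat.iter n (tri_step f) (a, b, c)).
  assert (HT : forall n, tri_in P (T n) /\ tri_side (L * (/2) ^ n) (T n) /\
             Cmod (Tri f a b c) * (/4) ^ n <= Cmod (tri_int f (T n)) /\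
             Cmod (tri_fst (T (S n)) - tri_fst (T n)) <= L * (/2) ^ n).
  { induction n as [|n (I1 & I2 & I3 & I4)].
    - assert (J1 : tri_in P (a, b, c)).
      { unfold tri_in, P, M. repeat split.
        - apply Rmax_l.
        - eapply Rle_trans; [apply Rmax_l|apply Rmax_r].
        - eapply Rle_trans; [apply Rmax_r|apply Rmax_r]. }
      assert (J2 : tri_side (L * (/2) ^ 0) (a, b, c)) by (unfold tri_side, L, pow; repeat split; lra).
      split; [exact J1|split; [exact J2|split]]; [unfold T, tri_int, pow; simpl Nat.iter; lra|apply (tri_step_side f _ _ J2)].
    - assert (J1 := tri_step_in f P _ Pm I1). destruct (tri_step_side f _ _ I2) as [J2 _].
      change (tri_step f (T n)) with (T (S n)) in *.
      replace (L * (/ 2) ^ n / 2) with (L * (/2) ^ S n) in J2 by (simpl; field).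
      destruct (tri_step_side f _ _ J2) as [_ J4].
      split; [exact J1|split; [exact J2|split; [|exact J4]]].
      eapply Rle_trans; [|apply (tri_step_int f o r (T n))]; [|exact Hf|].
      + replace ((/ 4) ^ S n) with ((/ 4) ^ n / 4) by (simpl; field). lra.
      + destruct (T n) as [[x y] z]. destruct I1 as (? & ? & ?). repeat split; now apply PD. }
  destruct (C_Cauchy_limit (fun n => tri_fst (T n)) (fun n => 2 * L * (/2) ^ n)) as [p Hp].
  { apply pow2_lim. }
  { intros n m Hnm. replace m with (n + (m - n))%nat by lia. generalize (m - n)%nat as k. clear m Hnm.
    intros k. assert (X : Cmod (tri_fst (T (n + k)%nat) - tri_fst (T n)) <= 2 * L * (/ 2) ^ n * (1 - (/2) ^ k)).
    { induction k as [|k IH].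
      - rewrite Nat.add_0_r. replace (tri_fst (T n) - tri_fst (T n))%C with (RtoC 0) by ring.
        rewrite Cmod_0. simpl; lra.
      - replace (n + S k)%nat with (S (n + k)) by lia.
        destruct (HT (n + k)%nat) as (_ & _ & _ & H4).
        replace (tri_fst (T (S (n + k))) - tri_fst (T n))%C with
          ((tri_fst (T (S (n + k))) - tri_fst (T (n + k)%nat)) + (tri_fst (T (n + k)%nat) - tri_fst (T n)))%C by ring.
        eapply Rle_trans; [apply Cmod_triangle|]. rewrite pow_add in H4. change ((/ 2) ^ S k) with (/ 2 * (/ 2) ^ k). lra. }
    eapply Rle_trans; [exact X|].
    assert (0 <= L) by (unfold L; lra).
    assert (0 <= (/2)^n) by (apply pow_le; lra). assert (0 <= (/2)^k) by (apply pow_le; lra).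
    assert (0 <= L * (/2)^n) by (apply Rmult_le_pos; lra).
    assert (0 <= L * (/2)^n * (/2)^k) by (apply Rmult_le_pos; lra). lra. }
  assert (Hpd : cdisc o r p).
  { unfold cdisc. destruct (Rlt_or_le (Cmod (p - o)) r) as [|Hle]; [assumption|exfalso].
    pose proof (pow2_lim (2 * L)) as Hl. apply is_lim_seq_spec in Hl.
    destruct (Hl (mkposreal (r - M) ltac:(lra))) as [N HN]. specialize (HN N (Nat.le_refl _)).
    simpl in HN. rewrite Rminus_0_r in HN. apply Rabs_def2 in HN.
    specialize (Hp N). destruct (HT N) as (I1 & _).
    assert (Hq : P (tri_fst (T N))) by (destruct (T N) as [[x y] z]; apply I1). unfold P in Hq.
    generalize (Cmod_triangle (p - tri_fst (T N)) (tri_fst (T N) - o)).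
    replace (p - tri_fst (T N) + (tri_fst (T N) - o))%C with (p - o)%C by ring. lra. }
  destruct (Hf p Hpd) as [l Hl].
  (* The 9 is three sides times [3 L / 2^n], the distance bound to the limit point: the first vertex
     is within [2 L / 2^n] of [p], the other two within a further [L / 2^n]. *)
  assert (K0 : forall eps, 0 < eps -> Cmod (Tri f a b c) <= 9 * L * L * eps).
  { intros eps He. destruct (Hl eps He) as (d & Hd & Hfd).
    pose proof (pow2_lim (3 * L)) as Hlim. apply is_lim_seq_spec in Hlim.
    destruct (Hlim (mkposreal d Hd)) as [n HN]. specialize (HN n (Nat.le_refl _)).
    simpl in HN. rewrite Rminus_0_r in HN. apply Rabs_def2 in HN. destruct HN as [HN _].
    destruct (HT n) as (I1 & I2 & I3 & _). specialize (Hp n).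
    set (l2 := (/2) ^ n) in *.
    assert (El : (/ 4) ^ n = l2 * l2).
    { unfold l2. rewrite <- Rpow_mult_distr. f_equal. field. }
    assert (Hl2 : 0 < l2) by (apply pow_lt; lra).
    assert (HL : 0 <= L) by (unfold L; lra).
    destruct (T n) as [[x y] z]. destruct I1 as (X1 & X2 & X3). destruct I2 as (Y1 & Y2 & Y3).
    unfold tri_fst, fst in Hp. unfold tri_int in I3.
    set (g := fun w => (f w - (f p - l * p + l * w))%C).
    assert (Hg : forall w, cdisc o r w -> Cdb g w).
    { intros w Hw. apply Cdb_minus; [now apply Hf|apply Cdb_affine]. }
    assert (Eg : Tri f x y z = Tri g x y z).
    { assert (A := affine_Tri (f p - l * p)%C l x y z). unfold Tri in *.
      assert (Q : forall u v, P u -> P v -> Iseg f u v = (Iseg g u v + Iseg (fun w => f p - l * p + l * w)%C u v)%C).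
      { intros u v Hu Hv. rewrite <- Iseg_plus.
        - unfold Iseg. f_equal. apply CI_ext; [lra|]. intros t _. unfold g. ring.
        - intros t Ht. apply Hg, disc_seg; auto.
        - intros t Ht. apply Cdb_affine. }
      rewrite (Q x y), (Q y z), (Q z x) by assumption.
      replace (Iseg g x y + Iseg g y z + Iseg g z x)%C
        with (Iseg g x y + Iseg g y z + Iseg g z x + 0)%C by ring.
      rewrite <- A. ring. }
    assert (Dp : forall w, Cmod (w - x) <= L * l2 -> Cmod (w - p) <= 3 * L * l2).
    { intros w Hw. generalize (Cmod_triangle (w - x) (x - p)).
      replace (w - x + (x - p))%C with (w - p)%C by ring. rewrite (Cmod_sub_sym x p). nra. }
    assert (BI : forall u v, P u -> P v -> Cmod (u - x) <= L * l2 -> Cmod (v - x) <= L * l2 ->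
       Cmod (v - u) <= L * l2 -> Cmod (Iseg g u v) <= L * l2 * (eps * (3 * L * l2))).
    { intros u v Hu Hv Hux Hvx Huv. eapply Rle_trans.
      - apply (Iseg_bound g u v (eps * (3 * L * l2))).
        + intros t Ht. apply Hg, disc_seg; auto.
        + intros t Ht.
          assert (B := seg_dist u v p t (3 * L * l2) Ht (Dp _ Hux) (Dp _ Hvx)).
          set (w := (u + t * (v - u))%C) in *.
          specialize (Hfd (w - p)%C ltac:(lra)).
          replace (p + (w - p))%C with w in Hfd by ring.
          replace (g w) with (f w - f p - l * (w - p))%C by (unfold g; ring).
          eapply Rle_trans; [exact Hfd|]. apply Rmult_le_compat_l; lra.
      - apply Rmult_le_compat_r; [|exact Huv].
        apply Rmult_le_pos; [lra|]. apply Rmult_le_pos; [lra|]. lra. }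
    assert (Z0 : Cmod (x - x) <= L * l2).
    { replace (x - x)%C with (RtoC 0) by ring. rewrite Cmod_0. apply Rmult_le_pos; lra. }
    assert (Y1' := Y1). rewrite Cmod_sub_sym in Y1'.
    assert (Y2' := Y2). rewrite Cmod_sub_sym in Y2'.
    assert (Y3' := Y3). rewrite Cmod_sub_sym in Y3'.
    assert (B1 := BI x y X1 X2 Z0 Y1' Y1').
    assert (B2 := BI y z X2 X3 Y1' Y3 Y2').
    assert (B3 := BI z x X3 X1 Y3 Z0 Y3').
    rewrite Eg in I3. unfold Tri in I3 at 2.
    generalize (Cmod_triangle3 (Iseg g x y) (Iseg g y z) (Iseg g z x)). intros B4.
    rewrite El in I3.
    apply Rmult_le_reg_r with (l2 * l2); [now apply Rmult_lt_0_compat|]. nra. }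
  apply Cmod_eq_0. apply Rle_antisym; [|apply Cmod_ge_0].
  apply Rnot_lt_le. intros Hpos.
  assert (HLp : 0 < 9 * L * L + 1) by nra.
  specialize (K0 (Cmod (Tri f a b c) / (2 * (9 * L * L + 1)))).
  assert (X : 0 < Cmod (Tri f a b c) / (2 * (9 * L * L + 1))) by (apply Rdiv_lt_0_compat; lra).
  specialize (K0 X).
  assert (E : 9 * L * L * (Cmod (Tri f a b c) / (2 * (9 * L * L + 1))) <=
     (9 * L * L + 1) * (Cmod (Tri f a b c) / (2 * (9 * L * L + 1)))) by (apply Rmult_le_compat_r; lra).
  replace ((9 * L * L + 1) * (Cmod (Tri f a b c) / (2 * (9 * L * L + 1)))) with (Cmod (Tri f a b c) / 2) in E
    by (field; lra).
  lra.
Qed.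

(** Goursat's theorem on the triangle [o], [z], [z + h] turns the increment of the integral from [o]
    into the integral over the short side, on which [f] is within [eps] of [f z]. *)
Lemma primitive_exists (f : C -> C) (o : C) (r : R) : holo_on (cdisc o r) f -> 
  exists F, forall z, cdisc o r z -> Cder F z (f z).
Proof.
  intros Hf. exists (fun z => Iseg f o z). intros z Hz eps He.
  assert (Ho : cdisc o r o).
  { unfold cdisc in *. replace (o - o)%C with (RtoC 0) by ring. rewrite Cmod_0.
    eapply Rle_lt_trans; [apply Cmod_ge_0|exact Hz]. }
  destruct (Hf z Hz) as [l Hl].
  destruct (Der_cont _ _ _ _ _ Hl eps He) as (d & Hd & Hc).
  exists (Rmin d (r - Cmod (z - o))). split; [apply Rmin_pos; unfold cdisc in *; lra|].
  intros h Hh.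
  assert (Hh1 : Cmod h < d) by exact (lt_Rmin_l _ _ _ Hh).
  assert (Hh2 : Cmod h < r - Cmod (z - o)) by exact (lt_Rmin_r _ _ _ Hh).
  assert (Hzh : cdisc o r (z + h)).
  { unfold cdisc. replace (z + h - o)%C with (z - o + h)%C by ring.
    eapply Rle_lt_trans; [apply Cmod_triangle|]. lra. }
  assert (S : forall x y, cdisc o r x -> cdisc o r y -> on_seg (Cdb f) x y).
  { intros x y Hx Hy. apply (on_seg_mono (cdisc o r)); [exact Hf|now apply disc_on_seg]. }
  assert (G := Goursat f o r o z (z + h)%C Hf Ho Hz Hzh). unfold Tri in G.
  rewrite (Iseg_swap f o (z + h)%C) in G by auto.
  assert (E : (Iseg f o (z + h) - Iseg f o z - f z * h = Iseg (fun w => f w + - f z) z (z + h))%C).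
  { rewrite Iseg_plus by (auto; intros t _; apply Cdb_const).
    replace (Iseg (fun _ : C => - f z)%C z (z + h)%C) with (- f z * h)%C.
    2:{ unfold Iseg. rewrite CI_const. rewrite Rminus_0_r. ring. }
    replace (Iseg f o (z + h)) with (Iseg f o (z + h) + 0)%C by ring. rewrite <- G. ring. }
  rewrite E. eapply Rle_trans.
  - apply (Iseg_bound _ _ _ eps).
    + intros t Ht. apply Cdb_plus; [|apply Cdb_const]. now apply S.
    + intros t Ht. replace (z + h - z)%C with h by ring.
      apply Rlt_le. apply Hc. eapply Rle_lt_trans; [now apply Cmod_scal_le|exact Hh1].
  - right. replace (z + h - z)%C with h by ring. ring.
Qed.

(** * Cauchy's integral formula *)

(** The derivative in [t] is [Ci * (circ c rho t - c)], so the contour measure [dz / (2 pi i)]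
    becomes [(circ c rho t - c) dt / (2 pi)]. The Cauchy integrals below run over [t] in [[0, 2 pi]]
    and carry the factor [circ c rho t - c], with the division by [2 pi] left out. *)
Definition circ (c : C) (rho t : R) : C := (c + rho * Cexp (t * Ci))%C.

Lemma Rder_circ c rho t : Rder (circ c rho) t (Ci * (circ c rho t - c))%C.
Proof.
  unfold circ. replace (Ci * (c + rho * Cexp (t * Ci) - c))%C with (0 + rho * (Ci * Cexp (t * Ci)))%C by ring.
  apply Der_plus; [apply Der_const|]. apply Der_scal, Rder_Cexp_line.
Qed.

Lemma Rdb_circ c rho t : Rdb (circ c rho) t.
Proof. eexists; apply Rder_circ. Qed.

Lemma Cmod_circ c rho t : 0 <= rho -> Cmod (circ c rho t - c) = rho.
Proof.
  intros H. unfold circ. replace (c + rho * Cexp (t * Ci) - c)%C with (rho * Cexp (t * Ci))%C by ring.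
  rewrite Cmod_mult, Cmod_R, Cmod_Cexp, Rabs_pos_eq by exact H.
  replace (Re (t * Ci)) with 0 by (unfold Re; simpl; ring). rewrite exp_0; ring.
Qed.

Lemma circ_closed c rho : circ c rho (2 * PI) = circ c rho 0.
Proof.
  unfold circ. do 2 f_equal. unfold Cexp, Re, Im; simpl.
  replace (2 * PI * 1 + 0 * 0) with (2 * PI) by ring. replace (0 * 1 + 0 * 0) with 0 by ring.
  replace (2 * PI * 0 - 0 * 1) with 0 by ring. replace (0 * 0 - 0 * 1) with 0 by ring.
  rewrite cos_2PI, sin_2PI, cos_0, sin_0. reflexivity.
Qed.

Lemma two_PI_ge0 : 0 <= 2 * PI.
Proof. generalize PI_RGT_0; lra. Qed.

Lemma circ_dist c rho w t : 0 <= rho -> rho - Cmod (w - c) <= Cmod (circ c rho t - w).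
Proof.
  intros H. generalize (Cmod_triangle (circ c rho t - w) (w - c)).
  replace (circ c rho t - w + (w - c))%C with (circ c rho t - c)%C by ring.
  rewrite Cmod_circ by exact H. lra.
Qed.

Lemma circ_neq c rho w t : 0 <= rho -> Cmod (w - c) < rho -> (circ c rho t - w)%C <> 0.
Proof.
  intros H Hw. apply Cmod_gt_0. generalize (circ_dist c rho w t H). lra.
Qed.

Lemma circ_in_disc c rho r t : 0 <= rho < r -> cdisc c r (circ c rho t).
Proof. intros H. unfold cdisc. rewrite Cmod_circ; lra. Qed.

Lemma CI_circ_closed (P p : R -> C) : (forall t, Rder P t (Ci * p t)%C) -> (forall t, Rdb p t) ->
  P (2 * PI) = P 0 -> CI p 0 (2 * PI) = 0.
Proof.
  intros HP Hp E.
  assert (X : (Ci * CI p 0 (2 * PI))%C = 0).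
  { rewrite <- CI_scal; [|apply two_PI_ge0|intros t _; apply Hp].
    rewrite (CI_FTC P); [rewrite E; ring|apply two_PI_ge0|intros t _; apply HP|].
    intros t _. apply Rdb_mult; [apply Rdb_const|apply Hp]. }
  replace (CI p 0 (2 * PI)) with (/ Ci * (Ci * CI p 0 (2 * PI)))%C by (field; apply Ci_nz).
  rewrite X; ring.
Qed.

Lemma CI_circ_holo g c rho r : holo_on (cdisc c r) g -> 0 <= rho < r ->
  CI (fun t => g (circ c rho t) * (circ c rho t - c))%C 0 (2 * PI) = 0.
Proof.
  intros Hg Hr. destruct (primitive_exists g c r Hg) as [G HG].
  apply (CI_circ_closed (fun t => G (circ c rho t))).
  - intros t. replace (Ci * (g (circ c rho t) * (circ c rho t - c)))%C
      with (g (circ c rho t) * (Ci * (circ c rho t - c)))%C by ring.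
    apply (Der_comp _ _ G); [|apply Rder_circ]. apply HG, circ_in_disc, Hr.
  - intros t. apply Rdb_mult.
    + apply (Rdb_comp g); [apply Hg, circ_in_disc, Hr|apply Rdb_circ].
    + apply Rdb_minus; [apply Rdb_circ|apply Rdb_const].
  - now rewrite circ_closed.
Qed.

Lemma Rdb_bounded f a b : a <= b -> Rdb_on f a b -> exists M, 0 < M /\ forall t, a <= t <= b -> Cmod (f t) <= M.
Proof.
  intros Hab Hf.
  destruct (continuity_ab_maj (fun t => Cmod (f t)) a b Hab) as [x [Hx _]].
  - intros t Ht. destruct (Hf t Ht) as [l Hl]. intros eps He.
    destruct (Der_cont Rplus RtoC f t l Hl eps He) as (d & Hd & H).
    exists d; split; [exact Hd|]. intros u [_ Hu]. simpl in *. unfold R_dist in *.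
    specialize (H (u - t)). rewrite Cmod_R in H. specialize (H Hu).
    replace (t + (u - t)) with u in H by ring.
    eapply Rle_lt_trans; [|exact H].
    apply Rabs_le. generalize (Cmod_sub_ge (f u) (f t)) (Cmod_sub_ge (f t) (f u)).
    rewrite (Cmod_sub_sym (f t)). lra.
  - exists (Cmod (f x) + 1). split; [generalize (Cmod_ge_0 (f x)); lra|].
    intros t Ht. specialize (Hx t Ht). simpl in Hx. lra.
Qed.

Lemma Rdb_kernel phi c rho w t : 0 <= rho -> Cmod (w - c) < rho -> Rdb phi t ->
  Rdb (fun t => phi t / (circ c rho t - w))%C t.
Proof.
  intros H Hw Hp. apply Rdb_div; [now apply circ_neq|exact Hp|].
  apply Rdb_minus; [apply Rdb_circ|apply Rdb_const].
Qed.

Lemma Rdb_kernel2 phi c rho w t : 0 <= rho -> Cmod (w - c) < rho -> Rdb phi t ->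
  Rdb (fun t => phi t / ((circ c rho t - w) * (circ c rho t - w)))%C t.
Proof.
  intros H Hw Hp. apply Rdb_div; [apply Cmult_neq_0; now apply circ_neq|exact Hp|].
  apply Rdb_mult; (apply Rdb_minus; [apply Rdb_circ|apply Rdb_const]).
Qed.

(** The kernel [1 / (z - w)] has the exact second-order remainder [h^2 / ((z - w)^2 (z - w - h))].
    It is bounded uniformly on the circle, because [w] has distance at least [d] from it and
    [|h| < d / 2]. The density [phi] is an arbitrary differentiable function of the angle. *)
Lemma Cauchy_type_derive phi c rho w : 0 <= rho -> Cmod (w - c) < rho -> (forall t, Rdb phi t) ->
  Cder (fun w => CI (fun t => phi t / (circ c rho t - w))%C 0 (2 * PI)) w
    (CI (fun t => phi t / ((circ c rho t - w) * (circ c rho t - w)))%C 0 (2 * PI)).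
Proof.
  intros H Hw Hp eps He. set (d := rho - Cmod (w - c)). assert (Hd : 0 < d) by (unfold d; lra).
  destruct (Rdb_bounded phi 0 (2 * PI) two_PI_ge0 (fun t _ => Hp t)) as (M & HM & HB).
  set (K := 2 * PI * (M * 2 / (d * d * d))).
  assert (Hddd : 0 < d * d * d) by (repeat apply Rmult_lt_0_compat; exact Hd).
  assert (HK : 0 < K).
  { unfold K. generalize PI_RGT_0; intros. apply Rmult_lt_0_compat; [lra|].
    apply Rdiv_lt_0_compat; lra. }
  exists (Rmin (d / 2) (eps / K)). split; [apply Rmin_pos; [lra|now apply Rdiv_lt_0_compat]|].
  intros h Hh.
  assert (Hh1 : Cmod h < d / 2) by exact (lt_Rmin_l _ _ _ Hh).
  assert (Hh2 : Cmod h < eps / K) by exact (lt_Rmin_r _ _ _ Hh).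
  assert (Hwh : Cmod (w + h - c) < rho).
  { replace (w + h - c)%C with (w - c + h)%C by ring. eapply Rle_lt_trans; [apply Cmod_triangle|].
    unfold d in Hh1; lra. }
  rewrite Cmult_comm.
  assert (K1 : forall t, Rdb (fun t => phi t / (circ c rho t - (w + h)))%C t) by (intros; now apply Rdb_kernel).
  assert (K2 : forall t, Rdb (fun t => phi t / (circ c rho t - w))%C t) by (intros; now apply Rdb_kernel).
  assert (K3 : forall t, Rdb (fun t => phi t / ((circ c rho t - w) * (circ c rho t - w)))%C t) by (intros; now apply Rdb_kernel2).
  rewrite <- CI_scal, <- !CI_minus; try apply two_PI_ge0; try (intros t _; auto).
  2:{ apply Rdb_minus; auto. }
  2:{ apply Rdb_mult; [apply Rdb_const|auto]. }
  eapply Rle_trans.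
  - apply (CI_bound _ 0 (2 * PI) (M * 2 / (d * d * d) * Cmod h ^ 2) two_PI_ge0).
    + intros t _. apply Rdb_minus; [apply Rdb_minus; auto|apply Rdb_mult; [apply Rdb_const|auto]].
    + intros t Ht. set (z := circ c rho t).
      assert (N1 : (z - w)%C <> 0) by now apply circ_neq.
      assert (N2 : (z - (w + h))%C <> 0) by now apply circ_neq.
      replace (phi t / (z - (w + h)) - phi t / (z - w) - h * (phi t / ((z - w) * (z - w))))%C
        with (phi t * (h * h) / ((z - w) * (z - w) * (z - (w + h))))%C.
      2:{ field. auto. }
      assert (D1 : d <= Cmod (z - w)) by now apply circ_dist.
      assert (D2 : d / 2 <= Cmod (z - (w + h))).
      { replace (z - (w + h))%C with (z - w - h)%C by ring. generalize (Cmod_sub_ge (z - w) h). lra. }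
      rewrite Cmod_div by (repeat apply Cmult_neq_0; assumption). rewrite !Cmod_mult.
      replace (M * 2 / (d * d * d) * Cmod h ^ 2) with (M * (Cmod h * Cmod h) * / (d * d * (d / 2)))
        by (field; lra).
      unfold Rdiv at 1. pose proof (Cmod_ge_0 h). apply Rmult_le_compat.
      * apply Rmult_le_pos; [apply Cmod_ge_0|now apply Rmult_le_pos].
      * apply Rlt_le, Rinv_0_lt_compat. repeat apply Rmult_lt_0_compat; lra.
      * apply Rmult_le_compat_r; [now apply Rmult_le_pos|now apply HB].
      * apply Rinv_le_contravar; [repeat apply Rmult_lt_0_compat; lra|].
        apply Rmult_le_compat; [apply Rmult_le_pos; lra|lra| |exact D2].
        apply Rmult_le_compat; lra.
  - replace ((2 * PI - 0) * (M * 2 / (d * d * d) * Cmod h ^ 2)) with (K * Cmod h * Cmod h)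
      by (unfold K; ring).
    apply Rmult_le_compat_r; [apply Cmod_ge_0|].
    apply Rmult_lt_compat_l with (r := K) in Hh2; [|exact HK].
    replace (K * (eps / K)) with eps in Hh2 by (field; lra). lra.
Qed.

Lemma Rder_circ_inv c rho w t : 0 <= rho -> Cmod (w - c) < rho ->
  Rder (fun t => / (circ c rho t - w))%C t
    (- (Ci * (circ c rho t - c)) / ((circ c rho t - w) * (circ c rho t - w)))%C.
Proof.
  intros H Hw.
  replace (- (Ci * (circ c rho t - c)))%C with (- (Ci * (circ c rho t - c) - 0))%C by ring.
  apply (Der_inv Rplus RtoC (fun t => circ c rho t - w)%C); [now apply circ_neq|].
  apply Der_minus; [apply Rder_circ|apply Der_const].
Qed.

Lemma Rdb_circ_sub c rho w t : Rdb (fun t => circ c rho t - w)%C t.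
Proof. apply Rdb_minus; [apply Rdb_circ|apply Rdb_const]. Qed.

Lemma cdisc_seg_center (c w : C) (r t : R) : 0 <= t <= 1 -> Cmod (w - c) < r -> cdisc c r (c + t * (w - c)).
Proof.
  intros Ht Hw. apply disc_seg; [exact Ht| |exact Hw].
  unfold cdisc. replace (c - c)%C with (RtoC 0) by ring. rewrite Cmod_0.
  eapply Rle_lt_trans; [apply Cmod_ge_0|exact Hw].
Qed.

(** The derivative in [w] is, up to the factor [Ci], the integral of the total derivative of
    [- 1 / (z - w)] over a closed curve, hence 0. The value is therefore the one at the centre,
    where the integrand is 1. *)
Lemma winding_one c rho w : Cmod (w - c) < rho ->
  CI (fun t => (circ c rho t - c) / (circ c rho t - w))%C 0 (2 * PI) = (2 * PI)%R.
Proof.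
  intros Hw. assert (H : 0 <= rho) by (generalize (Cmod_ge_0 (w - c)); lra).
  assert (H0 : 0 < rho) by (generalize (Cmod_ge_0 (w - c)); lra).
  set (T := fun w => CI (fun t => (circ c rho t - c) / (circ c rho t - w))%C 0 (2 * PI)).
  assert (HT : Cmod (T w - T c) <= 0 * Cmod (w - c)).
  { apply (Cder_mean_value T (fun _ => 0)); [|intros; rewrite Cmod_0; lra].
    intros t Ht. set (v := (c + t * (w - c))%C).
    assert (Hv : Cmod (v - c) < rho) by (apply cdisc_seg_center; assumption).
    assert (D := Cauchy_type_derive (fun t => circ c rho t - c)%C c rho v H Hv (Rdb_circ_sub c rho c)).
    cbv beta in D. fold T in D.
    rewrite (CI_circ_closed (fun t => - (1) * / (circ c rho t - v))%C) in D; [exact D| | |].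
    - intros s. 
      replace (Ci * ((circ c rho s - c) / ((circ c rho s - v) * (circ c rho s - v))))%C
       with (- (1) * (- (Ci * (circ c rho s - c)) / ((circ c rho s - v) * (circ c rho s - v))))%C
       by (field; now apply circ_neq).
      apply Der_scal. now apply Rder_circ_inv.
    - intros s. apply Rdb_kernel2; [exact H|exact Hv|apply Rdb_circ_sub].
    - now rewrite circ_closed. }
  rewrite Rmult_0_l in HT.
  assert (E : (T w - T c)%C = 0) by (apply Cmod_eq_0, Rle_antisym; [exact HT|apply Cmod_ge_0]).
  change (T w = (2 * PI)%R).
  replace (T w) with (T w - T c + T c)%C by ring. rewrite E. unfold T.
  rewrite (CI_ext _ (fun _ => 1)); [|apply two_PI_ge0|].
  - rewrite CI_const, Rminus_0_r. ring.
  - intros t _. field. apply Cmod_gt_0. rewrite Cmod_circ; lra.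
Qed.

Lemma Cder_unique f z l m : Cder f z l -> Cder f z m -> l = m.
Proof.
  intros H K. apply Cder_is_derive in H, K.
  apply is_C_derive_unique in H, K. congruence.
Qed.

(* [(F z - F w)/(z - w)] is differentiable at [w] as well, because [F] is a primitive
   of a differentiable function. *)
Lemma slope_holo F f c r w : (forall z, cdisc c r z -> Cder F z (f z)) -> holo_on (cdisc c r) f ->
  cdisc c r w ->
  exists G, holo_on (cdisc c r) G /\ forall z, z <> w -> G z = ((F z - F w) / (z - w))%C.
Proof.
  intros HF Hf Hw.
  exists (fun z => if Ceq_dec z w then f w else ((F z - F w) / (z - w))%C).
  split; [|intros z Hz; now destruct (Ceq_dec z w)].
  intros z Hz. destruct (Ceq_dec z w) as [->|Nz].
  2:{ assert (P : 0 < Cmod (z - w)) by (apply Cmod_gt_0; intros E; apply Nz, Ceq_minus, E).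
      apply (Cdb_ext_loc (fun z => (F z - F w) / (z - w))%C _ _ (Cmod (z - w)) P).
      - intros x Hx. destruct (Ceq_dec x w) as [->|]; [|reflexivity].
        rewrite Cmod_sub_sym in Hx. lra.
      - apply Cdb_div; [now apply Cmod_gt_0| |].
        + apply Cdb_minus; [|apply Cdb_const]. eexists; apply HF, Hz.
        + apply Cdb_minus; [apply Cdb_id|apply Cdb_const]. }
  destruct (Hf w Hw) as [l Hl]. exists (l / 2)%C. intros eps He.
  destruct (Hl eps He) as (d & Hd & H).
  exists (Rmin d (r - Cmod (w - c))). unfold cdisc in Hw. split; [apply Rmin_pos; lra|].
  intros h Hh.
  assert (Hh1 : Cmod h < d) by exact (lt_Rmin_l _ _ _ Hh).
  assert (Hh2 : Cmod h < r - Cmod (w - c)) by exact (lt_Rmin_r _ _ _ Hh).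
  destruct (Ceq_dec w w) as [_|N]; [|now elim N].
  destruct (Ceq_dec (w + h) w) as [E|N].
  { assert (E0 : h = 0) by (replace h with (w + h - w)%C by ring; rewrite E; ring).
    rewrite E0. replace (f w - f w - l / 2 * 0)%C with (RtoC 0) by ring. rewrite Cmod_0; lra. }
  assert (Nh : h <> 0) by (intros ->; apply N; ring).
  assert (Ph : 0 < Cmod h) by now apply Cmod_gt_0.
  set (Q := fun u => (F (w + u) - f w * u - l / 2 * (u * u))%C).
  assert (B : Cmod (Q h - Q 0) <= eps * Cmod h * Cmod (h - 0)).
  { apply (Cder_mean_value Q (fun u => f (w + u) - f w - l * u)%C).
    - intros t Ht. replace (0 + t * (h - 0))%C with (t * h)%C by ring.
      assert (Hth := Cmod_scal_le t h Ht). set (u := (t * h)%C) in *.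
      replace (f (w + u) - f w - l * u)%C with (f (w + u)%C * (0 + 1) - f w * 1 - l / 2 * (1 * u + u * 1))%C by field.
      apply Der_minus; [apply Der_minus|].
      + apply (Der_comp _ _ F (fun u => w + u)%C).
        * apply HF. unfold cdisc. replace (w + u - c)%C with (w - c + u)%C by ring.
          eapply Rle_lt_trans; [apply Cmod_triangle|]. lra.
        * apply Der_plus; [apply Der_const|apply Cder_id].
      + apply Der_scal, Cder_id.
      + apply Der_scal, Der_mult; apply Cder_id.
    - intros t Ht. replace (0 + t * (h - 0))%C with (t * h)%C by ring.
      assert (Hth := Cmod_scal_le t h Ht).
      eapply Rle_trans; [apply H; lra|]. apply Rmult_le_compat_l; lra. }
  replace (h - 0)%C with h in B by ring.
  replace (Q h - Q 0)%C with (F (w + h) - F w - f w * h - l / 2 * (h * h))%C in B.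
  2:{ unfold Q. replace (w + 0)%C with w by ring. ring. }
  replace ((F (w + h) - F w) / (w + h - w) - f w - l / 2 * h)%C
    with ((F (w + h) - F w - f w * h - l / 2 * (h * h)) / h)%C.
  2:{ replace (w + h - w)%C with h by ring. field. exact Nh. }
  rewrite Cmod_div by exact Nh.
  apply Rmult_le_reg_r with (Cmod h); [exact Ph|].
  replace (Cmod (F (w + h) - F w - f w * h - l / 2 * (h * h))%C / Cmod h * Cmod h)
    with (Cmod (F (w + h) - F w - f w * h - l / 2 * (h * h))%C) by (field; lra).
  exact B.
Qed.

(** The slope of [F] at [w] extends holomorphically across [w], so its circle integral vanishes, and
    what remains is [F w] times the winding integral. The formula is reached for primitives first,
    because [slope_holo] needs a differentiable derivative. *)
Lemma Cauchy_formula_primitive F f c rho r w :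
  (forall z, cdisc c r z -> Cder F z (f z)) -> holo_on (cdisc c r) f ->
  rho < r -> Cmod (w - c) < rho ->
  CI (fun t => F (circ c rho t) * (circ c rho t - c) / (circ c rho t - w))%C 0 (2 * PI) = ((2 * PI)%R * F w)%C.
Proof.
  intros HF Hf Hr Hw. assert (H : 0 <= rho) by (generalize (Cmod_ge_0 (w - c)); lra).
  assert (Hwr : cdisc c r w) by (unfold cdisc; lra).
  destruct (slope_holo F f c r w HF Hf Hwr) as (G & HG & EG).
  assert (Z := CI_circ_holo G c rho r HG (conj H Hr)).
  assert (BF : forall t, Rdb (fun t => F (circ c rho t)) t).
  { intros t. apply (Rdb_comp F); [eexists; apply HF, circ_in_disc; lra|apply Rdb_circ]. }
  assert (B1 : forall t, Rdb (fun t => F (circ c rho t) * (circ c rho t - c) / (circ c rho t - w))%C t).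
  { intros t. apply Rdb_kernel; [exact H|exact Hw|]. apply Rdb_mult; [apply BF|apply Rdb_circ_sub]. }
  assert (B2 : forall t, Rdb (fun t => (circ c rho t - c) / (circ c rho t - w))%C t).
  { intros t. apply Rdb_kernel; [exact H|exact Hw|]. apply Rdb_circ_sub. }
  rewrite <- (winding_one c rho w Hw), Cmult_comm, <- CI_scal by (try apply two_PI_ge0; intros t _; apply B2).
  replace (CI (fun t => F (circ c rho t) * (circ c rho t - c) / (circ c rho t - w))%C 0 (2 * PI))
    with (CI (fun t => F (circ c rho t) * (circ c rho t - c) / (circ c rho t - w))%C 0 (2 * PI) - 0)%C by ring.
  rewrite <- Z, <- CI_minus.
  - apply CI_ext; [apply two_PI_ge0|]. intros t _.
    assert (N : (circ c rho t - w)%C <> 0) by now apply circ_neq.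
    rewrite EG; [field; exact N|]. intros E; apply N; rewrite E; ring.
  - apply two_PI_ge0.
  - intros t _; apply B1.
  - intros t _. apply Rdb_mult; [|apply Rdb_circ_sub].
    apply (Rdb_comp G); [apply HG, circ_in_disc; lra|apply Rdb_circ].
Qed.

(** Differentiating in [w] the formula for a primitive [F] expresses [f w] by the kernel
    [1 / (z - w)^2] against [F]. Integration by parts around the closed circle then moves the
    derivative from the kernel back onto [F]. *)
Lemma Cauchy_formula f c rho r w : holo_on (cdisc c r) f -> rho < r -> Cmod (w - c) < rho ->
  CI (fun t => f (circ c rho t) * (circ c rho t - c) / (circ c rho t - w))%C 0 (2 * PI) = ((2 * PI)%R * f w)%C.
Proof.
  intros Hf Hr Hw. assert (H : 0 <= rho) by (generalize (Cmod_ge_0 (w - c)); lra).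
  destruct (primitive_exists f c r Hf) as [F HF].
  assert (BF : forall t, Rdb (fun t => F (circ c rho t)) t).
  { intros t. apply (Rdb_comp F); [eexists; apply HF, circ_in_disc; lra|apply Rdb_circ]. }
  assert (Bf : forall t, Rdb (fun t => f (circ c rho t)) t).
  { intros t. apply (Rdb_comp f); [apply Hf, circ_in_disc; lra|apply Rdb_circ]. }
  assert (Bp : forall t, Rdb (fun t => F (circ c rho t) * (circ c rho t - c))%C t).
  { intros t. apply Rdb_mult; [apply BF|apply Rdb_circ_sub]. }
  assert (B1 : forall t, Rdb (fun t => f (circ c rho t) * (circ c rho t - c) / (circ c rho t - w))%C t).
  { intros t. apply Rdb_kernel; [exact H|exact Hw|]. apply Rdb_mult; [apply Bf|apply Rdb_circ_sub]. }
  assert (B2 : forall t, Rdb (fun t => F (circ c rho t) * (circ c rho t - c) / ((circ c rho t - w) * (circ c rho t - w)))%C t).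
  { intros t. apply Rdb_kernel2; [exact H|exact Hw|]. apply Bp. }
  assert (D := Cauchy_type_derive _ c rho w H Hw Bp).
  assert (D2 : Cder (fun w => (2 * PI)%R * F w)%C w ((2 * PI)%R * f w)%C).
  { apply Der_scal, HF. unfold cdisc; lra. }
  assert (E1 : CI (fun t => F (circ c rho t) * (circ c rho t - c) / ((circ c rho t - w) * (circ c rho t - w)))%C 0 (2 * PI)
     = ((2 * PI)%R * f w)%C).
  { apply (Cder_unique (fun w => (2 * PI)%R * F w)%C w); [|exact D2].
    refine (Der_ext_loc _ _ _ _ _ _ (rho - Cmod (w - c)) _ _ _ D); [lra| |].
    - intros h Hh. apply (Cauchy_formula_primitive F f c rho r); try assumption.
      replace (w + h - c)%C with (w - c + h)%C by ring.
      eapply Rle_lt_trans; [apply Cmod_triangle|]. lra.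
    - now apply (Cauchy_formula_primitive F f c rho r). }
  rewrite <- E1. apply Ceq_minus. rewrite <- CI_minus by (try apply two_PI_ge0; intros t _; auto).
  apply (CI_circ_closed (fun t => F (circ c rho t) / (circ c rho t - w))%C).
  - intros t. assert (N : (circ c rho t - w)%C <> 0) by now apply circ_neq.
    replace (Ci * (f (circ c rho t) * (circ c rho t - c) / (circ c rho t - w) -
      F (circ c rho t) * (circ c rho t - c) / ((circ c rho t - w) * (circ c rho t - w))))%C
    with ((f (circ c rho t) * (Ci * (circ c rho t - c)) * (circ c rho t - w)
        - F (circ c rho t) * (Ci * (circ c rho t - c) - 0)) / ((circ c rho t - w) * (circ c rho t - w)))%C by (field; exact N).
    apply (Der_div _ _ (fun t => F (circ c rho t))); [exact N| |].
    + apply (Der_comp _ _ F); [apply HF, circ_in_disc; lra|apply Rder_circ].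
    + apply Der_minus; [apply Rder_circ|apply Der_const].
  - intros t. apply Rdb_minus; auto.
  - now rewrite circ_closed.
Qed.

(** * Identity theorem and removable singularities *)

(* [2 PI] times the quotient of [f] minus its Taylor polynomial of degree [n - 1] at [c] by [(w - c)^n]. *)
Definition taylor_rem (f : C -> C) (c : C) (rho : R) (n : nat) (w : C) : C :=
  CI (fun t => f (circ c rho t) * (circ c rho t - c) / (circ c rho t - c) ^ n / (circ c rho t - w))%C 0 (2 * PI).

Lemma Cpow_S (z : C) n : (z ^ S n = z * z ^ n)%C.
Proof. reflexivity. Qed.

Lemma Rdb_pow (f : R -> C) n t : Rdb f t -> Rdb (fun t => f t ^ n)%C t.
Proof.
  intros H. induction n as [|n IH]; simpl; [apply Rdb_const|now apply Rdb_mult].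
Qed.

Lemma circ_center_neq c rho t : 0 < rho -> (circ c rho t - c)%C <> 0.
Proof. intros H. apply Cmod_gt_0. rewrite Cmod_circ; lra. Qed.

Lemma Rdb_taylor_num f c rho r n t : holo_on (cdisc c r) f -> 0 < rho < r ->
  Rdb (fun t => f (circ c rho t) * (circ c rho t - c) / (circ c rho t - c) ^ n)%C t.
Proof.
  intros Hf Hr. apply Rdb_div.
  - apply Cpow_nz, circ_center_neq; lra.
  - apply Rdb_mult; [|apply Rdb_circ_sub].
    apply (Rdb_comp f); [apply Hf, circ_in_disc; lra|apply Rdb_circ].
  - apply Rdb_pow, Rdb_circ_sub.
Qed.

Lemma taylor_rem_0 f c rho r w : holo_on (cdisc c r) f -> rho < r -> Cmod (w - c) < rho ->
  taylor_rem f c rho 0 w = ((2 * PI)%R * f w)%C.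
Proof.
  intros Hf Hr Hw. rewrite <- (Cauchy_formula f c rho r w Hf Hr Hw). unfold taylor_rem.
  apply CI_ext; [apply two_PI_ge0|]. intros t _. simpl.
  field. apply circ_neq; [generalize (Cmod_ge_0 (w - c)); lra|exact Hw].
Qed.

(** Under the integral, [1 / (z - w)] splits as [1 / (z - c) + (w - c) / ((z - c) (z - w))]. The
    value at [c] is [2 pi] times the Taylor coefficient of order [n]. *)
Lemma taylor_rem_S f c rho r n w : holo_on (cdisc c r) f -> rho < r -> Cmod (w - c) < rho ->
  taylor_rem f c rho n w = (taylor_rem f c rho n c + (w - c) * taylor_rem f c rho (S n) w)%C.
Proof.
  intros Hf Hr Hw.
  assert (H : 0 < rho) by (generalize (Cmod_ge_0 (w - c)); lra).
  assert (Hc : Cmod (c - c) < rho) by (replace (c - c)%C with (RtoC 0) by ring; rewrite Cmod_0; lra).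
  unfold taylor_rem. rewrite <- CI_scal, <- CI_plus; try apply two_PI_ge0.
  - apply CI_ext; [apply two_PI_ge0|]. intros t _. rewrite Cpow_S. field.
    repeat split; first [apply Cpow_nz, circ_center_neq; lra|apply circ_center_neq; lra|apply circ_neq; lra].
  - intros t _. apply Rdb_kernel; [lra|exact Hc|]. apply (Rdb_taylor_num f c rho r); [exact Hf|lra].
  - intros t _. apply Rdb_mult; [apply Rdb_const|].
    apply Rdb_kernel; [lra|exact Hw|]. apply (Rdb_taylor_num f c rho r); [exact Hf|lra].
  - intros t _. apply Rdb_kernel; [lra|exact Hw|]. apply (Rdb_taylor_num f c rho r); [exact Hf|lra].
Qed.

Lemma taylor_rem_Cdb f c rho r n w : holo_on (cdisc c r) f -> rho < r -> Cmod (w - c) < rho ->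
  Cdb (taylor_rem f c rho n) w.
Proof.
  intros Hf Hr Hw. assert (H : 0 < rho) by (generalize (Cmod_ge_0 (w - c)); lra).
  eexists. apply (Cauchy_type_derive (fun t => f (circ c rho t) * (circ c rho t - c) / (circ c rho t - c) ^ n)%C); [lra|exact Hw|].
  intros t. apply (Rdb_taylor_num f c rho r); [exact Hf|lra].
Qed.

Lemma taylor_rem_bound f c rho r w : holo_on (cdisc c r) f -> rho < r -> Cmod (w - c) < rho ->
  exists K, 0 <= K /\ forall n, Cmod (taylor_rem f c rho n w) <= K * (/ rho) ^ n.
Proof.
  intros Hf Hr Hw. assert (H : 0 < rho) by (generalize (Cmod_ge_0 (w - c)); lra).
  assert (B : Rdb_on (fun t => f (circ c rho t) * (circ c rho t - c))%C 0 (2 * PI)).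
  { intros t _. apply Rdb_mult; [|apply Rdb_circ_sub].
    apply (Rdb_comp f); [apply Hf, circ_in_disc; lra|apply Rdb_circ]. }
  destruct (Rdb_bounded _ _ _ two_PI_ge0 B) as (M & HM & HB).
  set (d := rho - Cmod (w - c)). assert (Hd : 0 < d) by (unfold d; lra).
  exists (2 * PI * (M / d)). split.
  { apply Rmult_le_pos; [apply two_PI_ge0|]. apply Rlt_le, Rdiv_lt_0_compat; lra. }
  intros n. unfold taylor_rem. eapply Rle_trans.
  - apply (CI_bound _ 0 (2 * PI) (M / d * (/ rho) ^ n) two_PI_ge0).
    + intros t _. apply Rdb_kernel; [lra|exact Hw|]. apply (Rdb_taylor_num f c rho r); [exact Hf|lra].
    + intros t Ht.
      assert (N1 : (circ c rho t - w)%C <> 0) by (apply circ_neq; lra).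
      assert (N2 : (circ c rho t - c)%C <> 0) by now apply circ_center_neq.
      rewrite !Cmod_div by (try apply Cpow_nz; assumption).
      rewrite (Cmod_pow (circ c rho t - c)), Cmod_circ by lra.
      specialize (HB t Ht). cbv beta in HB.
      assert (D : d <= Cmod (circ c rho t - w)) by (apply circ_dist; lra).
      unfold Rdiv. rewrite pow_inv.
      replace (M * / d * / rho ^ n) with (M * / rho ^ n * / d) by ring.
      assert (P : 0 < / rho ^ n) by (apply Rinv_0_lt_compat, pow_lt, H).
      apply Rmult_le_compat.
      * apply Rmult_le_pos; [apply Cmod_ge_0|lra].
      * apply Rlt_le, Rinv_0_lt_compat. lra.
      * apply Rmult_le_compat_r; [lra|exact HB].
      * apply Rinv_le_contravar; lra.
  - right. ring.
Qed.

Lemma Cdb_cont f z : Cdb f z -> forall eps, 0 < eps -> exists d, 0 < d /\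
  forall w, Cmod (w - z) < d -> Cmod (f w - f z) < eps.
Proof.
  intros [l H] eps He. destruct (Der_cont _ _ _ _ _ H eps He) as (d & Hd & K).
  exists d; split; [exact Hd|]. intros w Hw. specialize (K (w - z)%C Hw).
  replace (z + (w - z))%C with w in K by ring. exact K.
Qed.

Lemma Cdb_accum_zero f c : Cdb f c ->
  (forall d, 0 < d -> exists w, w <> c /\ Cmod (w - c) < d /\ f w = 0) -> f c = 0.
Proof.
  intros Hf H. apply Cmod_eq_0, Rle_antisym; [|apply Cmod_ge_0]. apply Rnot_lt_le. intros P.
  destruct (Cdb_cont f c Hf _ P) as (d & Hd & K). destruct (H d Hd) as (w & _ & Hw & E).
  specialize (K w Hw). rewrite E in K. replace (0 - f c)%C with (- f c)%C in K by ring.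
  rewrite Cmod_opp in K. lra.
Qed.

(** All Taylor coefficients at [c] vanish, so [2 pi f w] equals [(w - c)^n] times the remainder of
    order [n]. Cauchy's estimate makes this [O((|w - c| / rho)^n)] on a circle chosen with
    [|w - c| < rho < r]. *)
Lemma identity_disc f c r : holo_on (cdisc c r) f ->
  (forall d, 0 < d -> exists w, w <> c /\ Cmod (w - c) < d /\ f w = 0) ->
  forall w, cdisc c r w -> f w = 0.
Proof.
  intros Hf Hz w Hw. unfold cdisc in Hw.
  set (rho := (Cmod (w - c) + r) / 2).
  assert (H1 : Cmod (w - c) < rho) by (unfold rho; lra).
  assert (H2 : rho < r) by (unfold rho; lra).
  assert (H3 : 0 < rho) by (generalize (Cmod_ge_0 (w - c)); lra).
  assert (Hc : Cmod (c - c) < rho) by (replace (c - c)%C with (RtoC 0) by ring; rewrite Cmod_0; lra).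
  (* Accumulation of zeros at [c] passes from each remainder to the next: a remainder vanishes at
     [c] by continuity, and at every other zero the factor [w - c] cancels. *)
  assert (A : forall n d, 0 < d -> exists w, w <> c /\ Cmod (w - c) < d /\ taylor_rem f c rho n w = 0).
  { induction n as [|n IH]; intros d Hd.
    - destruct (Hz (Rmin d rho)) as (v & Hv1 & Hv2 & Hv3); [now apply Rmin_pos|].
      exists v. split; [exact Hv1|]. split; [exact (lt_Rmin_l _ _ _ Hv2)|].
      rewrite (taylor_rem_0 f c rho r); [rewrite Hv3; ring|exact Hf|exact H2|].
      exact (lt_Rmin_r _ _ _ Hv2).
    - assert (Z := Cdb_accum_zero _ c (taylor_rem_Cdb f c rho r n c Hf H2 Hc) IH).
      destruct (IH (Rmin d rho)) as (v & Hv1 & Hv2 & Hv3); [now apply Rmin_pos|].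
      exists v. split; [exact Hv1|]. split; [exact (lt_Rmin_l _ _ _ Hv2)|].
      rewrite (taylor_rem_S f c rho r) in Hv3; [|exact Hf|exact H2|exact (lt_Rmin_r _ _ _ Hv2)].
      rewrite Z, Cplus_0_l in Hv3.
      assert (Nv : (v - c)%C <> 0) by (intros E; apply Hv1, Ceq_minus, E).
      replace (taylor_rem f c rho (S n) v) with (/ (v - c) * ((v - c) * taylor_rem f c rho (S n) v))%C
        by (field; exact Nv).
      rewrite Hv3. ring. }
  assert (E : forall n, ((2 * PI)%R * f w = (w - c) ^ n * taylor_rem f c rho n w)%C).
  { induction n as [|n IH].
    - rewrite (taylor_rem_0 f c rho r) by assumption. simpl. ring.
    - rewrite IH, (taylor_rem_S f c rho r) by assumption.
      rewrite (Cdb_accum_zero _ c (taylor_rem_Cdb f c rho r n c Hf H2 Hc) (A n)), Cpow_S. ring. }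
  destruct (taylor_rem_bound f c rho r w Hf H2 H1) as (K & HK & B).
  assert (X : forall n, Cmod ((2 * PI)%R * f w) <= K * (Cmod (w - c) / rho) ^ n).
  { intros n. rewrite (E n), Cmod_mult, Cmod_pow. unfold Rdiv. rewrite Rpow_mult_distr.
    eapply Rle_trans; [apply Rmult_le_compat_l; [apply pow_le, Cmod_ge_0|apply B]|]. right; ring. }
  assert (L : is_lim_seq (fun n => K * (Cmod (w - c) / rho) ^ n) 0).
  { replace (Finite 0) with (Rbar_mult K 0) by (simpl; f_equal; ring).
    apply is_lim_seq_scal_l, is_lim_seq_geom. rewrite Rabs_pos_eq.
    - apply Rmult_lt_reg_r with rho; [exact H3|]. unfold Rdiv. rewrite Rmult_assoc, Rinv_l; lra.
    - apply Rmult_le_pos; [apply Cmod_ge_0|apply Rlt_le, Rinv_0_lt_compat, H3]. }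
  assert (Y := is_lim_seq_le _ _ _ _ X (is_lim_seq_const _) L). simpl in Y.
  assert (Z : Cmod ((2 * PI)%R * f w) = 0) by (apply Rle_antisym; [exact Y|apply Cmod_ge_0]).
  apply Cmod_eq_0 in Z.
  assert (NP : RtoC (2 * PI) <> 0) by (apply RtoC_neq_0; generalize PI_RGT_0; lra).
  replace (f w) with (/ (2 * PI)%R * ((2 * PI)%R * f w))%C by (field; exact NP).
  rewrite Z. ring.
Qed.

(** A chain of discs of radius [delta] with consecutive centres less than [delta] apart: vanishing
    on one disc supplies zeros accumulating at the next centre. *)
Lemma identity_segment f (a b : C) (delta : R) : 0 < delta ->
  (forall t, 0 <= t <= 1 -> holo_on (cdisc (a + t * (b - a))%C delta) f) ->
  (forall d, 0 < d -> exists w, w <> a /\ Cmod (w - a) < d /\ f w = 0) ->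
  forall w, cdisc b delta w -> f w = 0.
Proof.
  intros Hd Hf Hz.
  destruct (nfloor_ex (Cmod (b - a) / delta)) as [N [_ HN]].
  { apply Rmult_le_pos; [apply Cmod_ge_0|apply Rlt_le, Rinv_0_lt_compat, Hd]. }
  assert (PN : 0 < INR N + 1) by (generalize (pos_INR N); lra).
  set (p := fun j : nat => (a + (INR j / (INR N + 1))%R * (b - a))%C).
  assert (Hp : forall j, (j <= S N)%nat -> holo_on (cdisc (p j) delta) f).
  { intros j Hj. apply Hf. split.
    - apply Rmult_le_pos; [apply pos_INR|apply Rlt_le, Rinv_0_lt_compat, PN].
    - apply Rmult_le_reg_r with (INR N + 1); [exact PN|].
      unfold Rdiv. rewrite Rmult_assoc, Rinv_l by lra. apply le_INR in Hj. rewrite S_INR in Hj. lra. }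
  assert (A : forall j, (j <= S N)%nat -> forall w, cdisc (p j) delta w -> f w = 0).
  { induction j as [|j IH]; intros Hj.
    - apply identity_disc; [now apply Hp|]. unfold p.
      replace (a + (INR 0 / (INR N + 1))%R * (b - a))%C with a; [exact Hz|].
      simpl. replace (0 / (INR N + 1)) with 0 by (field; lra). ring.
    - apply identity_disc; [now apply Hp|]. intros d Hd2.
      assert (D : Cmod (p (S j) - p j) < delta).
      { unfold p. rewrite S_INR.
        replace (a + ((INR j + 1) / (INR N + 1))%R * (b - a) - (a + (INR j / (INR N + 1))%R * (b - a)))%C
          with ((/ (INR N + 1))%R * (b - a))%C.
        2:{ replace ((INR j + 1) / (INR N + 1)) with (INR j / (INR N + 1) + / (INR N + 1)) by (field; lra).
            rewrite RtoC_plus. ring. }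
        rewrite Cmod_mult, Cmod_R, Rabs_pos_eq by (apply Rlt_le, Rinv_0_lt_compat, PN).
        apply Rmult_lt_reg_l with (INR N + 1); [exact PN|].
        rewrite <- Rmult_assoc, Rinv_r, Rmult_1_l by lra.
        apply Rmult_lt_compat_r with (r := delta) in HN; [|exact Hd].
        replace (Cmod (b - a) / delta * delta) with (Cmod (b - a)) in HN by (field; lra). exact HN. }
      (* Half of the smaller margin: [p (S j) + x] is within [d] of its own centre and still inside
         the previous disc. *)
      set (x := Rmin d (delta - Cmod (p (S j) - p j)) / 2).
      assert (Hx : 0 < x) by (unfold x; generalize (Rmin_pos d (delta - Cmod (p (S j) - p j))); lra).
      assert (Hx1 : x < d) by (unfold x in *; generalize (Rmin_l d (delta - Cmod (p (S j) - p j))); lra).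
      assert (Hx2 : x < delta - Cmod (p (S j) - p j)) by (unfold x in *; generalize (Rmin_r d (delta - Cmod (p (S j) - p j))); lra).
      exists (p (S j) + x)%C.
      assert (Ex : (p (S j) + x - p (S j) = x)%C) by ring.
      split; [|split].
      + intros E. rewrite E in Ex. replace (p (S j) - p (S j))%C with (RtoC 0) in Ex by ring.
        apply RtoC_inj in Ex. lra.
      + rewrite Ex, Cmod_R, Rabs_pos_eq; lra.
      + apply IH; [lia|]. unfold cdisc.
        replace (p (S j) + x - p j)%C with (p (S j) - p j + x)%C by ring.
        eapply Rle_lt_trans; [apply Cmod_triangle|]. rewrite Cmod_R, Rabs_pos_eq; lra. }
  assert (E : p (S N) = b).
  { unfold p. rewrite S_INR. replace ((INR N + 1) / (INR N + 1)) with 1 by (field; lra). ring. }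
  rewrite <- E. apply A. lia.
Qed.

(** The conclusion has the form of the hypothesis at the other endpoint, so that segments can be
    joined into a broken line. *)
Lemma identity_segment_disc f (a b : C) (delta : R) : 0 < delta ->
  (forall t, 0 <= t <= 1 -> holo_on (cdisc (a + t * (b - a))%C delta) f) ->
  (forall d, 0 < d -> exists w, w <> a /\ Cmod (w - a) < d /\ f w = 0) ->
  forall d, 0 < d -> exists w, w <> b /\ Cmod (w - b) < d /\ f w = 0.
Proof.
  intros Hd Hf Hz d Hd2. pose proof (identity_segment f a b delta Hd Hf Hz) as A.
  set (x := Rmin d delta / 2). assert (Hx := Rmin_pos d delta Hd2 Hd).
  pose proof (Rmin_l d delta). pose proof (Rmin_r d delta).
  exists (b + x)%C. assert (Ex : (b + x - b = x)%C) by ring.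
  assert (Px : 0 < x) by (unfold x; lra).
  split; [|split].
  - intros E. rewrite E in Ex. replace (b - b)%C with (RtoC 0) in Ex by ring.
    apply RtoC_inj in Ex. lra.
  - rewrite Ex, Cmod_R, Rabs_pos_eq; unfold x in *; lra.
  - apply A. unfold cdisc. rewrite Ex, Cmod_R, Rabs_pos_eq; unfold x in *; lra.
Qed.

(** As [f] is bounded, [(z - p)^2 f z] extended by 0 is differentiable also at [p]. Its Taylor
    remainders of order 0 and 1 vanish at [p]; the one of order 2, divided by [2 pi], agrees with
    [f] near [p] and supplies the missing value. *)
Lemma removable_point f p r M : 0 < r ->
  (forall z, 0 < Cmod (z - p) < r -> Cdb f z /\ Cmod (f z) <= M) ->
  exists v, Cdb (fun z => if Ceq_dec z p then v else f z) p.
Proof.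
  intros Hr Hf.
  assert (HM : 0 <= M).
  { destruct (Hf (p + (r / 2)%R)%C) as [_ H].
    - replace (p + (r / 2)%R - p)%C with (RtoC (r / 2)) by ring. rewrite Cmod_R, Rabs_pos_eq; lra.
    - eapply Rle_trans; [apply Cmod_ge_0|exact H]. }
  set (g := fun z => if Ceq_dec z p then RtoC 0 else ((z - p) * (z - p) * f z)%C).
  assert (Eg : forall z, z <> p -> g z = ((z - p) * (z - p) * f z)%C).
  { intros z Hz. unfold g. now destruct (Ceq_dec z p). }
  assert (Eg0 : g p = 0) by (unfold g; now destruct (Ceq_dec p p)).
  assert (Ppos : forall z, z <> p -> 0 < Cmod (z - p)).
  { intros z Hz. apply Cmod_gt_0. intros E; apply Hz, Ceq_minus, E. }
  assert (Hg : holo_on (cdisc p r) g).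
  { intros z Hz. destruct (Ceq_dec z p) as [->|Nz].
    - exists 0. intros eps He. exists (Rmin r (eps / (M + 1))). split.
      { apply Rmin_pos; [exact Hr|apply Rdiv_lt_0_compat; lra]. }
      intros h Hh. rewrite Eg0.
      assert (Hh1 : Cmod h < r) by exact (lt_Rmin_l _ _ _ Hh).
      assert (Hh2 : Cmod h < eps / (M + 1)) by exact (lt_Rmin_r _ _ _ Hh).
      destruct (Ceq_dec (p + h) p) as [E|N].
      + rewrite E, Eg0. replace (0 - 0 - 0 * h)%C with (RtoC 0) by ring. rewrite Cmod_0.
        apply Rmult_le_pos; [lra|apply Cmod_ge_0].
      + rewrite Eg by exact N. pose proof (Ppos _ N) as P.
        replace (p + h - p)%C with h in * by ring.
        destruct (Hf (p + h)%C) as [_ B]; [replace (p + h - p)%C with h by ring; lra|].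
        replace (h * h * f (p + h) - 0 - 0 * h)%C with (h * h * f (p + h))%C by ring.
        rewrite !Cmod_mult.
        apply Rmult_lt_compat_r with (r := M + 1) in Hh2; [|lra].
        replace (eps / (M + 1) * (M + 1)) with eps in Hh2 by (field; lra).
        replace (Cmod h * Cmod h * Cmod (f (p + h)%C)) with (Cmod h * Cmod (f (p + h)%C) * Cmod h) by ring.
        apply Rmult_le_compat_r; [lra|].
        apply Rle_trans with (Cmod h * (M + 1)); [|lra]. apply Rmult_le_compat_l; lra.
    - apply (Cdb_ext_loc (fun z => (z - p) * (z - p) * f z)%C _ _ (Cmod (z - p))).
      + now apply Ppos.
      + intros x Hx. symmetry. apply Eg. intros ->. rewrite Cmod_sub_sym in Hx. lra.
      + apply Cdb_mult; [apply Cdb_mult; (apply Cdb_minus; [apply Cdb_id|apply Cdb_const])|].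
        apply Hf. split; [now apply Ppos|exact Hz]. }
  set (rho := r / 2). assert (Hrho : rho < r) by (unfold rho; lra).
  assert (Hrho0 : 0 < rho) by (unfold rho; lra).
  assert (Hc : Cmod (p - p) < rho) by (replace (p - p)%C with (RtoC 0) by ring; rewrite Cmod_0; lra).
  assert (NP : RtoC (2 * PI) <> 0) by (apply RtoC_neq_0; generalize PI_RGT_0; lra).
  assert (E1 : forall w, w <> p -> Cmod (w - p) < rho -> taylor_rem g p rho 1 w = ((2 * PI)%R * ((w - p) * f w))%C).
  { intros w Nw Hw. assert (N : (w - p)%C <> 0) by (apply Cmod_gt_0; auto).
    assert (E0 := taylor_rem_S g p rho r 0 w Hg Hrho Hw).
    rewrite !(taylor_rem_0 g p rho r) in E0 by assumption.
    rewrite Eg0, Eg in E0 by exact Nw.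
    replace (taylor_rem g p rho 1 w) with (/ (w - p) * ((2 * PI)%R * 0 + (w - p) * taylor_rem g p rho 1 w))%C
      by (field; exact N).
    rewrite <- E0. field. exact N. }
  (* Off [p] this remainder is [2 pi (z - p) f z], which tends to 0 because [f] is bounded;
     continuity forces the value 0 at [p]. *)
  assert (Z : taylor_rem g p rho 1 p = 0).
  { apply Cmod_eq_0, Rle_antisym; [|apply Cmod_ge_0]. apply Rnot_lt_le. intros P.
    destruct (Cdb_cont _ p (taylor_rem_Cdb g p rho r 1 p Hg Hrho Hc) (Cmod (taylor_rem g p rho 1 p) / 2))
      as (d & Hd & K); [lra|].
    set (T := Cmod (taylor_rem g p rho 1 p)) in *.
    assert (HQ : 0 < 2 * PI * (M + 1)) by (generalize PI_RGT_0; intros; apply Rmult_lt_0_compat; lra).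
    set (x := Rmin (Rmin d rho) (T / 2 / (2 * PI * (M + 1))) / 2).
    assert (X0 : 0 < Rmin (Rmin d rho) (T / 2 / (2 * PI * (M + 1)))).
    { apply Rmin_pos; [now apply Rmin_pos|]. apply Rdiv_lt_0_compat; lra. }
    assert (X1 := Rmin_l (Rmin d rho) (T / 2 / (2 * PI * (M + 1)))).
    assert (X2 := Rmin_r (Rmin d rho) (T / 2 / (2 * PI * (M + 1)))).
    assert (X3 := Rmin_l d rho). assert (X4 := Rmin_r d rho).
    assert (Ex : (p + x - p = x)%C) by ring.
    assert (Cx : Cmod x = x) by (rewrite Cmod_R, Rabs_pos_eq; unfold x; lra).
    assert (Nx : (p + x)%C <> p).
    { intros E. rewrite E in Ex. replace (p - p)%C with (RtoC 0) in Ex by ring.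
      apply RtoC_inj in Ex. unfold x in Ex. lra. }
    specialize (K (p + x)%C). rewrite Ex, Cx in K. specialize (K ltac:(unfold x; lra)).
    rewrite E1 in K; [|exact Nx|rewrite Ex, Cx; unfold x; lra].
    rewrite Ex in K.
    destruct (Hf (p + x)%C) as [_ B]; [rewrite Ex, Cx; unfold x; lra|].
    assert (U : Cmod ((2 * PI)%R * (x * f (p + x)%C)) < T / 2).
    { rewrite !Cmod_mult, Cx, Cmod_R, Rabs_pos_eq by apply two_PI_ge0.
      assert (Hx : x < T / 2 / (2 * PI * (M + 1))) by (unfold x; lra).
      apply Rmult_lt_compat_r with (r := 2 * PI * (M + 1)) in Hx; [|exact HQ].
      replace (T / 2 / (2 * PI * (M + 1)) * (2 * PI * (M + 1))) with (T / 2) in Hx by (field; generalize PI_RGT_0; lra).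
      eapply Rle_lt_trans; [|exact Hx].
      replace (x * (2 * PI * (M + 1))) with (2 * PI * (x * (M + 1))) by ring.
      apply Rmult_le_compat_l; [apply two_PI_ge0|]. apply Rmult_le_compat_l; [unfold x; lra|lra]. }
    generalize (Cmod_sub_ge (taylor_rem g p rho 1 p) ((2 * PI)%R * (x * f (p + x)%C))).
    rewrite Cmod_sub_sym. fold T. lra. }
  exists (/ (2 * PI)%R * taylor_rem g p rho 2 p)%C.
  apply (Cdb_ext_loc (fun z => / (2 * PI)%R * taylor_rem g p rho 2 z)%C _ _ rho Hrho0).
  - intros x Hx. destruct (Ceq_dec x p) as [->|Nx]; [reflexivity|].
    assert (N : (x - p)%C <> 0) by (apply Cmod_gt_0; auto).
    assert (E2 := taylor_rem_S g p rho r 1 x Hg Hrho Hx).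
    rewrite Z, E1 in E2 by assumption.
    replace (taylor_rem g p rho 2 x) with (/ (x - p) * (0 + (x - p) * taylor_rem g p rho 2 x))%C
      by (field; exact N).
    rewrite <- E2. field. auto.
  - apply Cdb_mult; [apply Cdb_const|]. now apply (taylor_rem_Cdb g p rho r).
Qed.

(** All exceptional points are filled at once, with values chosen by description. Since they are
    isolated, near any point of [D] at most the value at that point itself has been changed. *)
Lemma removable_set f (D S : C -> Prop) :
  (forall p, D p -> exists d, 0 < d /\ forall z, 0 < Cmod (z - p) < d -> ~ S z) ->
  (forall p, D p -> ~ S p -> Cdb f p) ->
  (forall p, D p -> S p -> exists d M, 0 < d /\
     forall z, 0 < Cmod (z - p) < d -> Cdb f z /\ Cmod (f z) <= M) ->
  exists g, holo_on D g /\ forall z, ~ S z -> g z = f z.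
Proof.
  intros Hi Hf HS.
  assert (V : forall p, exists v, D p -> S p -> Cdb (fun z => if Ceq_dec z p then v else f z) p).
  { intros p. destruct (excluded_middle_informative (D p /\ S p)) as [[Dp Sp]|N].
    - destruct (HS p Dp Sp) as (d & M & Hd & H). destruct (removable_point f p d M Hd H) as [v Hv].
      now exists v.
    - exists 0. intros; tauto. }
  pose (v := fun p => proj1_sig (constructive_indefinite_description _ (V p))).
  assert (Hv : forall p, D p -> S p -> Cdb (fun z => if Ceq_dec z p then v p else f z) p).
  { intros p. unfold v. destruct (constructive_indefinite_description _ (V p)); assumption. }
  exists (fun z => if excluded_middle_informative (S z) then v z else f z). split.
  - intros p Dp. destruct (Hi p Dp) as (d & Hd & Hs).
    destruct (excluded_middle_informative (S p)) as [Sp|Np].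
    + apply (Cdb_ext_loc (fun z => if Ceq_dec z p then v p else f z) _ _ d Hd); [|now apply Hv].
      intros x Hx. destruct (Ceq_dec x p) as [->|Nx].
      * now destruct (excluded_middle_informative (S p)).
      * destruct (excluded_middle_informative (S x)) as [Sx|]; [|reflexivity].
        exfalso. apply (Hs x); [|exact Sx]. split; [|exact Hx].
        apply Cmod_gt_0. intros E; apply Nx, Ceq_minus, E.
    + apply (Cdb_ext_loc f _ _ d Hd); [|now apply Hf].
      intros x Hx. destruct (excluded_middle_informative (S x)) as [Sx|]; [|reflexivity].
      destruct (Ceq_dec x p) as [->|Nx]; [contradiction|].
      exfalso. apply (Hs x); [|exact Sx]. split; [|exact Hx].
      apply Cmod_gt_0. intros E; apply Nx, Ceq_minus, E.
  - intros z Nz. now destruct (excluded_middle_informative (S z)).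
Qed.

(** * Improper integrals and Mellin transforms *)

(** Below, differentiation under an improper integral or a series takes this form: the second-order
    remainder is itself an integral or a series, bounded by [K] times the square of the
    increment. *)
Lemma Der_quadratic {T : Type} (add : T -> T -> T) (j : T -> C) f z l K d : 0 < d ->
  (forall h, Cmod (j h) < d -> Cmod (f (add z h) - f z - l * j h)%C <= K * Cmod (j h) ^ 2) ->
  Der add j f z l.
Proof.
  intros Hd H eps He.
  exists (Rmin d (eps / (Rabs K + 1))). pose proof (Rabs_pos K) as HK. pose proof (Rle_abs K) as HK2.
  split; [apply Rmin_pos; [exact Hd|apply Rdiv_lt_0_compat; lra]|].
  intros h Hh. eapply Rle_trans; [apply H; exact (lt_Rmin_l _ _ _ Hh)|].
  assert (Hh2 : Cmod (j h) < eps / (Rabs K + 1)) by exact (lt_Rmin_r _ _ _ Hh).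
  apply Rmult_lt_compat_r with (r := Rabs K + 1) in Hh2; [|lra].
  replace (eps / (Rabs K + 1) * (Rabs K + 1)) with eps in Hh2 by (field; lra).
  pose proof (Cmod_ge_0 (j h)). replace (K * Cmod (j h) ^ 2) with (K * Cmod (j h) * Cmod (j h)) by ring.
  apply Rmult_le_compat_r; [assumption|]. nra.
Qed.

Lemma Rpower_pos x p : 0 < Rpower x p.
Proof. apply exp_pos. Qed.

Lemma ln_nonneg x : 1 <= x -> 0 <= ln x.
Proof. intros [H| <-]; [rewrite <- ln_1; apply Rlt_le, ln_increasing; lra|rewrite ln_1; lra]. Qed.

Lemma ln_nonpos x : 0 < x <= 1 -> ln x <= 0.
Proof. intros [H0 [H| ->]]; [rewrite <- ln_1; apply Rlt_le, ln_increasing; lra|rewrite ln_1; lra]. Qed.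

Lemma Rpower_mono_exp x p q : 1 <= x -> p <= q -> Rpower x p <= Rpower x q.
Proof. intros Hx H. apply exp_le, Rmult_le_compat_r; [now apply ln_nonneg|exact H]. Qed.

Lemma Rpower_anti_exp x p q : 0 < x <= 1 -> p <= q -> Rpower x q <= Rpower x p.
Proof. intros Hx H. apply exp_le. pose proof (ln_nonpos x Hx). nra. Qed.

Lemma Rpower_tends_0 p : 0 < p -> forall eps, 0 < eps -> exists d, 0 < d <= 1 /\
  forall x, 0 < x <= d -> Rpower x p <= eps.
Proof.
  intros Hp eps He. exists (Rmin 1 (Rpower eps (/ p))).
  split; [split; [apply Rmin_pos; [lra|apply Rpower_pos]|apply Rmin_l]|].
  intros x [H0 Hx].
  assert (Hx2 : x <= Rpower eps (/ p)) by (eapply Rle_trans; [exact Hx|apply Rmin_r]).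
  replace eps with (Rpower (Rpower eps (/ p)) p).
  - apply Rle_Rpower_l; lra.
  - rewrite Rpower_mult, Rinv_l, Rpower_1; lra.
Qed.

Lemma Rpower_inv_arg x p : 0 < x -> Rpower (/ x) p = Rpower x (- p).
Proof. intros H. unfold Rpower. rewrite ln_Rinv by exact H. f_equal; ring. Qed.

Lemma Rpower_neg_tends_0 q : q < 0 -> forall eps, 0 < eps -> exists M, 1 <= M /\
  forall x, M <= x -> Rpower x q <= eps.
Proof.
  intros Hq eps He. destruct (Rpower_tends_0 (- q) ltac:(lra) eps He) as (d & Hd & H).
  assert (Hi : 1 <= / d) by (rewrite <- Rinv_1; apply Rinv_le_contravar; lra).
  exists (/ d). split; [exact Hi|].
  intros x Hx. rewrite <- (Rinv_inv x), Rpower_inv_arg by (apply Rinv_0_lt_compat; lra).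
  apply H. split; [apply Rinv_0_lt_compat; lra|].
  rewrite <- (Rinv_inv d). apply Rinv_le_contravar; [lra|exact Hx].
Qed.

Lemma is_derive_Rpower x p : 0 < x -> is_derive (fun x => Rpower x p) x (p * Rpower x (p - 1)).
Proof.
  intros H. unfold Rpower. auto_derive; [exact H|].
  replace ((p - 1) * ln x) with (p * ln x + - ln x) by ring.
  rewrite exp_plus, exp_Ropp, exp_ln by exact H. field. lra.
Qed.

Lemma is_RInt_Rpower c p u v : p <> -1 -> 0 < u <= v ->
  is_RInt (fun x => c * Rpower x p) u v (c * ((Rpower v (p + 1) - Rpower u (p + 1)) / (p + 1))).
Proof.
  intros Hp Hu.
  replace (c * ((Rpower v (p + 1) - Rpower u (p + 1)) / (p + 1))) with
    (minus (c / (p + 1) * Rpower v (p + 1)) (c / (p + 1) * Rpower u (p + 1)))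
    by (unfold minus, plus, opp; simpl; field; lra).
  apply (is_RInt_derive (V := R_CompleteNormedModule) (fun x => c / (p + 1) * Rpower x (p + 1))); intros x Hx; rewrite Rmin_left, Rmax_right in Hx by lra.
  - replace (c * Rpower x p) with (c / (p + 1) * ((p + 1) * Rpower x (p + 1 - 1))).
    + apply (is_derive_scal (fun x => Rpower x (p + 1))), is_derive_Rpower. lra.
    + replace (p + 1 - 1) with p by ring. field. lra.
  - apply (ex_derive_continuous (V := R_NormedModule)). eexists.
    apply (is_derive_scal (fun x => Rpower x p)), is_derive_Rpower. lra.
Qed.

Lemma CI_power_bound f c p u v : p <> -1 -> 0 < u <= v -> Rdb_on f u v ->
  (forall x, u <= x <= v -> Cmod (f x) <= c * Rpower x p) ->
  Cmod (CI f u v) <= c * ((Rpower v (p + 1) - Rpower u (p + 1)) / (p + 1)).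
Proof.
  intros Hp Hu Hf H. apply (CI_le f (fun x => c * Rpower x p)); [lra|exact Hf|exact H|].
  now apply is_RInt_Rpower.
Qed.

(* [l] is the integral of [f] over [(0, +oo)]; the differentiability makes [f] integrable on compacts. *)
Definition Imp (f : R -> C) (l : C) : Prop :=
  (forall x, 0 < x -> Rdb f x) /\
  forall eps, 0 < eps -> exists d M, 0 < d /\
    forall a b, 0 < a < d -> M < b -> a <= b -> Cmod (CI f a b - l) <= eps.

Lemma Imp_CInt f l : Imp f l -> CInt_0_infty f = l.
Proof.
  intros [Hf H]. unfold CInt_0_infty.
  apply (is_RInt_gen_unique (V := C_R_CompleteNormedModule)).
  intros P [eps HP]. destruct (H (eps / 2)) as (d & M & Hd & K); [generalize (cond_pos eps); lra|].
  unfold filtermapi.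
  apply (Filter_prod _ _ _ (fun a => 0 < a < Rmin d 1) (fun b => Rmax M 1 < b)).
  - exists (mkposreal _ (Rmin_pos d 1 Hd Rlt_0_1)). intros a Ha Ha0. split; [exact Ha0|].
    change (Rabs (a - 0) < Rmin d 1) in Ha. rewrite Rminus_0_r, Rabs_pos_eq in Ha by lra. exact Ha.
  - exists (Rmax M 1). intros b Hb; exact Hb.
  - intros a b [Ha0 Ha] Hb. pose proof (Rmin_l d 1). pose proof (Rmin_r d 1).
    pose proof (Rmax_l M 1). pose proof (Rmax_r M 1).
    exists (CI f a b). split.
    + apply CI_correct; [simpl; lra|]. intros t Ht. apply Hf. simpl in *. lra.
    + apply HP. apply (C_NormedModule_mixin_compat1 l (CI f a b)).
      change (Cmod (CI f a b - l) < eps).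
      eapply Rle_lt_trans; [apply K; lra|]. generalize (cond_pos eps); lra.
Qed.

Lemma Imp_unique f l m : Imp f l -> Imp f m -> l = m.
Proof. intros H K. apply Imp_CInt in H, K. congruence. Qed.

Lemma Imp_ext f g l : (forall x, 0 < x -> f x = g x) -> Imp f l -> Imp g l.
Proof.
  intros E [Hf H]. split.
  - intros x Hx. apply (Rdb_ext_loc f g x x Hx); [|now apply Hf].
    intros y Hy. apply E. apply Rabs_def2 in Hy. lra.
  - intros eps He. destruct (H eps He) as (d & M & Hd & K). exists d, M. split; [exact Hd|].
    intros a b Ha Hb Hab. rewrite <- (CI_ext f g a b Hab); [now apply K|].
    intros t Ht. apply E. lra.
Qed.

Lemma Rdb_on_pos f a b : (forall x, 0 < x -> Rdb f x) -> 0 < a -> Rdb_on f a b.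
Proof. intros H Ha t Ht. apply H. lra. Qed.

Lemma Imp_plus f g l m : Imp f l -> Imp g m -> Imp (fun x => f x + g x)%C (l + m)%C.
Proof.
  intros [Hf H] [Hg K]. split; [intros; apply Rdb_plus; auto|].
  intros eps He.
  destruct (H (eps/2)) as (d1 & M1 & Hd1 & H1); [lra|].
  destruct (K (eps/2)) as (d2 & M2 & Hd2 & H2); [lra|].
  exists (Rmin d1 d2), (Rmax M1 M2). split; [now apply Rmin_pos|].
  intros a b Ha Hb Hab.
  pose proof (Rmin_l d1 d2). pose proof (Rmin_r d1 d2).
  pose proof (Rmax_l M1 M2). pose proof (Rmax_r M1 M2).
  rewrite CI_plus by (try exact Hab; apply Rdb_on_pos; auto; lra).
  replace (CI f a b + CI g a b - (l + m))%C with ((CI f a b - l) + (CI g a b - m))%C by ring.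
  eapply Rle_trans; [apply Cmod_triangle|].
  specialize (H1 a b ltac:(lra) ltac:(lra) Hab). specialize (H2 a b ltac:(lra) ltac:(lra) Hab). lra.
Qed.

Lemma Imp_scal c f l : Imp f l -> Imp (fun x => c * f x)%C (c * l)%C.
Proof.
  intros [Hf H]. split; [intros; apply Rdb_mult; [apply Rdb_const|auto]|].
  intros eps He. pose proof (Cmod_ge_0 c).
  destruct (H (eps / (Cmod c + 1))) as (d & M & Hd & K); [apply Rdiv_lt_0_compat; lra|].
  exists d, M. split; [exact Hd|]. intros a b Ha Hb Hab.
  rewrite CI_scal by (try exact Hab; apply Rdb_on_pos; auto; lra).
  replace (c * CI f a b - c * l)%C with (c * (CI f a b - l))%C by ring. rewrite Cmod_mult.
  specialize (K a b Ha Hb Hab).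
  apply Rle_trans with ((Cmod c + 1) * (eps / (Cmod c + 1))).
  - apply Rmult_le_compat; [lra|apply Cmod_ge_0|lra|exact K].
  - right; field; lra.
Qed.

Lemma Imp_minus f g l m : Imp f l -> Imp g m -> Imp (fun x => f x - g x)%C (l - m)%C.
Proof.
  intros H K. replace (l - m)%C with (l + -(1) * m)%C by ring.
  apply (Imp_ext (fun x => f x + -(1) * g x)%C); [intros; ring|].
  apply Imp_plus; [exact H|now apply Imp_scal].
Qed.

Lemma Imp_scale f l t : 0 < t -> Imp f l -> Imp (fun x => t * f (t * x)%R)%C l.
Proof.
  intros Ht [Hf H]. split.
  - intros x Hx. apply Rdb_mult; [apply Rdb_const|].
    destruct (Hf (t * x)) as [m Hm]; [now apply Rmult_lt_0_compat|].
    exists (m * t)%C. intros eps He. destruct (Hm (eps / t)) as (d & Hd & K); [now apply Rdiv_lt_0_compat|].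
    exists (d / t). split; [now apply Rdiv_lt_0_compat|]. intros h Hh. rewrite Cmod_R in *.
    specialize (K (t * h)). rewrite Cmod_R, Rabs_mult, (Rabs_pos_eq t) in K by lra.
    replace (t * (x + h)) with (t * x + t * h) by ring.
    replace (m * t * h)%C with (m * (t * h)%R)%C by (rewrite RtoC_mult; ring).
    replace (eps * Rabs h) with (eps / t * (t * Rabs h)) by (field; lra).
    apply K. apply Rmult_lt_compat_l with (r := t) in Hh; [|exact Ht].
    replace (t * (d / t)) with d in Hh by (field; lra). exact Hh.
  - intros eps He. destruct (H eps He) as (d & M & Hd & K).
    exists (d / t), (M / t). split; [now apply Rdiv_lt_0_compat|]. intros a b Ha Hb Hab.
    assert (E := CI_comp_lin f t 0 a b Ht Hab). rewrite !Rplus_0_r in E.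
    rewrite (CI_ext (fun x => t * f (t * x)%R)%C (fun x => t * f (t * x + 0)%R)%C) by
      (try exact Hab; intros; now rewrite Rplus_0_r).
    assert (Pa : 0 < t * a) by (apply Rmult_lt_0_compat; lra).
    rewrite E by (intros y Hy; apply Hf; lra).
    apply K.
    + split; [exact Pa|]. destruct Ha as [_ Ha]. apply Rmult_lt_compat_l with (r := t) in Ha; [|exact Ht].
      replace (t * (d / t)) with d in Ha by (field; lra). exact Ha.
    + apply Rmult_lt_compat_l with (r := t) in Hb; [|exact Ht].
      replace (t * (M / t)) with M in Hb by (field; lra). exact Hb.
    + apply Rmult_le_compat_l; lra.
Qed.

Definition lim0 (F : R -> C) (l : C) : Prop :=
  forall eps, 0 < eps -> exists d, 0 < d /\ forall x, 0 < x < d -> Cmod (F x - l) <= eps.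
Definition liminf (F : R -> C) (l : C) : Prop :=
  forall eps, 0 < eps -> exists M, forall x, M < x -> Cmod (F x - l) <= eps.

Lemma Imp_FTC F f l0 l1 : (forall x, 0 < x -> Rder F x (f x)) -> (forall x, 0 < x -> Rdb f x) ->
  lim0 F l0 -> liminf F l1 -> Imp f (l1 - l0)%C.
Proof.
  intros HF Hf H0 H1. split; [exact Hf|]. intros eps He.
  destruct (H0 (eps/2)) as (d & Hd & K0); [lra|]. destruct (H1 (eps/2)) as (M & K1); [lra|].
  exists d, M. split; [exact Hd|]. intros a b Ha Hb Hab.
  rewrite (CI_FTC F); [|exact Hab|intros t Ht; apply HF; lra|intros t Ht; apply Hf; lra].
  replace (F b - F a - (l1 - l0))%C with ((F b - l1) - (F a - l0))%C by ring.
  eapply Rle_trans; [apply Cmod_sub_le|]. specialize (K0 a Ha). specialize (K1 b Hb). lra.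
Qed.

(** Power bounds with exponent [p] at 0 and [q] at infinity under one constant. The integral
    converges for [-1 < p] and [q < -1], and a factor [RCpower x s] shifts both exponents by
    [Re s]. *)
Definition Dom (f : R -> C) (c p q : R) : Prop :=
  (forall x, 0 < x -> Rdb f x) /\
  (forall x, 0 < x <= 1 -> Cmod (f x) <= c * Rpower x p) /\
  (forall x, 1 <= x -> Cmod (f x) <= c * Rpower x q).

Lemma Dom_const_ge0 f c p q : Dom f c p q -> 0 <= c.
Proof.
  intros (_ & H & _). specialize (H 1 ltac:(lra)).
  unfold Rpower in H. rewrite ln_1, Rmult_0_r, exp_0 in H.
  generalize (Cmod_ge_0 (f 1)). lra.
Qed.

(** Comparison with [c x^p] on [(0, 1]] and [c x^q] on [[1, +oo)], whose integrals are the two terms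
    of the bound. The bound on the value is what later permits derivatives and limits under the
    integral sign. *)
Lemma Imp_dom f c p q : Dom f c p q -> -1 < p -> q < -1 ->
  exists l, Imp f l /\ Cmod l <= c * (/ (p + 1) + / (- 1 - q)).
Proof.
  intros HD Hp Hq. pose proof (Dom_const_ge0 _ _ _ _ HD) as Hc. destruct HD as (Hf & H0 & H1).
  set (T := fun a b => c * (Rpower a (p + 1) * / (p + 1) + Rpower b (q + 1) * / (- 1 - q))).
  assert (Ip : 0 < / (p + 1)) by (apply Rinv_0_lt_compat; lra).
  assert (Iq : 0 < / (- 1 - q)) by (apply Rinv_0_lt_compat; lra).
  assert (L0 : forall a a', 0 < a <= a' -> a' <= 1 -> Cmod (CI f a a') <= c * (Rpower a' (p + 1) * / (p + 1))).
  { intros a a' Ha Ha'. eapply Rle_trans.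
    - apply (CI_power_bound f c p a a'); [lra|exact Ha|apply Rdb_on_pos; auto; lra|]. intros x Hx; apply H0; lra.
    - apply Rmult_le_compat_l; [exact Hc|]. apply Rmult_le_compat_r; [lra|]. generalize (Rpower_pos a (p + 1)); lra. }
  assert (L1 : forall b b', 1 <= b' <= b -> Cmod (CI f b' b) <= c * (Rpower b' (q + 1) * / (- 1 - q))).
  { intros b b' Hb. eapply Rle_trans.
    - apply (CI_power_bound f c q b' b); [lra|lra|apply Rdb_on_pos; auto; lra|]. intros x Hx; apply H1; lra.
    - apply Rmult_le_compat_l; [exact Hc|].
      replace ((Rpower b (q + 1) - Rpower b' (q + 1)) / (q + 1)) with
       ((Rpower b' (q + 1) - Rpower b (q + 1)) * / (- 1 - q)) by (field; lra).
      apply Rmult_le_compat_r; [lra|]. generalize (Rpower_pos b (q + 1)); lra. }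
  assert (LT : forall a a' b b', 0 < a <= a' -> a' <= 1 -> 1 <= b' <= b -> Cmod (CI f a b - CI f a' b') <= T a' b').
  { intros a a' b b' Ha Ha' Hb.
    rewrite (CI_chasles f a a' b) by (try lra; apply Rdb_on_pos; auto; lra).
    rewrite (CI_chasles f a' b' b) by (try lra; apply Rdb_on_pos; auto; lra).
    replace (CI f a a' + (CI f a' b' + CI f b' b) - CI f a' b')%C with (CI f a a' + CI f b' b)%C by ring.
    eapply Rle_trans; [apply Cmod_triangle|]. specialize (L0 a a' Ha Ha'). specialize (L1 b b' Hb).
    unfold T. lra. }
  assert (TS : forall eps, 0 < eps -> exists d M, 0 < d <= 1 /\ 1 <= M /\
             forall a b, 0 < a <= d -> M <= b -> T a b <= eps).
  { intros eps He. set (e' := eps / (2 * (c + 1) * (/ (p + 1) + / (- 1 - q)))).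
    assert (HQ : 0 < 2 * (c + 1) * (/ (p + 1) + / (- 1 - q))) by (apply Rmult_lt_0_compat; lra).
    assert (He' : 0 < e') by (unfold e'; now apply Rdiv_lt_0_compat).
    destruct (Rpower_tends_0 (p + 1) ltac:(lra) e' He') as (d & Hd & Kd).
    destruct (Rpower_neg_tends_0 (q + 1) ltac:(lra) e' He') as (M & HM & KM).
    exists d, M. split; [exact Hd|]. split; [exact HM|]. intros a b Ha Hb. specialize (Kd a Ha). specialize (KM b Hb).
    unfold T. apply Rle_trans with (c * (e' * / (p + 1) + e' * / (- 1 - q))).
    - apply Rmult_le_compat_l; [exact Hc|]. apply Rplus_le_compat; apply Rmult_le_compat_r; lra.
    - apply Rle_trans with ((c + 1) * (e' * / (p + 1) + e' * / (- 1 - q))).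
      + apply Rmult_le_compat_r; [|lra]. apply Rplus_le_le_0_compat; apply Rmult_le_pos; lra.
      + replace ((c + 1) * (e' * / (p + 1) + e' * / (- 1 - q))) with (eps / 2); [lra|].
        unfold e'. set (u := / (p + 1)) in *. set (v := / (-1 - q)) in *. field. lra. }
  assert (Pn : forall n, 1 <= INR n + 1) by (intros n; generalize (pos_INR n); lra).
  assert (Pin : forall n, 0 < / (INR n + 1) <= 1).
  { intros n. specialize (Pn n). split; [apply Rinv_0_lt_compat; lra|].
    rewrite <- Rinv_1. apply Rinv_le_contravar; lra. }
  (* For [n = 0] the exhausting interval degenerates to [[1, 1]]; comparing the limit with that
     empty integral yields the bound on [l]. *)
  set (u := fun n => CI f (/ (INR n + 1)) (INR n + 1)).
  set (e := fun n => T (/ (INR n + 1)) (INR n + 1)).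
  assert (Te : forall n, 0 <= e n).
  { intros n. unfold e, T. apply Rmult_le_pos; [exact Hc|].
    apply Rplus_le_le_0_compat; apply Rmult_le_pos; try lra; apply Rlt_le, Rpower_pos. }
  assert (Elim : forall eps, 0 < eps -> exists N, forall n, (N <= n)%nat -> e n <= eps).
  { intros eps He. destruct (TS eps He) as (d & M & Hd & HM & K).
    destruct (nfloor_ex (Rmax M (/ d))) as [N [_ HN]].
    { generalize (Rmax_l M (/ d)); lra. }
    exists N. intros n Hn. apply le_INR in Hn. unfold e.
    pose proof (Rmax_l M (/ d)). pose proof (Rmax_r M (/ d)). specialize (Pn n).
    apply K; [|lra]. split; [apply Rinv_0_lt_compat; lra|].
    rewrite <- (Rinv_inv d). apply Rinv_le_contravar; [apply Rinv_0_lt_compat; lra|lra]. }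
  destruct (C_Cauchy_limit u e) as [l Hl].
  { apply is_lim_seq_spec. intros eps. destruct (Elim (eps / 2)) as [N HN]; [generalize (cond_pos eps); lra|].
    exists N. intros n Hn. specialize (HN n Hn). rewrite Rminus_0_r, Rabs_pos_eq by auto.
    generalize (cond_pos eps); lra. }
  { intros n m Hnm.
    apply (LT (/ (INR m + 1)) (/ (INR n + 1)) (INR m + 1) (INR n + 1)).
    - split; [apply Pin|]. apply Rinv_le_contravar; [specialize (Pn n); lra|].
      apply le_INR in Hnm. lra.
    - apply Pin.
    - split; [apply Pn|]. apply le_INR in Hnm. lra. }
  exists l. split.
  - split; [exact Hf|]. intros eps He.
    destruct (Elim (eps/2)) as [N HN]; [lra|]. specialize (HN N (Nat.le_refl _)).
    exists (/ (INR N + 1)), (INR N + 1). split; [apply Pin|]. intros a b Ha Hb Hab.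
    assert (X : Cmod (CI f a b - u N) <= e N).
    { apply (LT a (/ (INR N + 1)) b (INR N + 1)); [lra|apply Pin|]. specialize (Pn N). lra. }
    specialize (Hl N). generalize (Cmod_triangle (CI f a b - u N) (u N - l)).
    replace (CI f a b - u N + (u N - l))%C with (CI f a b - l)%C by ring.
    rewrite (Cmod_sub_sym (u N) l). lra.
  - specialize (Hl 0%nat). unfold u, e in Hl. simpl INR in Hl. rewrite Rplus_0_l, Rinv_1 in Hl.
    assert (Z : CI f 1 1 = 0).
    { apply CI_unique, (is_RInt_point (V := C_R_NormedModule)). }
    rewrite Z in Hl. replace (l - 0)%C with l in Hl by ring.
    unfold T in Hl. replace (Rpower 1 (p + 1)) with 1 in Hl by (unfold Rpower; rewrite ln_1, Rmult_0_r, exp_0; reflexivity).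
    replace (Rpower 1 (q + 1)) with 1 in Hl by (unfold Rpower; rewrite ln_1, Rmult_0_r, exp_0; reflexivity).
    lra.
Qed.

(** * Complex powers and Mellin transforms *)

Lemma Re_scal_ln (s : C) (y : R) : Re (s * y) = Re s * y.
Proof. unfold Re; simpl; ring. Qed.

Lemma Cmod_RCpower x s : Cmod (RCpower x s) = Rpower x (Re s).
Proof. unfold RCpower, Rpower. now rewrite Cmod_Cexp, Re_scal_ln. Qed.

Lemma RCpower_add x s t : RCpower x (s + t) = (RCpower x s * RCpower x t)%C.
Proof. unfold RCpower. rewrite <- Cexp_add. f_equal; ring. Qed.

Lemma RCpower_RtoC x p : RCpower x (RtoC p) = RtoC (Rpower x p).
Proof. unfold RCpower, Rpower. now rewrite <- RtoC_mult, Cexp_RtoC. Qed.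

Lemma RCpower_1 x : 0 < x -> RCpower x 1 = RtoC x.
Proof. intros H. now rewrite RCpower_RtoC, Rpower_1. Qed.

Lemma RCpower_sub1 x s : 0 < x -> RCpower x (s - 1) = (RCpower x s / x)%C.
Proof.
  intros H. assert (N : RtoC x <> 0) by (apply RtoC_neq_0; lra).
  replace (RCpower x s) with (RCpower x ((s - 1) + 1)) by (f_equal; ring).
  rewrite RCpower_add, RCpower_1 by exact H. field. exact N.
Qed.

Lemma RCpower_mult_arg x y s : 0 < x -> 0 < y -> RCpower (x * y) s = (RCpower x s * RCpower y s)%C.
Proof. intros Hx Hy. unfold RCpower. rewrite ln_mult, RtoC_plus, <- Cexp_add by assumption. f_equal; ring. Qed.

Lemma Rder_ln x : 0 < x -> Rder (fun x => RtoC (ln x)) x (/ x)%C.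
Proof.
  intros H. rewrite <- RtoC_inv by lra. apply Rder_RtoC. auto_derive; [exact H|]. field. lra.
Qed.

Lemma Rder_RCpower x s : 0 < x -> Rder (fun x => RCpower x s) x (s * RCpower x (s - 1))%C.
Proof.
  intros H. rewrite RCpower_sub1 by exact H. unfold Rdiv, Cdiv.
  replace (s * (RCpower x s * / x))%C with (Cexp (s * ln x) * (s * / x))%C by (unfold RCpower; ring).
  apply (Der_comp _ _ Cexp (fun x => s * ln x)%C); [apply Cder_Cexp|].
  apply Der_scal. now apply Rder_ln.
Qed.

Lemma Rdb_RCpower x s : 0 < x -> Rdb (fun x => RCpower x s) x.
Proof. intros H. eexists. now apply Rder_RCpower. Qed.

Lemma Rdb_ln x : 0 < x -> Rdb (fun x => RtoC (ln x)) x.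
Proof. intros H. eexists. now apply Rder_ln. Qed.

Lemma exp_ge_1plus x : 1 + x <= exp x.
Proof. destruct (Req_dec x 0) as [->|N]; [rewrite exp_0; lra|apply Rlt_le, exp_ineq1; exact N]. Qed.

Lemma exp_ge_sqr u : 0 <= u -> u ^ 2 <= 4 * exp u.
Proof.
  intros H. replace (exp u) with (exp (u / 2) * exp (u / 2)).
  - generalize (exp_ge_1plus (u / 2)); intros. nra.
  - rewrite <- exp_plus. f_equal; field.
Qed.

Lemma exp_absln_mul_le1 x a p : 0 < x <= 1 -> exp (a * Rabs (ln x)) * Rpower x p = Rpower x (p - a).
Proof.
  intros H. rewrite Rabs_left1 by now apply ln_nonpos. unfold Rpower. rewrite <- exp_plus. f_equal; ring.
Qed.

Lemma exp_absln_mul_ge1 x a p : 1 <= x -> exp (a * Rabs (ln x)) * Rpower x p = Rpower x (p + a).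
Proof.
  intros H. rewrite Rabs_pos_eq by now apply ln_nonneg. unfold Rpower. rewrite <- exp_plus. f_equal; ring.
Qed.

(** The factor [exp (a |ln x|)] is [x^(-a)] below 1 and [x^a] above, so it loosens each exponent by
    [a]. It absorbs logarithms and powers [x^h], which keeps derivatives in [s] integrable. *)
Lemma Dom_mellin k c p q s m : Dom k c p q -> (forall x, 0 < x -> Rdb m x) -> forall c' a, 0 <= c' ->
  (forall x, 0 < x -> Cmod (m x) <= c' * exp (a * Rabs (ln x)) * Rpower x s) ->
  Dom (fun x => m x * k x)%C (c' * c) (p + s - a) (q + s + a).
Proof.
  intros HD Hm c' a Hc' H. destruct HD as (Hk & K0 & K1). split; [|split].
  - intros x Hx. apply Rdb_mult; auto.
  - intros x Hx. rewrite Cmod_mult.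
    apply Rle_trans with ((c' * exp (a * Rabs (ln x)) * Rpower x s) * (c * Rpower x p)).
    + apply Rmult_le_compat; try apply Cmod_ge_0; [apply H; lra|now apply K0].
    + right. rewrite <- exp_absln_mul_le1 by exact Hx. rewrite Rpower_plus. ring.
  - intros x Hx. rewrite Cmod_mult.
    apply Rle_trans with ((c' * exp (a * Rabs (ln x)) * Rpower x s) * (c * Rpower x q)).
    + apply Rmult_le_compat; try apply Cmod_ge_0; [apply H; lra|now apply K1].
    + right. rewrite <- exp_absln_mul_ge1 by exact Hx. rewrite Rpower_plus. ring.
Qed.

(** The exponent is [s] instead of the customary [s - 1], in accordance with the integral that
    defines zeta_2. *)
Definition mellin (k : R -> C) (s : C) : C := CInt_0_infty (fun x => RCpower x s * k x)%C.

Lemma mellin_Imp k c p q s : Dom k c p q -> -1 < p + Re s -> q + Re s < -1 ->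
  Imp (fun x => RCpower x s * k x)%C (mellin k s).
Proof.
  intros HD Hp Hq.
  assert (D : Dom (fun x => RCpower x s * k x)%C (1 * c) (p + Re s - 0) (q + Re s + 0)).
  { apply Dom_mellin; [exact HD|intros; now apply Rdb_RCpower|lra|].
    intros x Hx. rewrite Cmod_RCpower, Rmult_0_l, exp_0. lra. }
  destruct (Imp_dom _ _ _ _ D ltac:(lra) ltac:(lra)) as (l & Hl & _).
  unfold mellin. now rewrite (Imp_CInt _ _ Hl).
Qed.

(** The second-order remainder has the integrand [x^s (x^h - 1 - h ln x) k x]. The middle factor is
    at most [|h|^2 (ln x)^2 exp (|h| |ln x|)], which a margin of [2 dl] in the exponents absorbs. *)
Lemma mellin_holo k c p q s : Dom k c p q -> -1 < p + Re s -> q + Re s < -1 -> Cdb (mellin k) s.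
Proof.
  intros HD Hp Hq. set (sg := Re s) in *.
  (* A quarter of the distance to the edge of the strip of convergence: the remainder shifts the
     exponents by [2 dl] and half of the room is left. *)
  set (dl := Rmin (p + sg + 1) (- 1 - (q + sg)) / 4).
  assert (Hd0 := Rmin_pos (p + sg + 1) (- 1 - (q + sg)) ltac:(lra) ltac:(lra)).
  assert (Hd1 := Rmin_l (p + sg + 1) (- 1 - (q + sg))).
  assert (Hd2 := Rmin_r (p + sg + 1) (- 1 - (q + sg))).
  assert (Hd : 0 < dl) by (unfold dl; lra).
  assert (D' : Dom (fun x => (ln x * RCpower x s) * k x)%C (/ dl * c) (p + sg - dl) (q + sg + dl)).
  { apply Dom_mellin; [exact HD| |apply Rlt_le, Rinv_0_lt_compat, Hd|].
    - intros x Hx. apply Rdb_mult; [now apply Rdb_ln|now apply Rdb_RCpower].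
    - intros x Hx. rewrite Cmod_mult, Cmod_RCpower, Cmod_R.
      apply Rmult_le_compat_r; [apply Rlt_le, Rpower_pos|].
      apply Rmult_le_reg_l with dl; [exact Hd|]. rewrite <- Rmult_assoc, Rinv_r, Rmult_1_l by lra.
      generalize (exp_ge_1plus (dl * Rabs (ln x))); lra. }
  destruct (Imp_dom _ _ _ _ D' ltac:(unfold dl; lra) ltac:(unfold dl; lra)) as (l & Hl & _).
  exists l.
  set (K := (4 * / dl ^ 2 * c) * (/ (p + sg - 2 * dl + 1) + / (- 1 - (q + sg + 2 * dl)))).
  apply (Der_quadratic _ _ _ _ _ K dl Hd). intros h Hh.
  assert (Dr : Dom (fun x => (RCpower x s * (Cexp (h * ln x) - 1 - h * ln x)) * k x)%C
     ((Cmod h ^ 2 * (4 * / dl ^ 2)) * c) (p + sg - 2 * dl) (q + sg + 2 * dl)).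
  { assert (Hdd : 0 < / dl ^ 2) by (apply Rinv_0_lt_compat, pow_lt, Hd).
    apply Dom_mellin; [exact HD| | |].
    - intros x Hx. apply Rdb_mult; [now apply Rdb_RCpower|].
      assert (B : Rdb (fun x => h * ln x)%C x) by (apply Rdb_mult; [apply Rdb_const|now apply Rdb_ln]).
      apply Rdb_minus; [|exact B]. apply Rdb_minus; [|apply Rdb_const].
      apply (Rdb_comp Cexp); [apply Cdb_Cexp|exact B].
    - apply Rmult_le_pos; [apply pow2_ge_0|lra].
    - intros x Hx. rewrite Cmod_mult, Cmod_RCpower, Rmult_comm.
      apply Rmult_le_compat_r; [apply Rlt_le, Rpower_pos|].
      eapply Rle_trans; [apply Cexp_sub2_le|]. rewrite Cmod_mult, Cmod_R.
      set (L := Rabs (ln x)). assert (HL : 0 <= L) by apply Rabs_pos.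
      pose proof (Cmod_ge_0 h).
      replace ((Cmod h * L) ^ 2 * exp (Cmod h * L)) with (Cmod h ^ 2 * (L ^ 2 * exp (Cmod h * L))) by ring.
      rewrite !Rmult_assoc. apply Rmult_le_compat_l; [apply pow2_ge_0|].
      assert (A : L ^ 2 <= 4 * / dl ^ 2 * exp (dl * L)).
      { assert (B := exp_ge_sqr (dl * L) ltac:(apply Rmult_le_pos; lra)).
        apply Rmult_le_reg_l with (dl ^ 2); [now apply pow_lt|].
        replace (dl ^ 2 * (4 * / dl ^ 2 * exp (dl * L))) with (4 * exp (dl * L)) by (field; lra).
        replace (dl ^ 2 * L ^ 2) with ((dl * L) ^ 2) by ring. exact B. }
      assert (E : exp (Cmod h * L) <= exp (dl * L)) by (apply exp_le, Rmult_le_compat_r; lra).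
      apply Rle_trans with ((4 * / dl ^ 2 * exp (dl * L)) * exp (dl * L)).
      + apply Rmult_le_compat; [apply pow2_ge_0|apply Rlt_le, exp_pos|exact A|exact E].
      + right. rewrite !Rmult_assoc, <- exp_plus. do 3 f_equal; ring. }
  destruct (Imp_dom _ _ _ _ Dr ltac:(unfold dl; lra) ltac:(unfold dl; lra)) as (r & Hr & Br).
  assert (Rh : Rabs (Re h) < dl) by (eapply Rle_lt_trans; [apply Rabs_Re_le|exact Hh]).
  apply Rabs_def2 in Rh.
  assert (Esh : Re (s + h) = sg + Re h) by (unfold sg, Re; simpl; ring).
  assert (I1 := mellin_Imp k c p q (s + h) HD ltac:(rewrite Esh; unfold dl in *; lra) ltac:(rewrite Esh; unfold dl in *; lra)).
  assert (I2 := mellin_Imp k c p q s HD Hp Hq).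
  assert (I3 := Imp_minus _ _ _ _ (Imp_minus _ _ _ _ I1 I2) (Imp_scal h _ _ Hl)).
  assert (Er : r = (mellin k (s + h) - mellin k s - h * l)%C).
  { apply (Imp_unique _ _ _ Hr). refine (Imp_ext _ _ _ _ I3). intros x Hx. cbv beta.
    rewrite RCpower_add. unfold RCpower at 2. ring. }
  replace (l * h)%C with (h * l)%C by ring. rewrite <- Er.
  eapply Rle_trans; [exact Br|]. right. unfold K. ring.
Qed.

Lemma Rdb_exp_neg (x : R) : Rdb (fun x => RtoC (exp (- x))) x.
Proof. apply Rdb_real. auto_derive; trivial. Qed.

(** The inequality [x / n <= exp (x / n)] raised to the power [n]. *)
Lemma exp_decay n x : 0 < x -> exp (- x) * x ^ n <= INR (n ^ n).
Proof.
  intros Hx. destruct n as [|n].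
  - simpl. rewrite Rmult_1_r. rewrite <- exp_0. apply exp_le. lra.
  - set (N := INR (S n)). assert (HN : 0 < N) by (apply lt_0_INR; lia).
    rewrite pow_INR. fold N.
    replace (exp (- x)) with (exp (- (x / N)) ^ S n).
    2:{         assert (G : forall m, exp (- (x / N)) ^ m = exp (INR m * (- (x / N)))).
        { induction m as [|m IH]; [simpl; now rewrite Rmult_0_l, exp_0|].
          simpl pow. rewrite IH, <- exp_plus, S_INR. f_equal; ring. }
        rewrite G. fold N. f_equal. field. lra. }
    rewrite <- Rpow_mult_distr. apply pow_incr. split.
    + apply Rmult_le_pos; [apply Rlt_le, exp_pos|lra].
    + assert (A := exp_ge_1plus (x / N)). rewrite exp_Ropp.
      assert (P := exp_pos (x / N)). apply Rmult_le_reg_l with (exp (x / N)); [exact P|].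
      rewrite <- Rmult_assoc, Rinv_r, Rmult_1_l by lra.
      apply Rle_trans with (x / N * N); [right; field; lra|]. apply Rmult_le_compat_r; lra.
Qed.

Lemma Dom_exp n : exists c, Dom (fun x => RtoC (exp (- x))) c 0 (- INR n).
Proof.
  exists (Rmax 1 (INR (n ^ n))). split; [intros; apply Rdb_exp_neg|].
  split; intros x Hx; rewrite Cmod_R, Rabs_pos_eq by apply Rlt_le, exp_pos.
  - rewrite Rpower_O, Rmult_1_r by lra. apply Rle_trans with 1; [|apply Rmax_l].
    rewrite <- exp_0. apply exp_le. lra.
  - rewrite Rpower_Ropp, Rpower_pow by lra.
    apply Rle_trans with (INR (n ^ n) * / x ^ n).
    + assert (P : 0 < x ^ n) by (apply pow_lt; lra).
      apply Rmult_le_reg_r with (x ^ n); [exact P|].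
      rewrite Rmult_assoc, Rinv_l, Rmult_1_r by lra. apply exp_decay; lra.
    + apply Rmult_le_compat_r; [apply Rlt_le, Rinv_0_lt_compat, pow_lt; lra|apply Rmax_r].
Qed.

(* The shifted Gamma function [Gamma (s + 1)]. *)
Definition Gm (s : C) : C := mellin (fun x => RtoC (exp (- x))) s.

Lemma Gm_CGamma s : CGamma s = Gm (s - 1).
Proof. reflexivity. Qed.

Lemma Gm_CGamma1 s : CGamma (s + 1) = Gm s.
Proof. rewrite Gm_CGamma. f_equal. ring. Qed.

Lemma Gm_Imp s : -1 < Re s -> Imp (fun x => RCpower x s * exp (- x))%C (Gm s).
Proof.
  intros Hs. destruct (nfloor_ex (Rmax 0 (Re s + 1))) as [n [_ Hn]]; [apply Rmax_l|].
  pose proof (Rmax_r 0 (Re s + 1)).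
  destruct (Dom_exp (S n)) as [c HD]. apply (mellin_Imp _ c 0 (- INR (S n))); [exact HD|lra|].
  rewrite S_INR. lra.
Qed.

Lemma Gm_holo s : -1 < Re s -> Cdb Gm s.
Proof.
  intros Hs. destruct (nfloor_ex (Rmax 0 (Re s + 1))) as [n [_ Hn]]; [apply Rmax_l|].
  pose proof (Rmax_r 0 (Re s + 1)).
  destruct (Dom_exp (S n)) as [c HD]. apply (mellin_holo _ c 0 (- INR (S n))); [exact HD|lra|].
  rewrite S_INR. lra.
Qed.

(** * The Gamma function *)

(** Integration by parts on the half-line: [F] is dominated by powers that vanish at both ends, so
    no boundary terms remain. *)
Lemma Imp_FTC_zero F f c p q : Dom F c p q -> 0 < p -> q < 0 ->
  (forall x, 0 < x -> Rder F x (f x)) -> (forall x, 0 < x -> Rdb f x) -> Imp f 0.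
Proof.
  intros HD Hp Hq HF Hf. pose proof (Dom_const_ge0 _ _ _ _ HD) as Hc. destruct HD as (_ & H0 & H1).
  replace (RtoC 0) with (0 - 0)%C by ring. apply (Imp_FTC F); [exact HF|exact Hf| |].
  - intros eps He. destruct (Rpower_tends_0 p Hp (eps / (c + 1))) as (d & Hd & K); [apply Rdiv_lt_0_compat; lra|].
    exists d. split; [lra|]. intros x Hx. replace (F x - 0)%C with (F x) by ring.
    eapply Rle_trans; [apply H0; lra|]. specialize (K x ltac:(lra)). pose proof (Rpower_pos x p).
    apply Rle_trans with ((c + 1) * (eps / (c + 1))); [|right; field; lra].
    apply Rmult_le_compat; lra.
  - intros eps He. destruct (Rpower_neg_tends_0 q Hq (eps / (c + 1))) as (M & HM & K); [apply Rdiv_lt_0_compat; lra|].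
    exists M. intros x Hx. replace (F x - 0)%C with (F x) by ring.
    eapply Rle_trans; [apply H1; lra|]. specialize (K x ltac:(lra)). pose proof (Rpower_pos x q).
    apply Rle_trans with ((c + 1) * (eps / (c + 1))); [|right; field; lra].
    apply Rmult_le_compat; lra.
Qed.

Lemma Rder_exp_neg (x : R) : Rder (fun x => RtoC (exp (- x))) x (- exp (- x))%C.
Proof. rewrite <- RtoC_opp. apply Rder_RtoC. auto_derive; [trivial|ring]. Qed.

Lemma Dom_gamma s : exists c q, q < 0 /\ Dom (fun x => RCpower x s * exp (- x))%C c (Re s) q.
Proof.
  destruct (nfloor_ex (Rmax 0 (Re s + 1))) as [n [_ Hn]]; [apply Rmax_l|].
  pose proof (Rmax_r 0 (Re s + 1)).
  destruct (Dom_exp (S n)) as [c HD].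
  assert (D : Dom (fun x => RCpower x s * exp (- x))%C (1 * c) (0 + Re s - 0) (- INR (S n) + Re s + 0)).
  { apply Dom_mellin; [exact HD|intros; now apply Rdb_RCpower|lra|].
    intros x Hx. rewrite Cmod_RCpower, Rmult_0_l, exp_0. lra. }
  exists (1 * c), (- INR (S n) + Re s + 0). split; [rewrite S_INR; lra|].
  replace (0 + Re s - 0) with (Re s) in D by ring. exact D.
Qed.

Lemma Re_sub1 (s : C) : Re (s - 1) = Re s - 1.
Proof. unfold Re; simpl; ring. Qed.

Lemma Re_add1 (s : C) : Re (s + 1) = Re s + 1.
Proof. unfold Re; simpl; ring. Qed.

Lemma Gm_rec s : 0 < Re s -> Gm s = (s * Gm (s - 1))%C.
Proof.
  intros Hs.
  assert (I1 := Gm_Imp s ltac:(lra)).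
  assert (I2 := Gm_Imp (s - 1) ltac:(rewrite Re_sub1; lra)).
  assert (I3 := Imp_minus _ _ _ _ (Imp_scal s _ _ I2) I1). cbv beta in I3.
  destruct (Dom_gamma s) as (c & q & Hq & HD).
  assert (I4 : Imp (fun x => s * (RCpower x (s - 1) * exp (- x)) - RCpower x s * exp (- x))%C 0).
  { apply (Imp_FTC_zero (fun x => RCpower x s * exp (- x))%C _ c (Re s) q HD Hs Hq).
    - intros x Hx.
      replace (s * (RCpower x (s - 1) * exp (- x)) - RCpower x s * exp (- x))%C with
       (s * RCpower x (s - 1) * exp (- x) + RCpower x s * - exp (- x))%C by ring.
      apply (Der_mult _ _ (fun x => RCpower x s) (fun x => RtoC (exp (- x)))); [now apply Rder_RCpower|apply Rder_exp_neg].
    - apply I3. }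
  assert (E := Imp_unique _ _ _ I3 I4).
  apply Ceq_minus in E. now symmetry.
Qed.

Lemma CI_Re_ge f a b m : a <= b -> Rdb_on f a b -> (forall t, a <= t <= b -> m <= Re (f t)) ->
  (b - a) * m <= Re (CI f a b).
Proof.
  intros Hab Hf H.
  pose proof (is_RInt_fct_extend_fst (U := R_NormedModule) (V := R_NormedModule) _ _ _ _ (CI_correct f a b Hab Hf)) as K.
  apply (is_RInt_le (fun _ => m) (fun t => fst (f t)) a b); [exact Hab| |exact K|].
  - apply (is_RInt_const (V := R_NormedModule)).
  - intros x Hx. apply H. lra.
Qed.

(** The interval [[1, 2]], of length 1, contributes at least [m], and the rest contributes nothing
    negative. With [m = 0] this is positivity of the integral. *)
Lemma Imp_Re_ge f l m : Imp f l -> 0 <= m -> (forall x, 0 < x -> 0 <= Re (f x)) ->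
  (forall x, 1 <= x <= 2 -> m <= Re (f x)) -> m <= Re l.
Proof.
  intros [Hf H] Hm H0 H1. apply Rnot_lt_le. intros L.
  destruct (H ((m - Re l) / 2)) as (d & M & Hd & K); [lra|].
  set (a := Rmin d 1 / 2). set (b := Rmax M 2 + 1).
  pose proof (Rmin_l d 1). pose proof (Rmin_r d 1). pose proof (Rmin_pos d 1 Hd Rlt_0_1).
  pose proof (Rmax_l M 2). pose proof (Rmax_r M 2).
  specialize (K a b ltac:(unfold a; lra) ltac:(unfold b; lra) ltac:(unfold a, b; lra)).
  assert (Pa : 0 < a) by (unfold a; lra). assert (Pa1 : a <= 1) by (unfold a; lra).
  assert (Pb : 2 <= b) by (unfold b; lra).
  assert (X : m <= Re (CI f a b)).
  { rewrite (CI_chasles f a 1 b) by (try lra; apply Rdb_on_pos; auto; lra).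
    rewrite (CI_chasles f 1 2 b) by (try lra; apply Rdb_on_pos; auto; lra).
    replace (Re (CI f a 1 + (CI f 1 2 + CI f 2 b))) with (Re (CI f a 1) + (Re (CI f 1 2) + Re (CI f 2 b)))
      by (unfold Re; simpl; ring).
    assert (A1 := CI_Re_ge f a 1 0 Pa1 (Rdb_on_pos f a 1 Hf Pa) ltac:(intros; apply H0; lra)).
    assert (A2 := CI_Re_ge f 1 2 m ltac:(lra) (Rdb_on_pos f 1 2 Hf ltac:(lra)) H1).
    assert (A3 := CI_Re_ge f 2 b 0 Pb (Rdb_on_pos f 2 b Hf ltac:(lra)) ltac:(intros; apply H0; lra)).
    lra. }
  generalize (Rabs_Re_le (CI f a b - l)). replace (Re (CI f a b - l)) with (Re (CI f a b) - Re l) by (unfold Re; simpl; ring).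
  rewrite Rabs_pos_eq by lra. lra.
Qed.

(** * Elementary inequalities and non-vanishing of Gamma *)

Lemma nonneg_by_derivative (g g' : R -> R) : 0 <= g 0 -> (forall x, 0 <= x -> is_derive g x (g' x)) ->
  (forall x, 0 <= x -> 0 <= g' x) -> forall x, 0 <= x -> 0 <= g x.
Proof.
  intros G0 Hd Hp x Hx.
  destruct (MVT_gen g 0 x g') as (y & Hy & E).
  - intros z Hz. rewrite Rmin_left, Rmax_right in Hz by lra. apply Hd; lra.
  - intros z Hz. rewrite Rmin_left, Rmax_right in Hz by lra.
    apply continuity_pt_filterlim, (ex_derive_continuous g). eexists; apply Hd; lra.
  - rewrite Rmin_left, Rmax_right in Hy by lra. specialize (Hp y ltac:(lra)). nra.
Qed.

Lemma sinh_ge v : 0 <= v -> 2 * v <= exp v - exp (- v).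
Proof.
  intros Hv.
  assert (H := nonneg_by_derivative (fun v => exp v - exp (- v) - 2 * v) (fun v => exp v + exp (- v) - 2)).
  cbv beta in H. specialize (H ltac:(rewrite Ropp_0, exp_0; lra)).
  assert (0 <= exp v - exp (- v) - 2 * v); [|lra]. apply H; [| |exact Hv].
  - intros x _. auto_derive; [trivial|ring].
  - intros x Hx. rewrite exp_Ropp. pose proof (exp_pos x) as P.
    assert (E : exp x + / exp x - 2 = (exp x - 1) ^ 2 * / exp x) by (field; lra).
    rewrite E. apply Rmult_le_pos; [apply pow2_ge_0|apply Rlt_le, Rinv_0_lt_compat, P].
Qed.

(** With [y = exp (2 v)] this is [(2 v)^2 <= (exp v - exp (- v))^2]. In this form the square of the
    logarithm can be integrated against the Gamma density, because [y] and [/ y] merely shift the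
    exponent. *)
Lemma ln_sqr_le y : 0 < y -> ln y ^ 2 <= y - 2 + / y.
Proof.
  intros Hy. set (v := ln y / 2).
  assert (Ey : y = exp v * exp v) by (rewrite <- exp_plus; unfold v; rewrite <- (exp_ln y Hy) at 1; f_equal; field).
  assert (Ei : / y = exp (- v) * exp (- v)) by (rewrite Ey, exp_Ropp, <- Rinv_mult; reflexivity).
  assert (E1 : exp v * exp (- v) = 1) by (rewrite <- exp_plus, Rplus_opp_r, exp_0; reflexivity).
  replace (ln y) with (2 * v) by (unfold v; field).
  rewrite Ei, Ey.
  replace (exp v * exp v - 2 + exp (- v) * exp (- v)) with ((exp v - exp (- v)) ^ 2) by (simpl; nra).
  destruct (Rle_or_lt 0 v) as [H|H].
  - apply pow_incr. split; [lra|now apply sinh_ge].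
  - replace ((2 * v) ^ 2) with ((2 * - v) ^ 2) by ring.
    replace ((exp v - exp (- v)) ^ 2) with ((exp (- v) - exp v) ^ 2) by ring.
    apply pow_incr. split; [lra|]. assert (A := sinh_ge (- v) ltac:(lra)). rewrite Ropp_involutive in A. lra.
Qed.

Lemma sin_le_id v : 0 <= v -> sin v <= v.
Proof.
  intros Hv. assert (H := nonneg_by_derivative (fun v => v - sin v) (fun v => 1 - cos v)).
  cbv beta in H. specialize (H ltac:(rewrite sin_0; lra)).
  assert (0 <= v - sin v); [|lra]. apply H; [| |exact Hv].
  - intros x _. auto_derive; [trivial|ring].
  - intros x _. generalize (COS_bound x); lra.
Qed.

Lemma cos_ge_sqr u : 1 - u ^ 2 / 2 <= cos u.
Proof.
  assert (G : forall u, 0 <= u -> 1 - u ^ 2 / 2 <= cos u).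
  { intros x Hx. assert (H := nonneg_by_derivative (fun v => cos v - 1 + v ^ 2 / 2) (fun v => v - sin v)).
    cbv beta in H. specialize (H ltac:(rewrite cos_0; lra)).
    assert (0 <= cos x - 1 + x ^ 2 / 2); [|lra]. apply H; [| |exact Hx].
    - intros y _. auto_derive; [trivial|field].
    - intros y Hy. generalize (sin_le_id y Hy); lra. }
  destruct (Rle_or_lt 0 u) as [H|H]; [now apply G|].
  rewrite <- cos_neg. replace (u ^ 2) with ((- u) ^ 2) by ring. apply G; lra.
Qed.

Lemma Re_RtoC_mult (a : R) (z : C) : Re (a * z) = a * Re z.
Proof. unfold Re; simpl; ring. Qed.

Lemma Re_Gm_real_pos (sg : R) : 0 < sg -> 0 < Re (Gm sg).
Proof.
  intros Hs. assert (I := Gm_Imp sg ltac:(rewrite re_RtoC; lra)).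
  assert (P : 0 < exp (- 2)) by apply exp_pos.
  apply Rlt_le_trans with (exp (- 2)); [exact P|].
  apply (Imp_Re_ge _ _ _ I); [lra| |].
  - intros x Hx. rewrite RCpower_RtoC, <- RtoC_mult, re_RtoC. apply Rmult_le_pos; apply Rlt_le; [apply Rpower_pos|apply exp_pos].
  - intros x Hx. rewrite RCpower_RtoC, <- RtoC_mult, re_RtoC.
    apply Rle_trans with (1 * exp (- x)); [rewrite Rmult_1_l; apply exp_le; lra|].
    apply Rmult_le_compat_r; [apply Rlt_le, exp_pos|].
    rewrite <- (Rpower_O x) by lra. apply Rpower_mono_exp; lra.
Qed.

(* With [c = Re s + 1], the mean of the Gamma density [x^(Re s) e^(-x)], the oscillating factor
   [(x / c)^(i Im s)] has real part at least [1 - (Im s)^2/2 * (x/c - 2 + c/x)], which has positive mean. *)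
Lemma Gm_neq_0_large s : 0 < Re s -> Im s ^ 2 / 2 < Re s -> Gm s <> 0.
Proof.
  intros Hs Ht E. set (sg := Re s) in *. set (t := Im s) in *. set (c := sg + 1).
  assert (Hc : 0 < c) by (unfold c; lra).
  assert (I1 := Imp_scal (RCpower c (- (Ci * t))) _ _ (Gm_Imp s ltac:(fold sg; lra))).
  assert (Resg : forall a b : R, Re (a + b) = a + b) by (intros; unfold Re; simpl; ring).
  assert (J0 := Gm_Imp sg ltac:(rewrite re_RtoC; lra)).
  assert (J1 := Gm_Imp (sg + 1) ltac:(rewrite Resg; lra)).
  assert (J2 := Gm_Imp (sg - 1) ltac:(rewrite Re_sub1, re_RtoC; lra)).
  assert (E1 : Gm (sg + 1) = (c * Gm sg)%C).
  { rewrite Gm_rec by (rewrite Resg; lra). unfold c. rewrite RtoC_plus. f_equal. f_equal. ring. }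
  assert (E2 : Gm (sg - 1) = (/ sg * Gm sg)%C).
  { rewrite (Gm_rec sg) by (rewrite re_RtoC; lra). field. apply RtoC_neq_0; lra. }
  (* The integral of the oscillating factor minus its lower bound, expanded as
     [1 + t^2 - t^2/2 (y + 1/y)] with [y = x / c]; the terms in [x] and [1 / x] are the Gamma
     integrals with exponent shifted by one. *)
  assert (J := Imp_minus _ _ _ _ I1
     (Imp_minus _ _ _ _ (Imp_scal (1 + t * t) _ _ J0)
       (Imp_scal (t * t / 2) _ _ (Imp_plus _ _ _ _ (Imp_scal (/ c) _ _ J1) (Imp_scal c _ _ J2))))).
  cbv beta in J. rewrite E, E1, E2 in J.
  assert (Nc : RtoC c <> 0) by (apply RtoC_neq_0; lra).
  assert (Nsg : RtoC sg <> 0) by (apply RtoC_neq_0; lra).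
  match type of J with Imp ?f ?l => assert (JJ := Imp_Re_ge f l 0 J (Rle_refl 0)) end.
  (* With [Gm s = 0] this is the value of the integral: the means of [x / c] and [c / x] are 1 and
     [1 + 1 / sg]. *)
  assert (X : 0 <= - ((1 - t ^ 2 / (2 * sg)) * Re (Gm sg))).
  { replace (- ((1 - t ^ 2 / (2 * sg)) * Re (Gm sg))) with
     (Re (RCpower c (- (Ci * t)) * 0 - ((1 + t * t) * Gm sg - t * t / 2 * (/ c * (c * Gm sg) + c * (/ sg * Gm sg))))%C).
    2:{ replace (RCpower c (- (Ci * t)) * 0 - ((1 + t * t) * Gm sg - t * t / 2 * (/ c * (c * Gm sg) + c * (/ sg * Gm sg))))%C
        with (RtoC (- (1 - t ^ 2 / (2 * sg))) * Gm sg)%C; [rewrite Re_RtoC_mult; ring|].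
        unfold c in *. simpl pow. rewrite Rmult_1_r.
        rewrite RtoC_opp, RtoC_minus, RtoC_div by lra. rewrite !RtoC_mult, RtoC_plus. rewrite RtoC_plus in Nc. field. auto. }
    assert (JJJ : forall x, 0 < x ->
     0 <= Re (RCpower c (- (Ci * t)) * (RCpower x s * exp (- x)) -
       ((1 + t * t) * (RCpower x sg * exp (- x)) - t * t / 2 * (/ c * (RCpower x (sg + 1) * exp (- x)) +
         c * (RCpower x (sg - 1) * exp (- x)))))%C).
    { intros x Hx. assert (Nx : RtoC x <> 0) by (apply RtoC_neq_0; lra).
      set (y := x / c). assert (Hy : 0 < y) by (unfold y; now apply Rdiv_lt_0_compat).
      replace (RCpower c (- (Ci * t)) * (RCpower x s * exp (- x)) -
       ((1 + t * t) * (RCpower x sg * exp (- x)) - t * t / 2 * (/ c * (RCpower x (sg + 1) * exp (- x)) +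
         c * (RCpower x (sg - 1) * exp (- x)))))%C with
       ((Rpower x sg * exp (- x))%R * (Cexp (Ci * (t * ln y)%R) - RtoC (1 - t ^ 2 / 2 * (y - 2 + / y))))%C.
      2:{ rewrite RCpower_add, RCpower_sub1, RCpower_1, RCpower_RtoC by exact Hx.
          assert (A : (RCpower c (- (Ci * t)) * RCpower x s = Rpower x sg * Cexp (Ci * (t * ln y)%R))%C).
          { rewrite <- RCpower_RtoC. unfold RCpower. rewrite <- !Cexp_add. f_equal.
            unfold y. rewrite ln_div by lra. rewrite RtoC_mult, RtoC_minus.
            assert (Es : s = (sg + Ci * t)%C).
            { unfold sg, t. destruct s as [u v]. unfold Re, Im, Ci, RtoC, Cplus, Cmult; simpl. f_equal; ring. }
            rewrite Es at 1. ring. }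
          replace (RCpower c (- (Ci * t)) * (RCpower x s * exp (- x)))%C with
            (RCpower c (- (Ci * t)) * RCpower x s * exp (- x))%C by ring.
          rewrite A. unfold y. simpl pow. rewrite Rmult_1_r.
          rewrite !RtoC_mult, !RtoC_minus, !RtoC_mult, RtoC_plus, RtoC_minus, RtoC_inv by (apply Rgt_not_eq; now apply Rdiv_lt_0_compat).
          rewrite !RtoC_div, RtoC_mult by lra. field. auto. }
      rewrite Re_RtoC_mult. apply Rmult_le_pos; [apply Rmult_le_pos; apply Rlt_le; [apply Rpower_pos|apply exp_pos]|].
      replace (Re (Cexp (Ci * (t * ln y)%R) - RtoC (1 - t ^ 2 / 2 * (y - 2 + / y))))%C
        with (cos (t * ln y) - (1 - t ^ 2 / 2 * (y - 2 + / y))).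
      2:{ unfold Cexp, Ci, Re, Im; simpl.
          replace (0 * (t * ln y) - 1 * 0) with 0 by ring. replace (0 * 0 + 1 * (t * ln y)) with (t * ln y) by ring.
          rewrite exp_0. ring. }
      assert (B1 := cos_ge_sqr (t * ln y)). assert (B2 := ln_sqr_le y Hy).
      assert (B3 : t ^ 2 / 2 * ln y ^ 2 <= t ^ 2 / 2 * (y - 2 + / y)).
      { apply Rmult_le_compat_l; [|exact B2]. generalize (pow2_ge_0 t); lra. }
      replace ((t * ln y) ^ 2 / 2) with (t ^ 2 / 2 * ln y ^ 2) in B1 by field. lra. }
    apply JJ; [exact JJJ|]. intros x Hx. apply JJJ. lra. }
  assert (G := Re_Gm_real_pos sg Hs).
  assert (Q : 0 < 1 - t ^ 2 / (2 * sg)).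
  { apply Rmult_lt_reg_r with (2 * sg); [lra|].
    replace ((1 - t ^ 2 / (2 * sg)) * (2 * sg)) with (2 * sg - t ^ 2) by (field; lra). lra. }
  assert (0 < (1 - t ^ 2 / (2 * sg)) * Re (Gm sg)) by now apply Rmult_lt_0_compat.
  lra.
Qed.

(** The recursion carries a zero at [s] to zeros at every [s + n], and for large [n] the real part
    exceeds [(Im s)^2 / 2]. *)
Lemma Gm_neq_0 s : -1 < Re s -> Gm s <> 0.
Proof.
  intros Hs.
  assert (St : forall n s, -1 < Re s -> Gm (s + INR n) <> 0 -> Gm s <> 0).
  { induction n as [|n IH]; intros z Hz H.
    - simpl in H. replace (z + 0)%C with z in H by ring. exact H.
    - assert (H1 : Gm (z + 1) <> 0).
      { apply IH; [rewrite Re_add1; lra|].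
        replace (z + 1 + INR n)%C with (z + INR (S n))%C by (rewrite S_INR, RtoC_plus; ring). exact H. }
      intros E. apply H1. rewrite Gm_rec by (rewrite Re_add1; lra).
      replace (z + 1 - 1)%C with z by ring. rewrite E. ring. }
  destruct (nfloor_ex (Im s ^ 2 / 2 + 1)) as [n [_ Hn]]; [generalize (pow2_ge_0 (Im s)); lra|].
  apply (St (S n)); [exact Hs|].
  assert (E1 : Re (s + INR (S n)) = Re s + INR (S n)) by reflexivity.
  assert (E2 : Im (s + INR (S n)) = Im s) by apply Rplus_0_r.
  generalize (pow2_ge_0 (Im s)); intros.
  apply Gm_neq_0_large; rewrite E1, ?E2, S_INR; lra.
Qed.

(** * A Stieltjes integral *)

Lemma Rpower_1_base p : Rpower 1 p = 1.
Proof. unfold Rpower. now rewrite ln_1, Rmult_0_r, exp_0. Qed.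

(** The exponent [a] is left free because one limit below gives up part of the decay in exchange for
    smallness in a parameter; elsewhere [a = 0]. *)
Lemma Dom_over_1plus (m : R -> C) c s sg a :
  sg = Re s -> 0 <= c -> 0 <= a <= 1 -> (forall x, 0 < x -> Rdb m x) ->
  (forall x, 0 < x -> Cmod (m x) <= c * Rpower (1 + x) (a - 1)) ->
  Dom (fun x => RCpower x s * m x)%C c sg (sg + a - 1).
Proof.
  intros Es Hc Ha Hm H. split; [|split].
  - intros x Hx. apply Rdb_mult; [now apply Rdb_RCpower|auto].
  - intros x Hx. rewrite Cmod_mult, Cmod_RCpower, <- Es, Rmult_comm.
    apply Rmult_le_compat_r; [apply Rlt_le, Rpower_pos|].
    eapply Rle_trans; [apply H; lra|]. rewrite <- (Rmult_1_r c) at 2. apply Rmult_le_compat_l; [exact Hc|].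
    apply Rle_trans with (Rpower (1 + x) 0); [apply Rpower_mono_exp; lra|rewrite Rpower_O; lra].
  - intros x Hx. rewrite Cmod_mult, Cmod_RCpower, <- Es, Rmult_comm.
    replace (sg + a - 1) with ((a - 1) + sg) by ring. rewrite Rpower_plus, <- Rmult_assoc.
    apply Rmult_le_compat_r; [apply Rlt_le, Rpower_pos|].
    eapply Rle_trans; [apply H; lra|]. apply Rmult_le_compat_l; [exact Hc|].
    replace (a - 1) with (- (1 - a)) by ring. rewrite !Rpower_Ropp.
    apply Rinv_le_contravar; [apply Rpower_pos|]. apply Rle_Rpower_l; lra.
Qed.

Lemma Rpower_m1 x : 0 < x -> Rpower x (0 - 1) = / x.
Proof. intros H. replace (0 - 1) with (- (1)) by ring. now rewrite Rpower_Ropp, Rpower_1. Qed.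

Lemma Rdb_exp_lin (t x : R) : Rdb (fun x => RtoC (exp (- (t * (1 + x))))) x.
Proof. apply Rdb_real. auto_derive; trivial. Qed.

Lemma Rdb_inv_1plus x : 0 < x -> Rdb (fun x => / RtoC (1 + x))%C x.
Proof.
  intros H. apply Rdb_inv; [apply RtoC_neq_0; lra|]. apply Rdb_real. auto_derive; trivial.
Qed.

(** One differentiation in [t] removes the denominator [1 + x] and leaves an explicit Gamma
    integral. Integrating that derivative over [t > 0] evaluates the undamped integral at [t = 0]
    without interchanging two integrations. *)
Definition beta_damped (s : C) (t : R) : C :=
  CInt_0_infty (fun x => RCpower x s * (exp (- (t * (1 + x))) * / RtoC (1 + x)))%C.

Lemma beta_damped_Imp s t c : -1 < Re s < 0 -> 0 <= t -> c = exp (- t) ->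
  Imp (fun x => RCpower x s * (exp (- (t * (1 + x))) * / RtoC (1 + x)))%C (beta_damped s t) /\
  Cmod (beta_damped s t) <= c * (/ (Re s + 1) + / (- Re s)).
Proof.
  intros Hs Ht Ec.
  assert (Pc : 0 < c) by (rewrite Ec; apply exp_pos).
  assert (D := Dom_over_1plus (fun x => exp (- (t * (1 + x))) * / RtoC (1 + x))%C c s (Re s) 0 eq_refl
     ltac:(lra) ltac:(lra)).
  destruct (Imp_dom _ _ _ _ (D ltac:(intros; apply Rdb_mult; [apply Rdb_exp_lin|now apply Rdb_inv_1plus])
    ltac:(intros x Hx; rewrite Rpower_m1, <- RtoC_inv, Cmod_mult, !Cmod_R, !Rabs_pos_eq by
      (try lra; apply Rlt_le; first [apply exp_pos|apply Rinv_0_lt_compat; lra]);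
      apply Rmult_le_compat_r; [apply Rlt_le, Rinv_0_lt_compat; lra|rewrite Ec; apply exp_le; nra]))) as (l & Hl & B); [lra|lra|].
  unfold beta_damped. rewrite (Imp_CInt _ _ Hl). split; [exact Hl|].
  replace (- 1 - (Re s + 0 - 1)) with (- Re s) in B by ring. exact B.
Qed.

Lemma Gm_scaled s t : -1 < Re s -> 0 < t ->
  Imp (fun x => RCpower x s * exp (- (t * x)))%C (RCpower t (- s - 1) * Gm s)%C.
Proof.
  intros Hs Ht. assert (Nt : RtoC t <> 0) by (apply RtoC_neq_0; lra).
  refine (Imp_ext _ _ _ _ (Imp_scal (RCpower t (- s - 1)) _ _ (Imp_scale _ _ t Ht (Gm_Imp s Hs)))).
  intros x Hx. cbv beta. rewrite RCpower_mult_arg, RCpower_sub1 by assumption.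
  assert (E : (RCpower t (- s) * RCpower t s)%C = 1).
  { rewrite <- RCpower_add. replace (- s + s)%C with (RtoC 0) by ring. unfold RCpower.
    rewrite Cmult_0_l. apply Cexp_0. }
  replace (RCpower t (- s) / t * (t * (RCpower t s * RCpower x s * exp (- (t * x)))))%C
   with (RCpower t (- s) * RCpower t s * (RCpower x s * exp (- (t * x))))%C by (field; exact Nt).
  rewrite E. ring.
Qed.

(** For [|h| < t / 2] the remainder retains the factor [exp (- t (1 + x) / 2)], and [exp_decay 2]
    bounds its product with [(1 + x)^2] by [16 / t^2]. The constant blows up as [t] tends to 0, so
    the limit there is treated separately. *)
Lemma beta_damped_derive s t : -1 < Re s < 0 -> 0 < t ->
  Rder (beta_damped s) t (- (RCpower t (- s - 1) * exp (- t) * Gm s))%C.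
Proof.
  intros Hs Ht.
  set (K0 := 16 / t ^ 2).
  assert (Pt2 : 0 < t ^ 2) by (apply pow_lt, Ht).
  apply (Der_quadratic _ _ _ _ _ (K0 * (/ (Re s + 1) + / (- Re s))) (t / 2)); [lra|].
  intros h Hh. rewrite Cmod_R in *. apply Rabs_def2 in Hh.
  destruct (beta_damped_Imp s (t + h) _ Hs ltac:(lra) eq_refl) as [I1 _].
  destruct (beta_damped_Imp s t _ Hs ltac:(lra) eq_refl) as [I2 _].
  assert (I3 := Imp_scal (exp (- t)) _ _ (Gm_scaled s t ltac:(lra) Ht)).
  assert (J := Imp_plus _ _ _ _ (Imp_minus _ _ _ _ I1 I2) (Imp_scal h _ _ I3)). cbv beta in J.
  set (m := fun x : R => RtoC (exp (- (t * (1 + x))) * (exp (- (h * (1 + x))) - 1 + h * (1 + x)) * / (1 + x))).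
  assert (D : Dom (fun x => RCpower x s * m x)%C (K0 * h ^ 2) (Re s) (Re s + 0 - 1)).
  { apply Dom_over_1plus; [reflexivity| |lra| |].
    - apply Rmult_le_pos; [apply Rlt_le, Rdiv_lt_0_compat; lra|apply pow2_ge_0].
    - intros x Hx. apply Rdb_real. auto_derive. lra.
    - intros x Hx. rewrite Rpower_m1 by lra. set (y := 1 + x). assert (Hy : 0 < y) by (unfold y; lra).
      unfold m. fold y. rewrite Cmod_R, !Rabs_mult.
      rewrite (Rabs_pos_eq (/ y)) by (apply Rlt_le, Rinv_0_lt_compat, Hy).
      apply Rmult_le_compat_r; [apply Rlt_le, Rinv_0_lt_compat, Hy|].
      rewrite (Rabs_pos_eq (exp _)) by apply Rlt_le, exp_pos.
      assert (Q := Cexp_sub2_le (RtoC (- (h * y)))).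
      rewrite Cexp_RtoC, <- !RtoC_minus, !Cmod_R in Q.
      replace (exp (- (h * y)) - 1 - - (h * y)) with (exp (- (h * y)) - 1 + h * y) in Q by ring.
      rewrite Rabs_Ropp, Rabs_mult, (Rabs_pos_eq y) in Q by lra.
      assert (Ey : exp (Rabs h * y) <= exp (t / 2 * y)).
      { apply exp_le, Rmult_le_compat_r; [lra|]. apply Rabs_le. lra. }
      assert (Dy := exp_decay 2 (t / 2 * y) ltac:(apply Rmult_lt_0_compat; lra)).
      replace (INR (2 ^ 2)) with 4 in Dy by (simpl; ring).
      assert (P1 := exp_pos (- (t * y))).
      apply Rle_trans with (exp (- (t * y)) * ((Rabs h * y) ^ 2 * exp (t / 2 * y))).
      + apply Rmult_le_compat_l; [lra|]. eapply Rle_trans; [exact Q|].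
        apply Rmult_le_compat_l; [apply pow2_ge_0|exact Ey].
      + replace (exp (- (t * y)) * ((Rabs h * y) ^ 2 * exp (t / 2 * y))) with
          ((exp (- (t * y)) * exp (t / 2 * y)) * y ^ 2 * Rabs h ^ 2) by ring.
        rewrite pow2_abs. apply Rmult_le_compat_r; [apply pow2_ge_0|].
        rewrite <- exp_plus. replace (- (t * y) + t / 2 * y) with (- (t / 2 * y)) by field.
        unfold K0. apply Rmult_le_reg_r with (t ^ 2); [exact Pt2|].
        replace (16 / t ^ 2 * t ^ 2) with 16 by (field; lra).
        replace (exp (- (t / 2 * y)) * y ^ 2 * t ^ 2) with (4 * (exp (- (t / 2 * y)) * (t / 2 * y) ^ 2)) by field.
        lra. }
  destruct (Imp_dom _ _ _ _ D ltac:(lra) ltac:(lra)) as (r & Hr & B).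
  assert (Er : r = (beta_damped s (t + h) - beta_damped s t - (- (RCpower t (- s - 1) * exp (- t) * Gm s)) * h)%C).
  { replace (beta_damped s (t + h) - beta_damped s t - (- (RCpower t (- s - 1) * exp (- t) * Gm s)) * h)%C
      with (beta_damped s (t + h) - beta_damped s t + h * (exp (- t) * (RCpower t (- s - 1) * Gm s)))%C by ring.
    apply (Imp_unique _ _ _ Hr). refine (Imp_ext _ _ _ _ J). intros x Hx. cbv beta. unfold m.
    replace (- ((t + h) * (1 + x))) with (- (t * (1 + x)) + - (h * (1 + x))) by ring. rewrite exp_plus.
    replace (exp (- t) * (RCpower x s * exp (- (t * x))))%C with (RCpower x s * exp (- (t * (1 + x))))%C.
    2:{ replace (- (t * (1 + x))) with (- t + - (t * x)) by ring. rewrite exp_plus, RtoC_mult. ring. }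
    assert (Hy : 1 + x <> 0) by lra. set (y := 1 + x) in *. clearbody y.
    rewrite !RtoC_mult, RtoC_plus, RtoC_minus, RtoC_inv, RtoC_mult by exact Hy.
    field. now apply RtoC_neq_0. }
  rewrite <- Er. eapply Rle_trans; [exact B|]. rewrite pow2_abs.
  replace (- 1 - (Re s + 0 - 1)) with (- Re s) by ring. right; ring.
Qed.

Lemma beta_damped_liminf s : -1 < Re s < 0 -> liminf (beta_damped s) 0.
Proof.
  intros Hs eps He. set (K := / (Re s + 1) + / (- Re s)).
  assert (HK : 0 < K) by (unfold K; apply Rplus_lt_0_compat; apply Rinv_0_lt_compat; lra).
  exists (K / eps). intros t Ht.
  assert (P : 0 < K / eps) by now apply Rdiv_lt_0_compat.
  destruct (beta_damped_Imp s t _ Hs ltac:(lra) eq_refl) as [_ B]. fold K in B.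
  replace (beta_damped s t - 0)%C with (beta_damped s t) by ring.
  eapply Rle_trans; [exact B|]. rewrite exp_Ropp.
  assert (Q := exp_ge_1plus t). pose proof (exp_pos t).
  apply Rmult_le_reg_l with (exp t); [lra|]. rewrite <- Rmult_assoc, Rinv_r, Rmult_1_l by lra.
  apply Rmult_lt_compat_r with (r := eps) in Ht; [|exact He].
  replace (K / eps * eps) with K in Ht by (field; lra).
  apply Rle_trans with (t * eps); [lra|]. apply Rmult_le_compat_r; lra.
Qed.

Lemma one_sub_exp_le z a : 0 < z -> 0 <= a <= 1 -> 1 - exp (- z) <= Rpower z a.
Proof.
  intros Hz Ha. destruct (Rle_or_lt z 1) as [H|H].
  - apply Rle_trans with z; [generalize (exp_ge_1plus (- z)); lra|].
    rewrite <- (Rpower_1 z) at 1 by exact Hz. apply Rpower_anti_exp; lra.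
  - apply Rle_trans with 1; [generalize (exp_pos (- z)); lra|].
    rewrite <- (Rpower_O z) by exact Hz. apply Rpower_mono_exp; lra.
Qed.

(** The bound [1 - exp (- z) <= z^a] spends a power [a] of [1 + x] to gain the factor [t^a]. With
    [a = - Re s / 2] the exponent at infinity is [Re s / 2 - 1], still below -1. *)
Lemma beta_damped_lim0 s : -1 < Re s < 0 -> lim0 (beta_damped s) (beta_damped s 0).
Proof.
  intros Hs. set (a := - Re s / 2).
  set (K := / (Re s + 1) + / (- 1 - (Re s + a - 1))).
  assert (HK : 0 < K) by (unfold K, a; apply Rplus_lt_0_compat; apply Rinv_0_lt_compat; lra).
  assert (B : forall t, 0 < t -> Cmod (beta_damped s t - beta_damped s 0) <= Rpower t a * K).
  { intros t Ht.
    destruct (beta_damped_Imp s t _ Hs ltac:(lra) eq_refl) as [I1 _].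
    destruct (beta_damped_Imp s 0 _ Hs ltac:(lra) eq_refl) as [I2 _].
    set (m := fun x : R => RtoC ((exp (- (t * (1 + x))) - 1) * / (1 + x))).
    assert (D : Dom (fun x => RCpower x s * m x)%C (Rpower t a) (Re s) (Re s + a - 1)).
    { apply Dom_over_1plus; [reflexivity|apply Rlt_le, Rpower_pos|unfold a; lra| |].
      - intros x Hx. apply Rdb_real. auto_derive. lra.
      - intros x Hx. set (y := 1 + x). assert (Hy : 0 < y) by (unfold y; lra).
        unfold m. fold y. rewrite Cmod_R, Rabs_mult, (Rabs_pos_eq (/ y)) by (apply Rlt_le, Rinv_0_lt_compat, Hy).
        unfold Rminus at 2. rewrite Rpower_plus, Rpower_Ropp, Rpower_1, <- Rmult_assoc by exact Hy.
        apply Rmult_le_compat_r; [apply Rlt_le, Rinv_0_lt_compat, Hy|].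
        rewrite Rpower_mult_distr by assumption.
        assert (P : 0 < t * y) by now apply Rmult_lt_0_compat.
        rewrite Rabs_left1.
        + generalize (one_sub_exp_le (t * y) a P ltac:(unfold a; lra)). lra.
        + assert (exp (- (t * y)) <= exp 0) by (apply exp_le; lra). rewrite exp_0 in H. lra. }
    destruct (Imp_dom _ _ _ _ D ltac:(lra) ltac:(unfold a; lra)) as (r & Hr & Br).
    replace (beta_damped s t - beta_damped s 0)%C with r; [exact Br|].
    apply (Imp_unique _ _ _ Hr). refine (Imp_ext _ _ _ _ (Imp_minus _ _ _ _ I1 I2)).
    intros x Hx. cbv beta. unfold m. rewrite Rmult_0_l, Ropp_0, exp_0, RtoC_mult, RtoC_minus, RtoC_inv by lra. ring. }
  intros eps He. destruct (Rpower_tends_0 a ltac:(unfold a; lra) (eps / K)) as (d & Hd & H); [now apply Rdiv_lt_0_compat|].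
  exists d. split; [lra|]. intros x Hx. eapply Rle_trans; [apply B; lra|].
  specialize (H x ltac:(lra)). apply Rmult_le_compat_r with (r := K) in H; [|lra].
  replace (eps / K * K) with eps in H by (field; lra). exact H.
Qed.

(** [- beta_damped s] is a primitive of [Gm s * t^(-s-1) exp (- t)] with limits [- beta_damped s 0]
    at 0 and 0 at infinity, while Euler's integral gives [Gm s * Gm (- s - 1)] for the same
    function. *)
Lemma beta_Gamma s : -1 < Re s < 0 ->
  Imp (fun x => RCpower x s * / RtoC (1 + x))%C (Gm s * Gm (- s - 1))%C.
Proof.
  intros Hs. destruct (beta_damped_Imp s 0 _ Hs ltac:(lra) eq_refl) as [I0 _].
  assert (Es : Re (- s - 1) = - Re s - 1) by (unfold Re; simpl; ring).
  assert (I1 := Imp_scal (Gm s) _ _ (Gm_Imp (- s - 1) ltac:(rewrite Es; lra))). cbv beta in I1.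
  assert (I2 : Imp (fun x => Gm s * (RCpower x (- s - 1) * exp (- x)))%C (0 - - beta_damped s 0)%C).
  { apply (Imp_FTC (fun t => - beta_damped s t)%C).
    - intros x Hx. assert (H := beta_damped_derive s x Hs Hx).
      replace (Gm s * (RCpower x (- s - 1) * exp (- x)))%C with
        (- (1) * - (RCpower x (- s - 1) * exp (- x) * Gm s))%C by ring.
      refine (Der_ext_loc _ _ _ _ _ _ 1 Rlt_0_1 _ _ (Der_scal _ _ (- (1))%C _ _ _ H)); intros; cbv beta; ring.
    - apply I1.
    - intros eps He. destruct (beta_damped_lim0 s Hs eps He) as (d & Hd & H). exists d. split; [exact Hd|].
      intros x Hx. replace (- beta_damped s x - - beta_damped s 0)%C with (- (beta_damped s x - beta_damped s 0))%C by ring.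
      rewrite Cmod_opp. now apply H.
    - intros eps He. destruct (beta_damped_liminf s Hs eps He) as (M & H). exists M.
      intros x Hx. replace (- beta_damped s x - 0)%C with (- (beta_damped s x - 0))%C by ring.
      rewrite Cmod_opp. now apply H. }
  rewrite (Imp_unique _ _ _ I1 I2). replace (0 - - beta_damped s 0)%C with (beta_damped s 0) by ring.
  refine (Imp_ext _ _ _ _ I0). intros x Hx. cbv beta. rewrite Rmult_0_l, Ropp_0, exp_0. ring.
Qed.

(** A quantitative form of [- a] lying off the half-line [[0, +oo)]. The linear lower bound makes
    [1 / (x + a)] at most a constant times [1 / (1 + x)], and it survives small perturbations of
    [a]. *)
Definition off_neg (a : C) (c : R) : Prop := 0 < c /\ forall x, 0 <= x -> c * (1 + x) <= Cmod (x + a).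

Definition stieltjes (s a : C) : C := CInt_0_infty (fun x => RCpower x s * / (x + a))%C.
Definition stieltjes2 (s a : C) : C := CInt_0_infty (fun x => RCpower x s * / ((x + a) * (x + a)))%C.

Lemma off_neg_neq a c x : off_neg a c -> 0 <= x -> (x + a)%C <> 0.
Proof.
  intros [Hc H] Hx. apply Cmod_gt_0. specialize (H x Hx).
  assert (0 < c * (1 + x)) by (apply Rmult_lt_0_compat; lra). lra.
Qed.

Lemma off_neg_inv a c x : off_neg a c -> 0 <= x -> Cmod (/ (x + a)) <= / c * / (1 + x).
Proof.
  intros Ho Hx. rewrite Cmod_inv by (now apply (off_neg_neq a c)).
  destruct Ho as [Hc H]. rewrite <- Rinv_mult.
  apply Rinv_le_contravar; [apply Rmult_lt_0_compat; lra|now apply H].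
Qed.

Lemma Rdb_shift_inv a c x : off_neg a c -> 0 < x -> Rdb (fun x => / (x + a))%C x.
Proof.
  intros Ho Hx. apply Rdb_inv; [apply (off_neg_neq a c); [exact Ho|lra]|].
  apply Rdb_plus; [apply Rdb_RtoC|apply Rdb_const].
Qed.

Lemma stieltjes_Imp s a c : -1 < Re s < 0 -> off_neg a c ->
  Imp (fun x => RCpower x s * / (x + a))%C (stieltjes s a).
Proof.
  intros Hs Ho. assert (Hc : 0 < / c) by (apply Rinv_0_lt_compat, Ho).
  assert (D : Dom (fun x => RCpower x s * / (x + a))%C (/ c) (Re s) (Re s + 0 - 1)).
  { apply Dom_over_1plus; [reflexivity|lra|lra| |].
    - intros x Hx. now apply (Rdb_shift_inv a c).
    - intros x Hx. rewrite Rpower_m1 by lra. apply off_neg_inv; [exact Ho|lra]. }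
  destruct (Imp_dom _ _ _ _ D ltac:(lra) ltac:(lra)) as (l & Hl & _).
  unfold stieltjes. now rewrite (Imp_CInt _ _ Hl).
Qed.

Lemma Rinv_1plus_le1 x : 0 <= x -> / (1 + x) <= 1.
Proof. intros H. rewrite <- Rinv_1. apply Rinv_le_contravar; lra. Qed.

Lemma stieltjes2_Imp s a c : -1 < Re s < 0 -> off_neg a c ->
  Imp (fun x => RCpower x s * / ((x + a) * (x + a)))%C (stieltjes2 s a).
Proof.
  intros Hs Ho. assert (Hc : 0 < / c) by (apply Rinv_0_lt_compat, Ho).
  assert (D : Dom (fun x => RCpower x s * / ((x + a) * (x + a)))%C (/ c * / c) (Re s) (Re s + 0 - 1)).
  { apply Dom_over_1plus; [reflexivity|apply Rmult_le_pos; lra|lra| |].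
    - intros x Hx. apply Rdb_inv.
      + apply Cmult_neq_0; (apply (off_neg_neq a c); [exact Ho|lra]).
      + apply Rdb_mult; apply Rdb_plus; first [apply Rdb_RtoC|apply Rdb_const].
    - intros x Hx. assert (N : (x + a)%C <> 0) by (apply (off_neg_neq a c); [exact Ho|lra]).
      rewrite Rpower_m1 by lra. assert (B := off_neg_inv a c x Ho ltac:(lra)).
      replace (/ ((x + a) * (x + a)))%C with (/ (x + a) * / (x + a))%C by (field; exact N).
      rewrite Cmod_mult. assert (B1 := Rinv_1plus_le1 x ltac:(lra)).
      assert (P1 : 0 < / (1 + x)) by (apply Rinv_0_lt_compat; lra).
      pose proof (Cmod_ge_0 (/ (x + a))).
      apply Rle_trans with ((/ c * / (1 + x)) * (/ c * 1)).
      + apply Rmult_le_compat; try assumption. eapply Rle_trans; [exact B|]. apply Rmult_le_compat_l; lra.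
      + right; ring. }
  destruct (Imp_dom _ _ _ _ D ltac:(lra) ltac:(lra)) as (l & Hl & _).
  unfold stieltjes2. now rewrite (Imp_CInt _ _ Hl).
Qed.

Lemma off_neg_perturb a c h : off_neg a c -> Cmod h <= c / 2 -> off_neg (a + h) (c / 2).
Proof.
  intros [Hc H] Hh. split; [lra|]. intros x Hx. specialize (H x Hx).
  generalize (Cmod_sub_ge (x + a) (- h)). rewrite Cmod_opp.
  replace (x + a - - h)%C with (x + (a + h))%C by ring. nra.
Qed.

Lemma stieltjes_derive s a c : -1 < Re s < 0 -> off_neg a c ->
  Cder (stieltjes s) a (- stieltjes2 s a)%C.
Proof.
  intros Hs Ho. assert (Hc0 := proj1 Ho). assert (Hc : 0 < / c) by (apply Rinv_0_lt_compat, Ho).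
  assert (Hc2 : 0 < / (c / 2)) by (apply Rinv_0_lt_compat; lra).
  apply (Der_quadratic _ _ _ _ _ (/ c * / c * / (c / 2) * (/ (Re s + 1) + / (- Re s))) (c / 2)); [lra|].
  intros h Hh.
  assert (Oh := off_neg_perturb a c h Ho ltac:(lra)).
  assert (J := Imp_plus _ _ _ _ (Imp_minus _ _ _ _ (stieltjes_Imp s _ _ Hs Oh) (stieltjes_Imp s a c Hs Ho))
     (Imp_scal h _ _ (stieltjes2_Imp s a c Hs Ho))).
  set (m := fun x : R => (h * h * (/ (x + a) * / (x + a) * / (x + (a + h))))%C).
  assert (D : Dom (fun x => RCpower x s * m x)%C (Cmod h ^ 2 * (/ c * / c * / (c / 2))) (Re s) (Re s + 0 - 1)).
  { apply Dom_over_1plus; [reflexivity| |lra| |].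
    - apply Rmult_le_pos; [apply pow2_ge_0|]. repeat apply Rmult_le_pos; lra.
    - intros x Hx. apply Rdb_mult; [apply Rdb_const|].
      apply Rdb_mult; [apply Rdb_mult; now apply (Rdb_shift_inv a c)|now apply (Rdb_shift_inv (a + h) (c / 2))].
    - intros x Hx. rewrite Rpower_m1 by lra. unfold m. rewrite !Cmod_mult.
      assert (B := off_neg_inv a c x Ho ltac:(lra)). assert (B2 := off_neg_inv _ _ x Oh ltac:(lra)).
      assert (B1 := Rinv_1plus_le1 x ltac:(lra)).
      assert (P1 : 0 < / (1 + x)) by (apply Rinv_0_lt_compat; lra).
      pose proof (Cmod_ge_0 (/ (x + a))). pose proof (Cmod_ge_0 (/ (x + (a + h)))).
      replace (Cmod h * Cmod h) with (Cmod h ^ 2) by ring.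
      replace (Cmod h ^ 2 * (/ c * / c * / (c / 2)) * / (1 + x)) with
        (Cmod h ^ 2 * ((/ c * / c) * (/ (c / 2) * / (1 + x)))) by ring.
      apply Rmult_le_compat_l; [apply pow2_ge_0|].
      assert (B3 : Cmod (/ (x + a)) <= / c) by (eapply Rle_trans; [exact B|]; rewrite <- (Rmult_1_r (/ c)) at 2; apply Rmult_le_compat_l; lra).
      apply Rmult_le_compat; [now apply Rmult_le_pos|assumption| |exact B2].
      apply Rmult_le_compat; assumption. }
  destruct (Imp_dom _ _ _ _ D ltac:(lra) ltac:(lra)) as (r & Hr & B).
  assert (Er : r = (stieltjes s (a + h) - stieltjes s a - (- stieltjes2 s a) * h)%C).
  { replace (stieltjes s (a + h) - stieltjes s a - (- stieltjes2 s a) * h)%C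
     with (stieltjes s (a + h) - stieltjes s a + h * stieltjes2 s a)%C by ring.
    apply (Imp_unique _ _ _ Hr). refine (Imp_ext _ _ _ _ J). intros x Hx. cbv beta. unfold m.
    assert (N1 : (x + a)%C <> 0) by (apply (off_neg_neq a c); [exact Ho|lra]).
    assert (N2 : (x + (a + h))%C <> 0) by (apply (off_neg_neq _ _ x Oh); lra).
    field. auto. }
  rewrite <- Er. eapply Rle_trans; [exact B|].
  replace (- 1 - (Re s + 0 - 1)) with (- Re s) by ring. right; ring.
Qed.

(** The derivative of [x^(s+1) / (x + a)] is [s x^s / (x + a) + a x^s / (x + a)^2], and its boundary
    values vanish. Combined with [stieltjes_derive] this is the equation [a S' = s S] satisfied by
    the power [a^s]. *)
Lemma stieltjes_ode s a c : -1 < Re s < 0 -> off_neg a c -> (a * stieltjes2 s a)%C = (- s * stieltjes s a)%C.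
Proof.
  intros Hs Ho. assert (Hc0 := proj1 Ho). assert (Hc : 0 < / c) by (apply Rinv_0_lt_compat, Ho).
  assert (I1 := stieltjes_Imp s a c Hs Ho). assert (I2 := stieltjes2_Imp s a c Hs Ho).
  assert (I3 := Imp_plus _ _ _ _ (Imp_scal s _ _ I1) (Imp_scal a _ _ I2)). cbv beta in I3.
  assert (I4 : Imp (fun x => s * (RCpower x s * / (x + a)) + a * (RCpower x s * / ((x + a) * (x + a))))%C 0).
  { apply (Imp_FTC_zero (fun x => RCpower x (s + 1) * / (x + a))%C _ (/ c) (Re s + 1) (Re s)); [|lra|lra| |apply I3].
    - split; [|split].
      + intros x Hx. apply Rdb_mult; [now apply Rdb_RCpower|now apply (Rdb_shift_inv a c)].
      + intros x Hx. rewrite Cmod_mult, Cmod_RCpower, Re_add1, Rmult_comm.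
        apply Rmult_le_compat_r; [apply Rlt_le, Rpower_pos|].
        eapply Rle_trans; [apply (off_neg_inv a c x Ho); lra|].
        rewrite <- (Rmult_1_r (/ c)) at 2. apply Rmult_le_compat_l; [lra|]. apply Rinv_1plus_le1; lra.
      + intros x Hx. rewrite Cmod_mult, Cmod_RCpower, Re_add1, Rpower_plus, Rpower_1 by lra.
        apply Rle_trans with (Rpower x (Re s) * x * (/ c * / (1 + x))).
        * apply Rmult_le_compat_l; [apply Rmult_le_pos; [apply Rlt_le, Rpower_pos|lra]|].
          apply (off_neg_inv a c x Ho); lra.
        * replace (Rpower x (Re s) * x * (/ c * / (1 + x))) with (/ c * Rpower x (Re s) * (x * / (1 + x))) by ring.
          rewrite <- (Rmult_1_r (/ c * Rpower x (Re s))) at 2.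
          apply Rmult_le_compat_l; [apply Rmult_le_pos; [lra|apply Rlt_le, Rpower_pos]|].
          apply Rmult_le_reg_r with (1 + x); [lra|]. rewrite Rmult_assoc, Rinv_l; lra.
    - intros x Hx. assert (N1 : (x + a)%C <> 0) by (apply (off_neg_neq a c); [exact Ho|lra]).
      assert (Nx : RtoC x <> 0) by (apply RtoC_neq_0; lra).
      replace (s * (RCpower x s * / (x + a)) + a * (RCpower x s * / ((x + a) * (x + a))))%C with
        ((s + 1) * RCpower x (s + 1 - 1) * / (x + a) + RCpower x (s + 1) * (- (1 + 0) / ((x + a) * (x + a))))%C.
      2:{ replace (s + 1 - 1)%C with s by ring. rewrite RCpower_add, RCpower_1 by exact Hx. field. exact N1. }
      apply (Der_mult _ _ (fun x => RCpower x (s + 1)) (fun x => / (x + a))%C); [now apply Rder_RCpower|].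
      apply (Der_inv Rplus RtoC (fun x => x + a)%C); [exact N1|].
      apply Der_plus; [apply Rder_id|apply Der_const]. }
  assert (E := Imp_unique _ _ _ I3 I4).
  replace (a * stieltjes2 s a)%C with (s * stieltjes s a + a * stieltjes2 s a - s * stieltjes s a)%C by ring.
  rewrite E. ring.
Qed.

(** If [Cexp l] has modulus [r] and argument [2 ph], then [|x + Cexp l| >= cos ph (x + r)]: the
    squares differ by [(sin ph)^2 (x - r)^2]. *)
Lemma Cexp_off_neg l : Rabs (Im l) < PI -> exists c, off_neg (Cexp l) c.
Proof.
  intros Hl. set (r := exp (Re l)). set (ph := Im l / 2).
  assert (Hr : 0 < r) by apply exp_pos.
  apply Rabs_def2 in Hl.
  assert (Hcos : 0 < cos ph) by (apply cos_gt_0; unfold ph; lra).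
  exists (cos ph * Rmin 1 r). split; [apply Rmult_lt_0_compat; [exact Hcos|apply Rmin_pos; lra]|].
  intros x Hx.
  assert (A : cos ph * (x + r) <= Cmod (x + Cexp l)).
  { unfold Cmod. rewrite <- (sqrt_pow2 (cos ph * (x + r))) by (apply Rmult_le_pos; lra).
    apply sqrt_le_1_alt. unfold Cexp. simpl fst; simpl snd. fold r.
    replace (Im l) with (2 * ph) by (unfold ph; field).
    rewrite cos_2a_cos, sin_2a.
    assert (S := sin2_cos2 ph). unfold Rsqr in S. set (cc := cos ph) in *. set (ss := sin ph) in *.
    replace ((x + r * (2 * cc * cc - 1)) ^ 2 + (0 + r * (2 * ss * cc)) ^ 2) with
      (x ^ 2 + 2 * x * r * (2 * cc * cc - 1) + r ^ 2 * ((2 * cc * cc - 1) ^ 2 + 4 * (ss * ss) * (cc * cc))) by ring.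
    replace (ss * ss) with (1 - cc * cc) by lra.
    assert (0 <= (1 - cc * cc) * (x - r) ^ 2); [|nra].
    apply Rmult_le_pos; [nra|apply pow2_ge_0]. }
  eapply Rle_trans; [|exact A]. rewrite Rmult_assoc. apply Rmult_le_compat_l; [lra|].
  pose proof (Rmin_l 1 r). pose proof (Rmin_r 1 r). nra.
Qed.

(** By [stieltjes_ode] the function [stieltjes s (Cexp l) * Cexp (- s * l)] of [l] has derivative 0
    on the strip [|Im l| < PI], and at [l = 0] it is the Beta integral. The logarithm [l] as
    parameter fixes the branch of the power. *)
Lemma stieltjes_value s l : -1 < Re s < 0 -> Rabs (Im l) < PI ->
  Imp (fun x => RCpower x s * / (x + Cexp l))%C (Gm s * Gm (- s - 1) * Cexp (s * l))%C.
Proof.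
  intros Hs Hl.
  set (P := fun l => (stieltjes s (Cexp l) * Cexp (- s * l))%C).
  assert (HP : Cmod (P l - P 0) <= 0 * Cmod (l - 0)).
  { apply (Cder_mean_value P (fun _ => 0)); [|intros; rewrite Cmod_0; lra].
    intros t Ht. replace (0 + t * (l - 0))%C with (t * l)%C by ring.
    assert (Hv : Rabs (Im (t * l)) < PI).
    { replace (Im (t * l)) with (t * Im l) by (unfold Im; simpl; ring).
      rewrite Rabs_mult, (Rabs_pos_eq t) by lra. pose proof (Rabs_pos (Im l)). nra. }
    set (v := (t * l)%C) in *. destruct (Cexp_off_neg v Hv) as [c Ho].
    replace (RtoC 0) with (- stieltjes2 s (Cexp v) * Cexp v * Cexp (- s * v) + stieltjes s (Cexp v) * (Cexp (- s * v) * (- s)))%C.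
    2:{ replace (- stieltjes2 s (Cexp v) * Cexp v * Cexp (- s * v))%C with
         (- (Cexp v * stieltjes2 s (Cexp v)) * Cexp (- s * v))%C by ring.
        rewrite (stieltjes_ode s (Cexp v) c Hs Ho). ring. }
    apply (Der_mult _ _ (fun l => stieltjes s (Cexp l)) (fun l => Cexp (- s * l))%C).
    - apply (Der_comp _ _ (stieltjes s)); [now apply (stieltjes_derive s _ c)|apply Cder_Cexp].
    - apply (Der_comp _ _ Cexp); [apply Cder_Cexp|]. apply Cder_scal_aux. }
  rewrite Rmult_0_l in HP.
  assert (E : (P l - P 0)%C = 0) by (apply Cmod_eq_0, Rle_antisym; [exact HP|apply Cmod_ge_0]).
  apply Ceq_minus in E. unfold P in E.
  replace (- s * 0)%C with (RtoC 0) in E by ring. rewrite Cexp_0 in E.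
  assert (E1 : stieltjes s 1 = (Gm s * Gm (- s - 1))%C).
  { apply Imp_CInt. refine (Imp_ext _ _ _ _ (beta_Gamma s Hs)). intros x Hx.
    cbv beta. do 2 f_equal. rewrite RtoC_plus. ring. }
  rewrite E1 in E.
  assert (E2 : stieltjes s (Cexp l) = (Gm s * Gm (- s - 1) * Cexp (s * l))%C).
  { replace (Gm s * Gm (- s - 1))%C with (Gm s * Gm (- s - 1) * 1)%C by ring. rewrite <- E.
    replace (s * l)%C with (- (- s * l))%C by ring. rewrite (Cexp_opp (- s * l)). field. apply Cexp_neq_0. }
  rewrite <- E2. destruct (Cexp_off_neg l Hl) as [c Ho]. now apply (stieltjes_Imp s _ c).
Qed.

(** * Zeros of exp z - 1 - z *)

Definition q (z : C) : C := (Cexp z - 1 - z)%C.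

Lemma q_pair x y : q (x, y) = (exp x * cos y - 1 - x, exp x * sin y - y).
Proof. unfold q, Cexp, Re, Im, Cminus, Cplus, Copp, RtoC; simpl. f_equal; ring. Qed.

Lemma upper_zero_iff x y : upper_zero (x, y) <-> 0 < y /\ exp x * cos y = 1 + x /\ exp x * sin y = y.
Proof.
  unfold upper_zero. change (Cexp (x, y) - 1 - (x, y))%C with (q (x, y)). rewrite q_pair.
  unfold Im; simpl. split.
  - intros [H E]. unfold RtoC in E. injection E as E1 E2. repeat split; lra.
  - intros (H & E1 & E2). split; [exact H|]. unfold RtoC. f_equal; lra.
Qed.

Lemma sin_lt_id y : 0 < y -> sin y < y.
Proof. exact (sin_lt_x y). Qed.

Lemma zero_re_pos x y : upper_zero (x, y) -> 0 < x.
Proof.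
  intros H. apply upper_zero_iff in H. destruct H as (Hy & _ & E). apply Rnot_le_lt. intros Hx.
  assert (E1 : exp x <= 1) by (rewrite <- exp_0; apply exp_le; lra).
  pose proof (exp_pos x). pose proof (sin_lt_id y Hy).
  destruct (Rle_or_lt (sin y) 0); nra.
Qed.

Definition im_sqr (x : R) : R := exp (2 * x) - (1 + x) ^ 2.

Lemma zero_im_sqr x y : upper_zero (x, y) -> y ^ 2 = im_sqr x.
Proof.
  intros H. apply upper_zero_iff in H. destruct H as (Hy & E1 & E2).
  unfold im_sqr. rewrite <- E1. replace (2 * x) with (x + x) by ring. rewrite exp_plus.
  rewrite <- E2 at 1. generalize (sin2_cos2 y). unfold Rsqr. intros S.
  replace ((exp x * sin y) ^ 2) with (exp x * exp x * (sin y * sin y)) by ring.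
  replace (sin y * sin y) with (1 - cos y * cos y) by lra. ring.
Qed.

Lemma exp_ge_quadratic x : 0 <= x -> 1 + x + x ^ 2 / 2 <= exp x.
Proof.
  intros Hx. assert (H := nonneg_by_derivative (fun x => exp x - (1 + x + x ^ 2 / 2)) (fun x => exp x - (1 + x))).
  cbv beta in H. specialize (H ltac:(rewrite exp_0; lra)).
  assert (0 <= exp x - (1 + x + x ^ 2 / 2)); [|lra]. apply H; [| |exact Hx].
  - intros y _. auto_derive; [trivial|field].
  - intros y _. generalize (exp_ge_1plus y); lra.
Qed.

Lemma im_sqr_ge x : 0 <= x -> x ^ 2 + x ^ 4 / 4 <= im_sqr x.
Proof.
  intros Hx. unfold im_sqr. replace (2 * x) with (x + x) by ring. rewrite exp_plus.
  assert (A := exp_ge_quadratic x Hx).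
  assert (B : (1 + x + x ^ 2 / 2) * (1 + x + x ^ 2 / 2) <= exp x * exp x).
  { assert (0 <= x ^ 2) by apply pow2_ge_0. apply Rmult_le_compat; lra. }
  assert (0 <= x ^ 3) by (apply pow_le, Hx). simpl in *. lra.
Qed.

Lemma zero_re_le_im x y : upper_zero (x, y) -> x <= y.
Proof.
  intros H. pose proof (zero_re_pos x y H). pose proof (zero_im_sqr x y H) as E.
  apply upper_zero_iff in H. assert (A := im_sqr_ge x ltac:(lra)). assert (0 <= x ^ 4) by (apply pow_le; lra).
  apply Rnot_lt_le. intros L. simpl in *. nra.
Qed.

(** On the curve [y^2 >= x^4 / 4], so [x^2 <= 2 y] and [x^2 + y^2 <= (y + 1)^2]. This locates the
    modulus of a zero to within 1 of its imaginary part, which separates the zeros from the contour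
    circles. *)
Lemma zero_modulus_le x y : upper_zero (x, y) -> Cmod (x, y) <= y + 1.
Proof.
  intros H. pose proof (zero_re_pos x y H). pose proof (zero_im_sqr x y H) as E.
  apply upper_zero_iff in H. assert (A := im_sqr_ge x ltac:(lra)).
  assert (B : x ^ 2 <= 2 * y).
  { apply Rnot_lt_le. intros L. assert (0 <= x ^ 2) by apply pow2_ge_0.
    assert ((2 * y) * (2 * y) < x ^ 2 * x ^ 2) by (apply Rmult_le_0_lt_compat; lra).
    replace (x ^ 2 * x ^ 2) with (x ^ 4) in * by ring. simpl in *. nra. }
  unfold Cmod. simpl fst; simpl snd. rewrite <- (sqrt_pow2 (y + 1)) by lra.
  apply sqrt_le_1_alt. lra.
Qed.

Lemma MVT_derive (g g' : R -> R) a b : a < b -> (forall x, a <= x <= b -> is_derive g x (g' x)) ->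
  exists c, a <= c <= b /\ g b - g a = g' c * (b - a).
Proof.
  intros Hab Hd. destruct (MVT_gen g a b g') as (c & Hc & E).
  - intros z Hz. rewrite Rmin_left, Rmax_right in Hz by lra. apply Hd; lra.
  - intros z Hz. rewrite Rmin_left, Rmax_right in Hz by lra.
    apply continuity_pt_filterlim, (ex_derive_continuous g). eexists; apply Hd; lra.
  - rewrite Rmin_left, Rmax_right in Hc by lra. now exists c.
Qed.

Lemma is_derive_im_sqr x : is_derive im_sqr x (2 * exp (2 * x) - 2 * (1 + x)).
Proof. unfold im_sqr. auto_derive; [trivial|ring]. Qed.

Lemma modulus_mono x1 x2 : 0 < x1 < x2 -> x1 ^ 2 + im_sqr x1 < x2 ^ 2 + im_sqr x2.
Proof.
  intros H. destruct (MVT_derive (fun x => x ^ 2 + im_sqr x) (fun x => 2 * x + (2 * exp (2 * x) - 2 * (1 + x))) x1 x2)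
   as (c & Hc & E); [lra| |].
  - intros x _. apply (is_derive_plus (V := R_NormedModule) (fun x => x ^ 2) im_sqr); [auto_derive; [trivial|ring]|apply is_derive_im_sqr].
  - assert (1 < exp (2 * c)) by (rewrite <- exp_0; apply exp_increasing; lra). nra.
Qed.

(** Up to a positive factor, the derivative of [im_sqr x / x^2]. The expression and its first
    derivative vanish at 0, and its second derivative is [4 x exp (2 x)]. *)
Lemma slope_num_ge0 x : 0 <= x -> 0 <= (x - 1) * exp (2 * x) + 1 + x.
Proof.
  assert (H := nonneg_by_derivative (fun x => (2 * x - 1) * exp (2 * x) + 1) (fun x => 4 * x * exp (2 * x))).
  cbv beta in H. specialize (H ltac:(rewrite Rmult_0_r, exp_0; lra)).
  assert (H1 : forall x, 0 <= x -> 0 <= (2 * x - 1) * exp (2 * x) + 1).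
  { apply H.
    - intros y _. auto_derive; [trivial|ring].
    - intros y Hy. pose proof (exp_pos (2 * y)). apply Rmult_le_pos; lra. }
  assert (K := nonneg_by_derivative (fun x => (x - 1) * exp (2 * x) + 1 + x) (fun x => (2 * x - 1) * exp (2 * x) + 1)).
  cbv beta in K. apply K; [rewrite Rmult_0_r, exp_0; lra| |exact H1].
  intros y _. auto_derive; [trivial|ring].
Qed.

Lemma slope_mono x1 x2 : 0 < x1 <= x2 -> im_sqr x1 / x1 ^ 2 <= im_sqr x2 / x2 ^ 2.
Proof.
  intros [H [L|<-]]; [|lra].
  destruct (MVT_derive (fun x => im_sqr x / x ^ 2)
    (fun x => 2 * ((x - 1) * exp (2 * x) + 1 + x) / x ^ 3) x1 x2) as (c & Hc & E); [lra| |].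
  - intros x Hx. unfold im_sqr. auto_derive; [apply (pow_nonzero x 2); lra|]. field. lra.
  - assert (0 <= 2 * ((c - 1) * exp (2 * c) + 1 + c) / c ^ 3).
    { apply Rmult_le_pos; [generalize (slope_num_ge0 c); lra|].
      apply Rlt_le, Rinv_0_lt_compat, pow_lt. lra. }
    nra.
Qed.

Lemma zero_slope_mono x1 y1 x2 y2 : upper_zero (x1, y1) -> upper_zero (x2, y2) ->
  Cmod (x1, y1) <= Cmod (x2, y2) -> y1 / x1 <= y2 / x2.
Proof.
  intros H1 H2 L.
  pose proof (zero_re_pos _ _ H1). pose proof (zero_re_pos _ _ H2).
  pose proof (zero_im_sqr _ _ H1) as E1. pose proof (zero_im_sqr _ _ H2) as E2.
  apply upper_zero_iff in H1, H2. destruct H1 as [P1 _]. destruct H2 as [P2 _].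
  assert (Hx : x1 <= x2).
  { apply Rnot_lt_le. intros Lx. assert (A := modulus_mono x2 x1 ltac:(lra)).
    unfold Cmod in L. simpl fst in L; simpl snd in L. rewrite E1, E2 in L.
    apply sqrt_le_0 in L; [lra| |]; generalize (im_sqr_ge x1 ltac:(lra)) (im_sqr_ge x2 ltac:(lra)) (pow2_ge_0 x1) (pow2_ge_0 x2);
    assert (0 <= x1 ^ 4) by (apply pow_le; lra); assert (0 <= x2 ^ 4) by (apply pow_le; lra); lra. }
  assert (A := slope_mono x1 x2 ltac:(lra)). rewrite <- E1, <- E2 in A.
  replace (y1 ^ 2 / x1 ^ 2) with ((y1 / x1) ^ 2) in A by (field; lra).
  replace (y2 ^ 2 / x2 ^ 2) with ((y2 / x2) ^ 2) in A by (field; lra).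
  assert (0 < y1 / x1) by (apply Rdiv_lt_0_compat; lra).
  assert (0 < y2 / x2) by (apply Rdiv_lt_0_compat; lra).
  apply Rnot_lt_le. intros G. simpl in A. nra.
Qed.

(** Indexing starts at [k = 0] with [2 pi < Im z < 2 pi + pi / 2], since the corresponding band next
    to the real axis contains no zero. *)
Definition in_strip (k : nat) (z : C) : Prop :=
  2 * PI * (INR k + 1) < Im z < 2 * PI * (INR k + 1) + PI / 2.

Lemma sin_shift v k : sin (v + 2 * PI * INR k) = sin v.
Proof. replace (v + 2 * PI * INR k) with (v + 2 * INR k * PI) by ring. apply sin_period. Qed.

Lemma cos_shift v k : cos (v + 2 * PI * INR k) = cos v.
Proof. replace (v + 2 * PI * INR k) with (v + 2 * INR k * PI) by ring. apply cos_period. Qed.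

(** This excludes zeros with [0 < y < PI / 2], where [y cos y = (1 + x) sin y] would contradict
    [x > 0]. The proof splits at [v / 2] because the derivative [v sin v] of the difference vanishes
    at 0. *)
Lemma tan_gt_id v : 0 < v < PI / 2 -> v * cos v < sin v.
Proof.
  intros Hv. destruct (MVT_derive (fun v => sin v - v * cos v) (fun v => v * sin v) (0 + v / 2) v) as (c & Hc & E); [lra| |].
  { intros x _. auto_derive; [trivial|ring]. }
  assert (G := nonneg_by_derivative (fun v => sin v - v * cos v) (fun v => v * sin v)).
  cbv beta in G.
  destruct (MVT_derive (fun v => sin v - v * cos v) (fun v => v * sin v) 0 (v / 2)) as (d & Hd & F); [lra| |].
  { intros x _. auto_derive; [trivial|ring]. }
  cbv beta in *. rewrite sin_0, cos_0 in F. rewrite Rplus_0_l in *.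
  assert (0 < sin c) by (apply sin_gt_0; lra).
  assert (0 <= sin d) by (apply sin_ge_0; lra).
  assert (0 < c * sin c) by (apply Rmult_lt_0_compat; lra).
  assert (0 <= d * sin d) by (apply Rmult_le_pos; lra).
  assert (0 < c * sin c * (v - v / 2)) by (apply Rmult_lt_0_compat; lra).
  assert (0 <= d * sin d * (v / 2 - 0)) by (apply Rmult_le_pos; lra). lra.
Qed.

(** Since [x > 0], both [cos y = (1 + x) / e^x] and [sin y = y / e^x] are positive, which confines
    [y] to the first quarter of a period; the period with [n = 0] is excluded by [tan_gt_id]. *)
Lemma zero_in_strip z : upper_zero z -> exists k, in_strip k z.
Proof.
  destruct z as [x y]. intros H. assert (Hx := zero_re_pos x y H). apply upper_zero_iff in H.
  destruct H as (Hy & E1 & E2). assert (P := PI_RGT_0).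
  destruct (nfloor_ex (y / (2 * PI))) as [n [Hn1 Hn2]]; [apply Rlt_le, Rdiv_lt_0_compat; lra|].
  set (v := y - 2 * PI * INR n).
  assert (Ey : y = v + 2 * PI * INR n) by (unfold v; ring).
  assert (Hv : 0 <= v < 2 * PI).
  { unfold v. apply Rmult_le_compat_r with (r := 2 * PI) in Hn1; [|lra].
    apply Rmult_lt_compat_r with (r := 2 * PI) in Hn2; [|lra].
    replace (y / (2 * PI) * (2 * PI)) with y in * by (field; lra). lra. }
  rewrite Ey in E1, E2. rewrite cos_shift in E1. rewrite sin_shift in E2. rewrite <- Ey in E2.
  pose proof (exp_pos x).
  assert (Sp : 0 < sin v) by (apply Rnot_le_lt; intros; nra).
  assert (Cp : 0 < cos v) by (apply Rnot_le_lt; intros; nra).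
  assert (V1 : v < PI) by (apply Rnot_le_lt; intros L; generalize (sin_le_0 v L ltac:(lra)); lra).
  assert (V2 : v < PI / 2) by (apply Rnot_le_lt; intros L; generalize (cos_le_0 v L ltac:(lra)); lra).
  assert (V3 : 0 < v) by (destruct (proj1 Hv) as [|<-]; [assumption|rewrite sin_0 in Sp; lra]).
  destruct n as [|n].
  - exfalso. simpl in Ey. rewrite Rmult_0_r, Rplus_0_r in Ey. rewrite Ey in E2.
    assert (T := tan_gt_id v ltac:(lra)).
    assert (v * cos v = (1 + x) * sin v) by (rewrite <- E1; rewrite <- E2 at 1; ring). nra.
  - exists n. unfold in_strip, Im; simpl snd. rewrite S_INR in *. unfold v in *. lra.
Qed.

(* Eliminating [x = ln y - ln (sin y)] from [e^x cos y = 1 + x] shows that the zeros [x + i y]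
   with [sin y > 0] correspond to the zeros [y] of this function. *)
Definition strip_fun (y : R) : R := y * cos y / sin y - 1 - ln y + ln (sin y).

(** Written as minus a sum of squares over a positive denominator, so that strict decrease, hence
    uniqueness in each strip, can be read off. *)
Lemma strip_fun_derive y : 0 < y -> 0 < sin y ->
  is_derive strip_fun y (- ((y - sin y * cos y) ^ 2 + sin y ^ 4) / (y * sin y ^ 2)).
Proof.
  intros Hy Hs. unfold strip_fun. auto_derive; [repeat split; lra|].
  assert (S := sin2_cos2 y). unfold Rsqr in S.
  set (s := sin y) in *. set (c := cos y) in *.
  assert (C2 : c * c = 1 - s * s) by lra.
  replace (s ^ 4) with (s ^ 2 * (1 - c * c)) by (rewrite C2; ring).
  replace (- ((y - s * c) ^ 2 + s ^ 2 * (1 - c * c)) / (y * s ^ 2)) with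
    (2 * c / s - y * (s * s + c * c) / s ^ 2 - 1 / y * ((s * s) / s ^ 2)) .
  - field. lra.
  - rewrite C2. field_simplify_eq; [|lra]. 
    replace (c ^ 2) with (1 - s * s) by (rewrite <- C2; ring). ring.
Qed.

Lemma strip_sin_pos k y : 2 * PI * (INR k + 1) < y < 2 * PI * (INR k + 1) + PI / 2 -> 0 < y /\ 0 < sin y.
Proof.
  intros H. assert (P := PI_RGT_0). pose proof (pos_INR k).
  split; [nra|]. replace y with ((y - 2 * PI * (INR k + 1)) + 2 * PI * INR (S k)) by (rewrite S_INR; ring).
  rewrite sin_shift. apply sin_gt_0; lra.
Qed.

Lemma zero_strip_fun x y : upper_zero (x, y) -> 0 < sin y -> strip_fun y = 0 /\ x = ln y - ln (sin y).
Proof.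
  intros H Hs. apply upper_zero_iff in H. destruct H as (Hy & E1 & E2).
  assert (Ex : x = ln y - ln (sin y)).
  { rewrite <- E2 at 1. rewrite ln_mult, ln_exp by (try apply exp_pos; exact Hs). ring. }
  split; [|exact Ex]. unfold strip_fun.
  replace (y * cos y / sin y) with (1 + x); [lra|]. rewrite <- E1.
  replace (y * cos y / sin y) with (exp x * sin y * cos y / sin y) by now rewrite E2. field. lra.
Qed.

Lemma zero_unique k z w : upper_zero z -> upper_zero w -> in_strip k z -> in_strip k w -> z = w.
Proof.
  assert (G : forall x1 y1 x2 y2, upper_zero (x1, y1) -> upper_zero (x2, y2) ->
    in_strip k (x1, y1) -> in_strip k (x2, y2) -> y1 < y2 -> False).
  { intros x1 y1 x2 y2 H1 H2 S1 S2 L. unfold in_strip, Im in S1, S2. simpl snd in *.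
    destruct (MVT_derive strip_fun _ y1 y2 L (fun y Hy => strip_fun_derive y
      (proj1 (strip_sin_pos k y ltac:(lra))) (proj2 (strip_sin_pos k y ltac:(lra))))) as (c & Hc & E).
    rewrite (proj1 (zero_strip_fun _ _ H1 (proj2 (strip_sin_pos k _ S1)))) in E.
    rewrite (proj1 (zero_strip_fun _ _ H2 (proj2 (strip_sin_pos k _ S2)))) in E.
    destruct (strip_sin_pos k c ltac:(lra)) as [Pc Ps].
    assert (0 < ((c - sin c * cos c) ^ 2 + sin c ^ 4) / (c * sin c ^ 2)).
    { apply Rdiv_lt_0_compat.
      - assert (0 < sin c ^ 4) by (apply pow_lt, Ps). generalize (pow2_ge_0 (c - sin c * cos c)). lra.
      - apply Rmult_lt_0_compat; [exact Pc|apply pow_lt, Ps]. }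
    unfold Rdiv in *. rewrite Ropp_mult_distr_l_reverse in E. nra. }
  destruct z as [x1 y1], w as [x2 y2]. intros H1 H2 S1 S2.
  destruct (Rtotal_order y1 y2) as [L|[E|L]].
  - exfalso. eapply (G x1 y1 x2 y2); eassumption.
  - subst y2. f_equal.
    rewrite (proj2 (zero_strip_fun _ _ H1 (proj2 (strip_sin_pos k _ S1)))).
    now rewrite (proj2 (zero_strip_fun _ _ H2 (proj2 (strip_sin_pos k _ S2)))).
  - exfalso. eapply (G x2 y2 x1 y1); eassumption.
Qed.

(** [strip_fun] changes sign between the offsets [PI / 3] and [PI / 2]. At the second it is
    [- 1 - ln b]; at the first it is [u / 2 - 1 - ln u] with [u = a / sin (PI / 3) > 6], positive by
    the tangent to [ln] at 4 and [ln 4 <= 3 / 2]. *)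
Lemma zero_exists k : exists z, upper_zero z /\ in_strip k z.
Proof.
  assert (P := PI_RGT_0). assert (P3 : 3 < PI) by (generalize PI2_3_2; unfold PI2; lra).
  pose proof (pos_INR k) as Pk.
  set (a := 2 * PI * (INR k + 1) + PI / 3). set (b := 2 * PI * (INR k + 1) + PI / 2).
  assert (Ha : 6 < a) by (unfold a; nra).
  assert (Sa : sin a = sin (PI / 3)).
  { unfold a. replace (2 * PI * (INR k + 1) + PI / 3) with (PI / 3 + 2 * PI * INR (S k)) by (rewrite S_INR; ring). apply sin_shift. }
  assert (Ca : cos a = 1 / 2).
  { unfold a. replace (2 * PI * (INR k + 1) + PI / 3) with (PI / 3 + 2 * PI * INR (S k)) by (rewrite S_INR; ring).
    rewrite cos_shift. apply cos_PI3. }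
  assert (Sb : sin b = 1).
  { unfold b. replace (2 * PI * (INR k + 1) + PI / 2) with (PI / 2 + 2 * PI * INR (S k)) by (rewrite S_INR; ring).
    rewrite sin_shift. apply sin_PI2. }
  assert (Cb : cos b = 0).
  { unfold b. replace (2 * PI * (INR k + 1) + PI / 2) with (PI / 2 + 2 * PI * INR (S k)) by (rewrite S_INR; ring).
    rewrite cos_shift. apply cos_PI2. }
  assert (Hs : 0 < sin (PI / 3)) by (apply sin_gt_0; lra).
  assert (Hs1 : sin (PI / 3) <= 1) by (generalize (SIN_bound (PI / 3)); lra).
  assert (Spos : forall y, a <= y <= b -> 0 < y /\ 0 < sin y).
  { intros y Hy. destruct (Rlt_or_le y b).
    - apply (strip_sin_pos k). unfold a, b in *. lra.
    - assert (y = b) by lra. subst y. rewrite Sb. lra. }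
  destruct (Ranalysis5.IVT_interv (fun y => - strip_fun y) a b) as (y & Hy & E).
  - intros y Hy. destruct (Spos y Hy) as [P1 P2].
    apply continuity_pt_filterlim, (ex_derive_continuous (fun y => - strip_fun y)).
    eexists. apply (is_derive_opp strip_fun). apply strip_fun_derive; assumption.
  - unfold a, b. lra.
  - unfold strip_fun. rewrite Ca, Sa. set (u := a / sin (PI / 3)).
    assert (Hu : 6 < u).
    { unfold u. apply Rlt_le_trans with a; [exact Ha|]. unfold Rdiv. rewrite <- (Rmult_1_r a) at 1.
      apply Rmult_le_compat_l; [lra|]. rewrite <- Rinv_1. apply Rinv_le_contravar; lra. }
    replace (a * (1 / 2) / sin (PI / 3)) with (u / 2) by (unfold u; field; lra).
    assert (El : ln u = ln a - ln (sin (PI / 3))) by (unfold u; apply ln_div; lra).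
    assert (L4 : ln 4 <= 3 / 2).
    { rewrite <- (ln_exp (3 / 2)). apply ln_le; [lra|].
      replace (exp (3 / 2)) with (exp (1 / 2) * exp (1 / 2) * exp (1 / 2)) by (rewrite <- !exp_plus; f_equal; field).
      assert (A := exp_ge_quadratic (1 / 2) ltac:(lra)). simpl in A. nra. }
    assert (Lu : ln u <= u / 4 - 1 + ln 4).
    { replace u with (4 * (u / 4)) at 1 by field. rewrite ln_mult by lra.
      assert (A := exp_ge_1plus (ln (u / 4))). rewrite exp_ln in A by lra. lra. }
    lra.
  - unfold strip_fun. rewrite Cb, Sb, ln_1. assert (Hb : 1 <= b) by (unfold a, b in *; lra).
    pose proof (ln_nonneg b Hb). unfold Rdiv. rewrite Rmult_0_r, Rmult_0_l. lra.
  - destruct (Spos y Hy) as [P1 P2]. cbv beta in E.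
    (* The intermediate value theorem permits the endpoint [b], which the strict upper bound of the
       strip forbids. *)
    assert (Ny : y <> b).
    { intros ->. unfold strip_fun in E. rewrite Cb, Sb, ln_1 in E.
      assert (Hb : 1 <= b) by (unfold a, b in *; lra).
      pose proof (ln_nonneg b Hb). unfold Rdiv in E. rewrite Rmult_0_r, Rmult_0_l in E. lra. }
    exists (ln y - ln (sin y), y). split.
    + apply upper_zero_iff. unfold Rminus. rewrite exp_plus, exp_Ropp, !exp_ln by assumption.
      split; [exact P1|]. split; [|field; lra].
      unfold strip_fun in E. replace (y * / sin y * cos y) with (y * cos y / sin y) by (field; lra). lra.
    + unfold in_strip, Im; simpl snd. unfold a, b in *. lra.
Qed.

(** * Conjugate symmetry, enumeration and logarithms of the zeros *)

Lemma Cexp_conj z : Cexp (Cconj z) = Cconj (Cexp z).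
Proof.
  destruct z as [x y]. unfold Cexp, Cconj, Re, Im; simpl. rewrite cos_neg, sin_neg. f_equal; ring.
Qed.

Lemma q_conj z : q (Cconj z) = Cconj (q z).
Proof.
  unfold q. rewrite Cexp_conj. unfold Cconj, Cminus, Cplus, Copp, RtoC; simpl. f_equal; ring.
Qed.

Lemma q_zero_cases w : q w = 0 -> w = 0 \/ upper_zero w \/ upper_zero (Cconj w).
Proof.
  intros E. destruct (Rtotal_order (Im w) 0) as [L|[E0|L]].
  - right; right. split; [|].
    + destruct w; unfold Im, Cconj in *; simpl in *; lra.
    + change (q (Cconj w) = 0). rewrite q_conj, E. unfold Cconj, RtoC; simpl. f_equal; ring.
  - left. destruct w as [x y]. unfold Im in E0; simpl in E0. subst y.
    rewrite q_pair in E. unfold RtoC in *. injection E as E1 _. rewrite cos_0 in E1.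
    destruct (Req_dec x 0) as [->|Nx]; [reflexivity|].
    generalize (exp_ineq1 x Nx). lra.
  - right; left. split; [exact L|exact E].
Qed.

Lemma zero_is_nth (z : nat -> C) : (forall k, upper_zero (z k) /\ in_strip k (z k)) ->
  forall w, upper_zero w -> exists k, w = z k.
Proof.
  intros H w Hw. destruct (zero_in_strip w Hw) as [k Hk]. exists k.
  destruct (H k). now apply (zero_unique k).
Qed.

(** A logarithm of [- z]. For [z] in the open first quadrant its imaginary part lies in
    [(- PI, - PI / 2)], inside the strip of [stieltjes_value], so it selects the branch of
    [(- z)^(s-1)]. *)
Definition log_neg (z : C) : C := (ln (Cmod z), atan (Im z / Re z) - PI).

Lemma Cexp_log_neg z : 0 < Re z -> Cexp (log_neg z) = (- z)%C.
Proof.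
  destruct z as [x y]. unfold Re; simpl. intros Hx.
  assert (Hm : 0 < Cmod (x, y)).
  { apply Cmod_gt_0. intros E. injection E as E _. lra. }
  unfold log_neg, Cexp, Re, Im; simpl fst; simpl snd.
  rewrite exp_ln by exact Hm.
  unfold Rminus. rewrite <- (Rplus_0_r (atan (y / x) + - PI)).
  replace (atan (y / x) + - PI + 0) with (- (PI - atan (y / x))) by ring.
  rewrite cos_neg, sin_neg. replace (PI - atan (y / x)) with (- (atan (y / x) - PI)) by ring.
  rewrite cos_neg, sin_neg, Ropp_involutive. unfold Rminus.
  rewrite cos_plus, sin_plus, cos_neg, sin_neg, cos_PI, sin_PI, cos_atan, sin_atan.
  assert (Es : Cmod (x, y) = x * sqrt (1 + (y / x)²)).
  { unfold Cmod; simpl fst; simpl snd. rewrite <- (sqrt_pow2 x) at 2 by lra.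
    rewrite <- sqrt_mult_alt by (apply pow2_ge_0). f_equal. unfold Rsqr. field. lra. }
  assert (Sp : 0 < sqrt (1 + (y / x)²)) by (apply sqrt_lt_R0; generalize (Rle_0_sqr (y / x)); lra).
  rewrite Es. unfold Copp; simpl. f_equal; field; lra.
Qed.

Lemma log_neg_im z : 0 < Re z -> 0 < Im z -> Im (log_neg z) = atan (Im z / Re z) - PI /\
   0 < atan (Im z / Re z) < PI / 2.
Proof.
  intros Hx Hy. split; [reflexivity|]. split.
  - rewrite <- atan_0. apply atan_increasing. now apply Rdiv_lt_0_compat.
  - apply atan_bound.
Qed.

(** The positive real part of [z1] puts [theta1] below [PI / 2], where [atan] inverts [tan]; hence
    [theta1 = atan (y1 / x1)] and the monotonicity of the slope applies. *)
Lemma smallest_angle z1 r1 theta1 z : smallest_upper_zero z1 -> 0 < r1 -> 0 < theta1 < PI ->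
  z1 = (RtoC r1 * Cexp (Ci * RtoC theta1))%C -> upper_zero z -> theta1 <= atan (Im z / Re z).
Proof.
  intros [H1 Hmin] Hr Ht E Hz. specialize (Hmin z Hz).
  destruct z1 as [x1 y1], z as [x y].
  assert (M := zero_slope_mono _ _ _ _ H1 Hz Hmin).
  assert (Hx1 := zero_re_pos _ _ H1).
  assert (Ec : Cexp (Ci * theta1) = (cos theta1, sin theta1)).
  { unfold Cexp, Ci, Re, Im; simpl. replace (0 * theta1 - 1 * 0) with 0 by ring.
    replace (0 * 0 + 1 * theta1) with theta1 by ring. rewrite exp_0. f_equal; ring. }
  rewrite Ec in E. unfold Cmult, RtoC in E; simpl in E. injection E as E1 E2.
  replace (r1 * cos theta1 - 0 * sin theta1) with (r1 * cos theta1) in E1 by ring.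
  replace (r1 * sin theta1 + 0 * cos theta1) with (r1 * sin theta1) in E2 by ring.
  assert (Cp : 0 < cos theta1) by (apply Rnot_le_lt; intros; nra).
  assert (T2 : theta1 < PI / 2) by (apply Rnot_le_lt; intros L; generalize (cos_le_0 theta1 L ltac:(lra)); lra).
  unfold Re, Im; simpl.
  rewrite <- (atan_tan theta1) by lra.
  assert (Et : tan theta1 = y1 / x1) by (unfold tan; rewrite E1, E2; field; lra).
  rewrite Et. destruct M as [M|M]; [apply Rlt_le, atan_increasing, M|rewrite M; lra].
Qed.

(** * Mittag-Leffler expansion *)

(** The principal part of [1 / q] at a nonzero zero [p]; the residue is [1 / p] because
    [q'(p) = e^p - 1 = p]. *)
Definition pole (p w : C) : C := (/ (p * (w - p)))%C.
Definition polesum (L : list C) (w : C) : C := fold_right (fun p acc => pole p w + acc)%C (RtoC 0) L.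
Fixpoint zeros (z : nat -> C) (n : nat) : list C :=
  match n with O => nil | S n => z n :: Cconj (z n) :: zeros z n end.

(* [1/q] minus its principal part at [0]. *)
Definition hreg (w : C) : C := (/ q w - 2 / (w * w) + 2 / (3 * w))%C.

Lemma Cdb_q w : Cdb q w.
Proof. eexists. apply Cder_Cexp_sub2. Qed.

Lemma q_0 : q 0 = 0.
Proof. unfold q. rewrite Cexp_0. ring. Qed.

Lemma exp_quarter : exp (1 / 4) <= 4 / 3.
Proof.
  assert (A := exp_ge_1plus (- (1 / 4))). rewrite exp_Ropp in A.
  pose proof (exp_pos (1 / 4)). apply Rmult_le_reg_l with (/ exp (1 / 4)); [now apply Rinv_0_lt_compat|].
  rewrite Rinv_l by lra. lra.
Qed.

Lemma Cmod_RtoC_pos (r : R) : 0 <= r -> Cmod r = r.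
Proof. intros H. rewrite Cmod_R. now apply Rabs_pos_eq. Qed.

Lemma q_near_0 w : Cmod w <= 1 / 4 -> Cmod w ^ 2 / 8 <= Cmod (q w).
Proof.
  intros Hw. assert (B := Cexp_sub3_le w). fold (q w) in B.
  assert (E : exp (Cmod w) <= 4 / 3) by (eapply Rle_trans; [apply exp_le, Hw|apply exp_quarter]).
  pose proof (Cmod_ge_0 w) as P.
  assert (B2 : Cmod w ^ 3 * exp (Cmod w) <= Cmod w ^ 2 / 3).
  { apply Rle_trans with (Cmod w ^ 3 * (4 / 3)); [apply Rmult_le_compat_l; [now apply pow_le|exact E]|].
    assert (0 <= Cmod w ^ 2) by apply pow2_ge_0. replace (Cmod w ^ 3) with (Cmod w ^ 2 * Cmod w) by ring. nra. }
  generalize (Cmod_sub_ge (w * w / 2) (w * w / 2 - q w)).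
  replace (w * w / 2 - (w * w / 2 - q w))%C with (q w) by ring.
  rewrite (Cmod_sub_sym (w * w / 2)). rewrite Cmod_half, Cmod_mult.
  assert (B' : Cmod (q w - w * w / 2) <= Cmod w ^ 2 / 3) by lra.
  assert (0 <= Cmod w ^ 2) by apply pow2_ge_0.
  replace (Cmod w * Cmod w) with (Cmod w ^ 2) by ring. lra.
Qed.

(** Write [q w = w^2/2 + w^3/6 + r] with [r = O(w^4)]. Over the denominator [q w * w^2] the terms of
    order 2 and 3 in the numerator of [hreg] cancel, leaving [w^4 / 9 - (2 - 2 w / 3) r] against a
    denominator of order 4. *)
Lemma hreg_near_0 (w : C) : 0 < Cmod w <= 1 / 4 -> Cmod (hreg w) <= 32.
Proof.
  intros Hw. assert (Q := q_near_0 w ltac:(lra)).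
  assert (Nw : w <> 0) by (apply Cmod_gt_0; lra).
  assert (P2 : 0 < Cmod w ^ 2) by (apply pow_lt; lra).
  assert (Nq : q w <> 0) by (apply Cmod_gt_0; lra).
  set (r := (q w - w * w / 2 - w * w * w / 6)%C).
  assert (Br : Cmod r <= Cmod w ^ 4 * (4 / 3)).
  { eapply Rle_trans; [apply Cexp_sub4_le|]. apply Rmult_le_compat_l; [apply pow_le; lra|].
    eapply Rle_trans; [apply exp_le|apply exp_quarter]. lra. }
  assert (E : hreg w = ((w * w * w * w / 9 - (2 - 2 * w / 3) * r) / (q w * (w * w)))%C).
  { unfold hreg. assert (Eq : q w = (r + w * w / 2 + w * w * w / 6)%C) by (unfold r; ring).
    rewrite Eq. rewrite Eq in Nq. field. split; [exact Nw|].
    intros E. apply Nq. replace (r + w * w / 2 + w * w * w / 6)%C with (((6 * r + w * w * 3) * 2 + w * w * w * 2) / 12)%C by field.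
    rewrite <- (Cmult_0_l (/ 12)%C). unfold Cdiv. f_equal. rewrite <- E. ring. }
  assert (Bn : Cmod (w * w * w * w / 9 - (2 - 2 * w / 3) * r) <= 4 * Cmod w ^ 4).
  { eapply Rle_trans; [apply Cmod_sub_le|]. rewrite Cmod_mult.
    assert (B1 : Cmod (w * w * w * w / 9) = Cmod w ^ 4 / 9).
    { rewrite Cmod_div by (apply RtoC_neq_0; lra). rewrite !Cmod_mult, Cmod_RtoC_pos by lra. field. }
    assert (B2 : Cmod (2 - 2 * w / 3) <= 13 / 6).
    { eapply Rle_trans; [apply Cmod_sub_le|].
      rewrite Cmod_div by (apply RtoC_neq_0; lra). rewrite Cmod_mult, !Cmod_RtoC_pos by lra. lra. }
    rewrite B1. assert (0 <= Cmod w ^ 4) by (apply pow_le; lra).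
    assert (Cmod (2 - 2 * w / 3) * Cmod r <= 13 / 6 * (Cmod w ^ 4 * (4 / 3))).
    { apply Rmult_le_compat; [apply Cmod_ge_0|apply Cmod_ge_0|exact B2|exact Br]. }
    lra. }
  rewrite E, Cmod_div by (repeat apply Cmult_neq_0; assumption). rewrite !Cmod_mult.
  replace (Cmod w * Cmod w) with (Cmod w ^ 2) by ring.
  assert (P4 : Cmod w ^ 4 = Cmod w ^ 2 * Cmod w ^ 2) by ring.
  apply Rmult_le_reg_r with (Cmod (q w) * Cmod w ^ 2); [apply Rmult_lt_0_compat; lra|].
  unfold Rdiv. rewrite Rmult_assoc, Rinv_l by (apply Rgt_not_eq, Rmult_lt_0_compat; lra).
  rewrite Rmult_1_r. eapply Rle_trans; [exact Bn|]. rewrite P4. nra.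
Qed.

(** From [e^p = 1 + p] comes the exact expansion [q (p + u) = p u + (1 + p) (e^u - 1 - u)]: the zero
    is simple and isolated, and [1 / q] minus its principal part is bounded. *)
Lemma q_near_zero (p : C) : q p = 0 -> p <> 0 -> exists d M, 0 < d /\ forall w, 0 < Cmod (w - p) < d ->
  q w <> 0 /\ Cmod (/ q w - pole p w) <= M.
Proof.
  intros Hp Np. pose proof (proj1 (Cmod_gt_0 p) Np) as Pp. pose proof (Cmod_ge_0 (1 + p)) as P1.
  (* The radius keeps the quadratic term, at most [3 |1 + p| |u|^2], below half of [|p u|]. *)
  set (d := Rmin 1 (Cmod p / (6 * (Cmod (1 + p) + 1)))).
  assert (Hd : 0 < d) by (apply Rmin_pos; [lra|apply Rdiv_lt_0_compat; lra]).
  exists d, (6 * Cmod (1 + p) / Cmod p ^ 2). split; [exact Hd|]. intros w Hw.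
  set (u := (w - p)%C) in *. assert (Ew : w = (p + u)%C) by (unfold u; ring).
  assert (U1 : Cmod u < 1) by (eapply Rlt_le_trans; [apply Hw|apply Rmin_l]).
  assert (U2 : Cmod u < Cmod p / (6 * (Cmod (1 + p) + 1))) by (eapply Rlt_le_trans; [apply Hw|apply Rmin_r]).
  apply Rmult_lt_compat_r with (r := 6 * (Cmod (1 + p) + 1)) in U2; [|lra].
  replace (Cmod p / (6 * (Cmod (1 + p) + 1)) * (6 * (Cmod (1 + p) + 1))) with (Cmod p) in U2 by (field; lra).
  assert (Eq : q w = (p * u + (1 + p) * (Cexp u - 1 - u))%C).
  { assert (Ep : Cexp p = (1 + p)%C).
    { unfold q in Hp. replace (Cexp p) with (Cexp p - 1 - p + (1 + p))%C by ring. rewrite Hp. ring. }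
    rewrite Ew. unfold q. rewrite Cexp_add, Ep. ring. }
  assert (Br : Cmod (Cexp u - 1 - u) <= 3 * Cmod u ^ 2).
  { eapply Rle_trans; [apply Cexp_sub2_le|]. rewrite Rmult_comm. apply Rmult_le_compat_r; [apply pow2_ge_0|].
    apply Rle_trans with (exp 1); [apply exp_le; lra|]. apply exp_le_3. }
  assert (Bq : Cmod p * Cmod u / 2 <= Cmod (q w)).
  { rewrite Eq. generalize (Cmod_sub_ge (p * u) (- ((1 + p) * (Cexp u - 1 - u)))).
    replace (p * u - - ((1 + p) * (Cexp u - 1 - u)))%C with (p * u + (1 + p) * (Cexp u - 1 - u))%C by ring.
    rewrite Cmod_opp, !Cmod_mult.
    assert (Cmod (1 + p) * Cmod (Cexp u - 1 - u) <= Cmod (1 + p) * (3 * Cmod u ^ 2)) by (apply Rmult_le_compat_l; lra).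
    assert (Cmod (1 + p) * (3 * Cmod u ^ 2) <= Cmod p * Cmod u / 2) by (simpl; nra). lra. }
  assert (Pq : 0 < Cmod (q w)).
  { assert (0 < Cmod p * Cmod u) by (apply Rmult_lt_0_compat; lra). lra. }
  assert (Nq : q w <> 0) by now apply Cmod_gt_0.
  assert (Nu : u <> 0) by (apply Cmod_gt_0; lra).
  split; [exact Nq|]. unfold pole. fold u.
  replace (/ q w - / (p * u))%C with ((p * u - q w) / (q w * (p * u)))%C by (field; auto).
  rewrite Cmod_div by (repeat apply Cmult_neq_0; assumption).
  replace (p * u - q w)%C with (- ((1 + p) * (Cexp u - 1 - u)))%C by (rewrite Eq; ring).
  rewrite Cmod_opp, !Cmod_mult.
  apply Rle_trans with (Cmod (1 + p) * (3 * Cmod u ^ 2) / (Cmod p * Cmod u / 2 * (Cmod p * Cmod u))).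
  - unfold Rdiv at 1 2. apply Rmult_le_compat.
    + apply Rmult_le_pos; apply Cmod_ge_0.
    + apply Rlt_le, Rinv_0_lt_compat. repeat apply Rmult_lt_0_compat; lra.
    + apply Rmult_le_compat_l; lra.
    + assert (0 < Cmod p * Cmod u) by (apply Rmult_lt_0_compat; lra).
      apply Rinv_le_contravar; [apply Rmult_lt_0_compat; lra|]. apply Rmult_le_compat_r; lra.
  - right. field. lra.
Qed.

Lemma pole_Cdb (p w : C) : p <> 0 -> w <> p -> Cdb (pole p) w.
Proof.
  intros Np Nw. apply Cdb_inv.
  - apply Cmult_neq_0; [exact Np|]. intros E. apply Nw, Ceq_minus, E.
  - apply Cdb_mult; [apply Cdb_const|]. apply Cdb_minus; [apply Cdb_id|apply Cdb_const].
Qed.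

Lemma polesum_Cdb L w : ~ In (RtoC 0) L -> ~ In w L -> Cdb (polesum L) w.
Proof.
  induction L as [|p L IH]; intros H0 H.
  - exact (Cdb_const 0 w).
  - simpl in *. apply Cdb_plus; [apply pole_Cdb|apply IH]; intuition.
Qed.

Lemma polesum_app L1 L2 w : polesum (L1 ++ L2) w = (polesum L1 w + polesum L2 w)%C.
Proof. induction L1 as [|p L IH]; simpl; [ring|rewrite IH; ring]. Qed.

Lemma Cdb_bounded f p : Cdb f p -> exists d M, 0 < d /\ forall w, Cmod (w - p) < d -> Cmod (f w) <= M.
Proof.
  intros H. destruct (Cdb_cont f p H 1 Rlt_0_1) as (d & Hd & K).
  exists d, (Cmod (f p) + 1). split; [exact Hd|]. intros w Hw. specialize (K w Hw).
  generalize (Cmod_triangle (f w - f p) (f p)). replace (f w - f p + f p)%C with (f w) by ring. lra.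
Qed.

Lemma PI_gt_3 : 3 < PI.
Proof. generalize PI2_3_2; unfold PI2; lra. Qed.

Section MittagLeffler.
Context (z : nat -> C) (Hz : forall k, upper_zero (z k) /\ in_strip k (z k)).

Lemma zero_im_gt k : 2 * PI * (INR k + 1) < Im (z k).
Proof. destruct (Hz k) as [_ H]. apply H. Qed.

Lemma zero_im_lt k : Im (z k) < 2 * PI * (INR k + 1) + 2.
Proof. destruct (Hz k) as [_ [_ H]]. generalize PI_4; lra. Qed.

Lemma zero_re_gt k : 0 < Re (z k) <= Im (z k).
Proof.
  destruct (Hz k) as [H _]. destruct (z k) as [x y]. unfold Re, Im; simpl.
  split; [now apply (zero_re_pos x y)|now apply zero_re_le_im].
Qed.

Lemma zero_Cmod_gt k : 2 * PI * (INR k + 1) < Cmod (z k).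
Proof.
  eapply Rlt_le_trans; [apply zero_im_gt|]. eapply Rle_trans; [apply Rle_abs|apply Rabs_Im_le].
Qed.

Lemma zero_Cmod_lt k : Cmod (z k) < 2 * PI * (INR k + 1) + 3.
Proof.
  pose proof (zero_im_lt k). destruct (Hz k) as [H1 _].
  assert (A : Cmod (z k) <= Im (z k) + 1) by (destruct (z k) as [x y]; now apply zero_modulus_le). lra.
Qed.

Lemma In_zeros n w : In w (zeros z n) <-> exists k, (k < n)%nat /\ (w = z k \/ w = Cconj (z k)).
Proof.
  induction n as [|n IH]; simpl.
  - split; [tauto|]. intros (k & Hk & _); lia.
  - rewrite IH. split.
    + intros [<-|[<-|(k & Hk & H)]]; [exists n; auto|exists n; auto|exists k; split; [lia|exact H]].
    + intros (k & Hk & H). destruct (Nat.eq_dec k n) as [->|Nk].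
      * intuition.
      * right; right. exists k. split; [lia|exact H].
Qed.

Lemma Im_conj w : Im (Cconj w) = - Im w.
Proof. reflexivity. Qed.

Lemma zero_im_pos k : 0 < Im (z k).
Proof. destruct (Hz k) as [[H _] _]. exact H. Qed.

Lemma zero_im_mono j k : (j < k)%nat -> Im (z j) < Im (z k).
Proof.
  intros H. generalize (zero_im_lt j) (zero_im_gt k) PI_gt_3. apply le_INR in H. rewrite S_INR in H. nra.
Qed.

(** The absolute imaginary parts increase strictly with the index, and the two members of a pair
    have opposite signs. *)
Lemma zeros_NoDup n : NoDup (zeros z n).
Proof.
  induction n as [|n IH]; simpl; [constructor|].
  assert (A : forall w, In w (zeros z n) -> Rabs (Im w) < Im (z n)).
  { intros w Hw. apply In_zeros in Hw. destruct Hw as (k & Hk & [->| ->]); [|rewrite Im_conj, Rabs_Ropp];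
    rewrite Rabs_pos_eq by (apply Rlt_le, zero_im_pos); now apply zero_im_mono. }
  pose proof (zero_im_pos n).
  constructor; [|constructor; [|exact IH]].
  - intros [E|E].
    + apply (f_equal Im) in E. rewrite Im_conj in E. lra.
    + apply A in E. rewrite Rabs_pos_eq in E; lra.
  - intros E. apply A in E. rewrite Im_conj, Rabs_Ropp, Rabs_pos_eq in E; lra.
Qed.

Lemma zeros_neq_0 n : ~ In (RtoC 0) (zeros z n).
Proof.
  intros H. apply In_zeros in H. destruct H as (k & _ & [E|E]); apply (f_equal Im) in E;
  rewrite ?Im_conj in E; generalize (zero_im_pos k); unfold Im, RtoC in *; simpl in *; lra.
Qed.

Lemma q_z k : q (z k) = 0.
Proof. destruct (Hz k) as [[_ H] _]. exact H. Qed.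

Lemma zeros_q n w : In w (zeros z n) -> q w = 0.
Proof.
  intros H. apply In_zeros in H. destruct H as (k & _ & [->| ->]); [apply q_z|].
  rewrite q_conj, q_z. unfold Cconj, RtoC; simpl. f_equal; ring.
Qed.

(** The radius [2 PI n + 6] is below [2 PI (n + 1)], which the zeros of index at least [n] exceed in
    modulus. *)
Lemma q_zeros_in_disc n (w : C) : q w = 0 -> w <> 0 -> Cmod w < 2 * PI * INR n + 6 -> In w (zeros z n).
Proof.
  intros Hw Nw L. apply In_zeros.
  assert (A : forall k, Cmod (z k) < 2 * PI * INR n + 6 -> (k < n)%nat).
  { intros k Hk. apply Nat.nle_gt. intros Hkn. apply le_INR in Hkn.
    generalize (zero_Cmod_gt k) PI_gt_3. nra. }
  destruct (q_zero_cases w Hw) as [E|[U|U]]; [contradiction| |].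
  - destruct (zero_is_nth z Hz w U) as [k ->]. exists k. split; [now apply A|now left].
  - destruct (zero_is_nth z Hz _ U) as [k E]. exists k. split.
    + apply A. rewrite <- E, Cmod_conj. exact L.
    + right. rewrite <- E. now rewrite Cconj_conj.
Qed.

Definition remainder (n : nat) (w : C) : C := (hreg w - polesum (zeros z n) w)%C.

Lemma Cdb_principal0 (w : C) : w <> 0 -> Cdb (fun w => - (2 / (w * w)) + 2 / (3 * w))%C w.
Proof.
  intros Nw. assert (N3 : (3 * w)%C <> 0) by (apply Cmult_neq_0; [apply RtoC_neq_0; lra|exact Nw]).
  apply Cdb_plus.
  - apply (Cdb_ext (fun w => - (1) * (2 / (w * w)))%C); [intros; ring|].
    apply Cdb_mult; [apply Cdb_const|]. apply Cdb_div; [now apply Cmult_neq_0|apply Cdb_const|].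
    apply Cdb_mult; apply Cdb_id.
  - apply Cdb_div; [exact N3|apply Cdb_const|]. apply Cdb_mult; [apply Cdb_const|apply Cdb_id].
Qed.

Lemma hreg_alt w : hreg w = (/ q w + (- (2 / (w * w)) + 2 / (3 * w)))%C.
Proof. unfold hreg. ring. Qed.

Lemma hreg_Cdb w : q w <> 0 -> Cdb hreg w.
Proof.
  intros Nq. assert (Nw : w <> 0) by (intros ->; apply Nq, q_0).
  apply (Cdb_ext (fun w => / q w + (- (2 / (w * w)) + 2 / (3 * w)))%C); [intros; symmetry; apply hreg_alt|].
  apply Cdb_plus; [apply Cdb_inv; [exact Nq|apply Cdb_q]|now apply Cdb_principal0].
Qed.

Lemma remainder_Cdb n w : q w <> 0 -> Cdb (remainder n) w.
Proof.
  intros Nq. apply Cdb_minus; [now apply hreg_Cdb|].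
  apply polesum_Cdb; [apply zeros_neq_0|]. intros H. apply Nq. now apply (zeros_q n).
Qed.

(** The singularities in the disc are 0, where [hreg] is bounded, and the listed zeros, each
    cancelled by its own entry of the list. As the list has no repetitions, the other entries stay
    bounded near that zero. *)
Lemma remainder_extends n : exists g, holo_on (cdisc 0 (2 * PI * INR n + 6)) g /\
  forall w, q w <> 0 -> g w = remainder n w.
Proof.
  apply (removable_set (remainder n) (cdisc 0 (2 * PI * INR n + 6)) (fun w => q w = 0)).
  - intros p Hp. destruct (Ceq_dec (q p) 0) as [E|Nq].
    + destruct (Ceq_dec p 0) as [->|Np].
      * exists (1 / 4). split; [lra|]. intros w Hw E0.
        replace (w - 0)%C with w in Hw by ring. assert (Q := q_near_0 w ltac:(lra)).
        rewrite E0, Cmod_0 in Q. assert (0 < Cmod w ^ 2) by (apply pow_lt; lra). lra.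
      * destruct (q_near_zero p E Np) as (d & M & Hd & H). exists d. split; [exact Hd|]. intros w Hw. now apply H.
    + destruct (Cdb_cont q p (Cdb_q p) (Cmod (q p))) as (d & Hd & H); [now apply Cmod_gt_0|].
      exists d. split; [exact Hd|]. intros w [_ Hw] E. specialize (H w Hw). rewrite E in H.
      replace (0 - q p)%C with (- q p)%C in H by ring. rewrite Cmod_opp in H. lra.
  - intros p _ Nq. now apply remainder_Cdb.
  - intros p Hp E. destruct (Ceq_dec p 0) as [->|Np].
    + destruct (Cdb_bounded (polesum (zeros z n)) 0) as (d & M & Hd & H).
      { apply polesum_Cdb; apply zeros_neq_0. }
      exists (Rmin d (1 / 4)), (32 + M). split; [apply Rmin_pos; lra|]. intros w Hw.
      pose proof (Rmin_l d (1 / 4)). pose proof (Rmin_r d (1 / 4)).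
      assert (Hw' := Hw). replace (w - 0)%C with w in Hw' by ring.
      assert (Q := q_near_0 w ltac:(lra)). assert (0 < Cmod w ^ 2) by (apply pow_lt; lra).
      assert (Nq : q w <> 0) by (apply Cmod_gt_0; lra).
      split; [now apply remainder_Cdb|]. unfold remainder. eapply Rle_trans; [apply Cmod_sub_le|].
      apply Rplus_le_compat; [apply hreg_near_0; lra|apply H; lra].
    + assert (Hin : In p (zeros z n)).
      { apply q_zeros_in_disc; [exact E|exact Np|]. unfold cdisc in Hp. replace (p - 0)%C with p in Hp by ring. exact Hp. }
      destruct (in_split _ _ Hin) as (l1 & l2 & El).
      pose proof (zeros_NoDup n) as ND. pose proof (zeros_neq_0 n) as N0. rewrite El in ND, N0.
      apply NoDup_remove_2 in ND.
      destruct (q_near_zero p E Np) as (d1 & M1 & Hd1 & H1).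
      destruct (Cdb_bounded (fun w => (- (2 / (w * w)) + 2 / (3 * w)) - (polesum l1 w + polesum l2 w))%C p)
        as (d2 & M2 & Hd2 & H2).
      { apply Cdb_minus; [now apply Cdb_principal0|].
        apply Cdb_plus; apply polesum_Cdb; intros I; [apply N0|apply ND|apply N0|apply ND];
        apply in_or_app; simpl; auto. }
      exists (Rmin d1 d2), (M1 + M2). split; [now apply Rmin_pos|]. intros w Hw.
      pose proof (Rmin_l d1 d2). pose proof (Rmin_r d1 d2).
      destruct (H1 w ltac:(lra)) as [Nq B1]. specialize (H2 w ltac:(lra)). cbv beta in H2.
      split; [now apply remainder_Cdb|].
      replace (remainder n w) with ((/ q w - pole p w) + ((- (2 / (w * w)) + 2 / (3 * w)) - (polesum l1 w + polesum l2 w)))%C.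
      * eapply Rle_trans; [apply Cmod_triangle|]. lra.
      * unfold remainder. rewrite hreg_alt, El, polesum_app. simpl. ring.
Qed.

(** When [e^(Re w)] is at least [2 r] or at most [r / 2], it cannot balance [|1 + w|], which is
    close to [r]. In between, [Re w] is small compared with the radius, so [|Im w|] is close to [r],
    where the sine is non-positive and the two terms of [Im (q w)] reinforce each other. *)
Lemma q_on_circle n w : 600 <= 2 * PI * INR n + 5 -> Cmod w = 2 * PI * INR n + 5 ->
  (2 * PI * INR n + 5) / 4 <= Cmod (q w).
Proof.
  set (r := 2 * PI * INR n + 5). intros Hr Hw.
  assert (L1 : Cmod (1 + w) <= r + 1).
  { eapply Rle_trans; [apply Cmod_triangle|]. rewrite Cmod_1. lra. }
  assert (L2 : r - 1 <= Cmod (1 + w)).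
  { generalize (Cmod_sub_ge w (- (1))). rewrite Cmod_opp, Cmod_1. replace (w - - (1))%C with (1 + w)%C by ring. lra. }
  assert (Eq : q w = (Cexp w - (1 + w))%C) by (unfold q; ring).
  assert (M := Cmod_Cexp w). pose proof (exp_pos (Re w)) as Pe.
  destruct (Rle_or_lt (2 * r) (exp (Re w))) as [A|A].
  { rewrite Eq. generalize (Cmod_sub_ge (Cexp w) (1 + w)). lra. }
  destruct (Rle_or_lt (exp (Re w)) (r / 2)) as [B|B].
  { rewrite Eq, Cmod_sub_sym. generalize (Cmod_sub_ge (1 + w) (Cexp w)). lra. }
  destruct w as [x y]. unfold Re in *; simpl fst in *.
  assert (Hx : 0 < x).
  { apply Rnot_le_lt. intros H. assert (exp x <= exp 0) by now apply exp_le. rewrite exp_0 in *. lra. }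
  (* [(x / 4)^4 <= e^x < 2 r] contradicts [x^2 >= r - 1/4] once [r] exceeds about 513; hence the
     threshold 600. *)
  assert (Hx2 : x ^ 2 < r - 1 / 4).
  { assert (E4 : (x / 4) ^ 4 <= exp x).
    { replace (exp x) with (exp (x / 4) ^ 4).
      - apply pow_incr. generalize (exp_ge_1plus (x / 4)). lra.
      - simpl. rewrite Rmult_1_r, <- !exp_plus. f_equal. field. }
    apply Rnot_le_lt. intros H.
    assert ((r - 1 / 4) * (r - 1 / 4) <= x ^ 2 * x ^ 2) by (apply Rmult_le_compat; lra).
    replace ((x / 4) ^ 4) with (x ^ 2 * x ^ 2 / 256) in E4 by field. nra. }
  assert (Ey : x ^ 2 + y ^ 2 = r ^ 2).
  { rewrite <- Hw. unfold Cmod. simpl fst; simpl snd. rewrite pow2_sqrt; [reflexivity|]. generalize (pow2_ge_0 x) (pow2_ge_0 y); lra. }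
  assert (Hy1 : Rabs y <= r).
  { rewrite <- Hw. apply (Rabs_Im_le (x, y)). }
  assert (Hy2 : r - 1 / 2 <= Rabs y).
  { apply Rnot_lt_le. intros H. rewrite <- (pow2_abs y) in Ey.
    assert (Rabs y ^ 2 <= (r - 1 / 2) ^ 2) by (apply pow_incr; generalize (Rabs_pos y); lra). lra. }
  (* [|y| - 2 PI n] lies in [[9/2, 5]], between [PI] and [2 PI], which is the reason for the offset
     5 in the radius. *)
  assert (Sa : sin (Rabs y) <= 0).
  { replace (Rabs y) with ((Rabs y - 2 * PI * INR n) + 2 * PI * INR n) by ring. rewrite sin_shift.
    generalize PI_gt_3 PI_4. unfold r in *. intros. apply sin_le_0; lra. }
  rewrite q_pair.
  assert (I : r - 1 / 2 <= Rabs (exp x * sin y - y)).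
  { destruct (Rle_or_lt 0 y) as [Py|Py].
    - rewrite Rabs_pos_eq in * by lra. rewrite Rabs_left1; nra.
    - rewrite (Rabs_left1 y) in * by lra. rewrite sin_neg in Sa. rewrite Rabs_pos_eq; nra. }
  generalize (Rabs_Im_le (exp x * cos y - 1 - x, exp x * sin y - y)). unfold Im at 1; simpl snd. lra.
Qed.

(** The modulus of the zero of index [k < n] is below [2 PI (k + 1) + 3], so the circle of radius
    [2 PI n + 5] keeps a distance of at least [2 PI (n - k - 1) + 2], more than [n - k]. *)
Lemma pole_on_circle n k w : (k < n)%nat -> Cmod w = 2 * PI * INR n + 5 ->
  Cmod (pole (z k) w) <= / ((INR k + 1) * (INR n - INR k)) /\
  Cmod (pole (Cconj (z k)) w) <= / ((INR k + 1) * (INR n - INR k)).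
Proof.
  intros Hk Hw. apply le_INR in Hk. rewrite S_INR in Hk. pose proof (pos_INR k) as Pk.
  pose proof PI_gt_3.
  assert (G : forall p, Cmod p = Cmod (z k) -> Cmod (pole p w) <= / ((INR k + 1) * (INR n - INR k))).
  { intros p Ep. pose proof (zero_Cmod_gt k) as L1. pose proof (zero_Cmod_lt k) as L2. rewrite <- Ep in *.
    assert (B1 : INR k + 1 <= Cmod p) by nra.
    assert (B2 : INR n - INR k <= Cmod (w - p)) by (generalize (Cmod_sub_ge w p); nra).
    unfold pole. rewrite Cmod_inv, Cmod_mult.
    2:{ apply Cmult_neq_0; apply Cmod_gt_0; lra. }
    apply Rinv_le_contravar; [apply Rmult_lt_0_compat; lra|]. apply Rmult_le_compat; lra. }
  split; apply G; [reflexivity|apply Cmod_conj].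
Qed.

(** A telescoping majorant for harmonic sums: the resulting [sqrt n] is cruder than a logarithm but
    still [o(n)]. *)
Lemma inv_le_sqrt_diff a : 0 <= a -> / (a + 1) <= 2 * (sqrt (a + 1) - sqrt a).
Proof.
  intros Ha. assert (P1 : 0 < sqrt (a + 1)) by (apply sqrt_lt_R0; lra). pose proof (sqrt_pos a) as P0.
  assert (E1 : sqrt (a + 1) * sqrt (a + 1) = a + 1) by (apply sqrt_sqrt; lra).
  assert (E0 : sqrt a * sqrt a = a) by (apply sqrt_sqrt; lra).
  assert (L : sqrt a <= sqrt (a + 1)) by (apply sqrt_le_1_alt; lra).
  assert (L1 : 1 <= sqrt (a + 1)) by (rewrite <- sqrt_1 at 1; apply sqrt_le_1_alt; lra).
  apply Rmult_le_reg_r with ((a + 1) * (sqrt (a + 1) + sqrt a)); [apply Rmult_lt_0_compat; lra|].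
  replace (/ (a + 1) * ((a + 1) * (sqrt (a + 1) + sqrt a))) with (sqrt (a + 1) + sqrt a) by (field; lra).
  replace (2 * (sqrt (a + 1) - sqrt a) * ((a + 1) * (sqrt (a + 1) + sqrt a)))
   with (2 * (a + 1) * (sqrt (a + 1) * sqrt (a + 1) - sqrt a * sqrt a)) by ring.
  rewrite E1, E0. replace (a + 1 - a) with 1 by ring.
  assert (sqrt (a + 1) <= a + 1) by (rewrite <- E1 at 2; nra). lra.
Qed.

(** The partial fractions [1 / ((m + 1) (n - m)) = (1 / (m + 1) + 1 / (n - m)) / (n + 1)] separate
    the two ends of the sum, and each part telescopes in square roots. At [m = n] the bound is
    [8 sqrt n / (n + 1)]. *)
Lemma polesum_on_circle n w : Cmod w = 2 * PI * INR n + 5 -> forall m, (m <= n)%nat ->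
  Cmod (polesum (zeros z m) w) <= 4 / (INR n + 1) * (sqrt (INR m) + sqrt (INR n) - sqrt (INR n - INR m)).
Proof.
  intros Hw. assert (Pn : 0 < INR n + 1) by (generalize (pos_INR n); lra).
  induction m as [|m IH]; intros Hm.
  - simpl. rewrite sqrt_0, Rminus_0_r, Cmod_0. right; ring.
  - specialize (IH ltac:(lia)). destruct (pole_on_circle n m w ltac:(lia) Hw) as [B1 B2].
    change (polesum (zeros z (S m)) w) with (pole (z m) w + (pole (Cconj (z m)) w + polesum (zeros z m) w))%C.
    eapply Rle_trans; [apply Cmod_triangle|].
    generalize (Cmod_triangle (pole (Cconj (z m)) w) (polesum (zeros z m) w)). intros T.
    rewrite S_INR. assert (Pm := pos_INR m). assert (Lm := le_INR _ _ Hm). rewrite S_INR in Lm.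
    assert (I1 := inv_le_sqrt_diff (INR m) Pm).
    assert (I2 := inv_le_sqrt_diff (INR n - (INR m + 1)) ltac:(lra)).
    replace (INR n - (INR m + 1) + 1) with (INR n - INR m) in I2 by ring.
    assert (E : / ((INR m + 1) * (INR n - INR m)) = / (INR n + 1) * (/ (INR m + 1) + / (INR n - INR m))) by (field; lra).
    rewrite E in B1, B2.
    assert (J : / (INR n + 1) * (/ (INR m + 1) + / (INR n - INR m)) <= / (INR n + 1) *
      (2 * (sqrt (INR m + 1) - sqrt (INR m)) + 2 * (sqrt (INR n - INR m) - sqrt (INR n - (INR m + 1))))).
    { apply Rmult_le_compat_l; [apply Rlt_le, Rinv_0_lt_compat, Pn|lra]. }
    unfold Rdiv in *. lra.
Qed.

(** In units of [1 / sqrt (n + 1)], the 15 consists of 4 from [1 / q], 2 and 1 from the principal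
    part at 0, and 8 from the poles. *)
Lemma remainder_on_circle n w : 600 <= 2 * PI * INR n + 5 -> Cmod w = 2 * PI * INR n + 5 ->
  q w <> 0 /\ Cmod (remainder n w) <= 15 / sqrt (INR n + 1).
Proof.
  intros Hr Hw. assert (Q := q_on_circle n w Hr Hw). assert (S := polesum_on_circle n w Hw n (Nat.le_refl n)).
  pose proof (pos_INR n) as Pn. pose proof PI_gt_3.
  set (r := 2 * PI * INR n + 5) in *.
  assert (Nq : q w <> 0) by (apply Cmod_gt_0; lra). split; [exact Nq|].
  assert (Nw : w <> 0) by (apply Cmod_gt_0; lra).
  set (t := sqrt (INR n + 1)). assert (Ht : 1 <= t) by (unfold t; rewrite <- sqrt_1 at 1; apply sqrt_le_1_alt; lra).
  assert (Et : t * t = INR n + 1) by (apply sqrt_sqrt; lra).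
  assert (St : sqrt (INR n) <= t) by (apply sqrt_le_1_alt; lra).
  assert (Hrt : t <= r) by (unfold r; nra).
  assert (It : 0 < / t) by (apply Rinv_0_lt_compat; lra).
  assert (Irt : / r <= / t) by (apply Rinv_le_contravar; lra).
  assert (Ir : 0 < / r) by (apply Rinv_0_lt_compat; lra).
  assert (B1 : Cmod (/ q w) <= 4 * / t).
  { rewrite Cmod_inv by exact Nq. apply Rle_trans with (/ (r / 4)).
    - apply Rinv_le_contravar; lra.
    - replace (/ (r / 4)) with (4 * / r) by (field; lra). lra. }
  assert (B2 : Cmod (2 / (w * w)) <= 2 * / t).
  { rewrite Cmod_div, Cmod_mult, Hw, Cmod_RtoC_pos by (try apply Cmult_neq_0; try assumption; lra).
    replace (2 / (r * r)) with (2 * / r * / r) by (field; lra).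
    assert (/ r <= 1) by (rewrite <- Rinv_1; apply Rinv_le_contravar; lra). nra. }
  assert (B3 : Cmod (2 / (3 * w)) <= / t).
  { rewrite Cmod_div, Cmod_mult, Hw, !Cmod_RtoC_pos by (try apply Cmult_neq_0; try assumption; try lra; apply RtoC_neq_0; lra).
    replace (2 / (3 * r)) with (2 / 3 * / r) by (field; lra). lra. }
  assert (B4 : Cmod (polesum (zeros z n) w) <= 8 * / t).
  { eapply Rle_trans; [exact S|]. replace (INR n - INR n) with 0 by ring. rewrite sqrt_0, <- Et.
    replace (8 * / t) with (4 / (t * t) * (2 * t)) by (field; lra).
    apply Rmult_le_compat_l; [apply Rlt_le, Rdiv_lt_0_compat; nra|lra]. }
  unfold remainder, hreg.
  eapply Rle_trans; [apply Cmod_sub_le|].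
  generalize (Cmod_triangle (/ q w - 2 / (w * w)) (2 / (3 * w))) (Cmod_sub_le (/ q w) (2 / (w * w))).
  unfold Rdiv in *. lra.
Qed.

(** Inside half the radius the Cauchy kernel [|v| / |v - w|] is at most 2, which gives a maximum
    principle up to that factor. *)
Lemma Cauchy_bound g rho r B w : holo_on (cdisc 0 r) g -> rho < r -> 2 * Cmod w < rho ->
  (forall v, Cmod v = rho -> Cmod (g v) <= B) -> Cmod (g w) <= 2 * B.
Proof.
  intros Hg Hr Hw HB. pose proof (Cmod_ge_0 w) as Pw. assert (P := PI_RGT_0).
  assert (Hw0 : Cmod (w - 0) < rho) by (replace (w - 0)%C with w by ring; lra).
  assert (E := Cauchy_formula g 0 rho r w Hg Hr Hw0).
  assert (Bg : Rdb_on (fun t => g (circ 0 rho t) * (circ 0 rho t - 0) / (circ 0 rho t - w))%C 0 (2 * PI)).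
  { intros t _. apply Rdb_kernel; [lra|exact Hw0|]. apply Rdb_mult; [|apply Rdb_circ_sub].
    apply (Rdb_comp g); [apply Hg, circ_in_disc; lra|apply Rdb_circ]. }
  assert (X := CI_bound _ 0 (2 * PI) (2 * B) two_PI_ge0 Bg).
  rewrite E, Cmod_mult, Cmod_RtoC_pos, Rminus_0_r in X by apply two_PI_ge0.
  apply Rmult_le_reg_l with (2 * PI); [lra|]. apply X. intros t _.
  assert (D : rho / 2 <= Cmod (circ 0 rho t - w)).
  { assert (D := circ_dist 0 rho w t ltac:(lra)). replace (w - 0)%C with w in D by ring. lra. }
  assert (Ec := Cmod_circ 0 rho t ltac:(lra)).
  rewrite Cmod_div, Cmod_mult, Ec by (apply Cmod_gt_0; lra).
  replace (circ 0 rho t - 0)%C with (circ 0 rho t) in Ec by ring.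
  specialize (HB _ Ec). pose proof (Cmod_ge_0 (g (circ 0 rho t))).
  apply Rmult_le_reg_r with (Cmod (circ 0 rho t - w)); [lra|].
  unfold Rdiv. rewrite Rmult_assoc, Rinv_l by lra. nra.
Qed.

(** The extended remainder is holomorphic on a disc of radius [2 PI n + 6], slightly beyond the
    contour circle, so its smallness on the circle passes to the fixed point [x]. *)
Lemma mittag_leffler x : 0 < x -> is_lim_seq (fun n => Cmod (remainder n x)) 0.
Proof.
  intros Hx. apply is_lim_seq_spec. intros eps.
  (* Three requirements on [n]: the threshold of [q_on_circle], [x] within half the radius, and
     [30 / sqrt (n + 1) < eps], for which 31 secures strictness. *)
  set (B := Rmax (Rmax 600 (2 * x)) ((31 / eps) ^ 2)).
  pose proof (Rmax_l (Rmax 600 (2 * x)) ((31 / eps) ^ 2)) as M1. fold B in M1.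
  pose proof (Rmax_r (Rmax 600 (2 * x)) ((31 / eps) ^ 2)) as M2. fold B in M2.
  pose proof (Rmax_l 600 (2 * x)) as M3. pose proof (Rmax_r 600 (2 * x)) as M4.
  pose proof (cond_pos eps) as Pe. pose proof PI_gt_3.
  destruct (nfloor_ex B ltac:(lra)) as [N0 [_ HN]]. exists (S N0). intros n Hn.
  apply le_INR in Hn. rewrite S_INR in Hn.
  rewrite Rminus_0_r, Rabs_pos_eq by apply Cmod_ge_0.
  destruct (remainder_extends n) as (g & Hg & Eg).
  assert (Nq : q x <> 0).
  { unfold q. rewrite Cexp_RtoC, <- !RtoC_minus. apply RtoC_neq_0.
    generalize (exp_ineq1 x ltac:(lra)). lra. }
  rewrite <- Eg by exact Nq.
  set (t := sqrt (INR n + 1)).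
  assert (Ht : 31 / eps <= t).
  { unfold t. rewrite <- (sqrt_pow2 (31 / eps)) by (apply Rlt_le, Rdiv_lt_0_compat; lra). apply sqrt_le_1_alt. lra. }
  assert (P31 : 0 < 31 / eps) by (apply Rdiv_lt_0_compat; lra).
  apply Rle_lt_trans with (2 * (15 / t)).
  - apply (Cauchy_bound g (2 * PI * INR n + 5) (2 * PI * INR n + 6)); [exact Hg|lra| |].
    + rewrite Cmod_RtoC_pos by lra. nra.
    + intros v Hv. destruct (remainder_on_circle n v ltac:(nra) Hv) as [Nv Bv]. now rewrite Eg.
  - apply Rmult_lt_reg_r with t; [lra|]. replace (2 * (15 / t) * t) with 30 by (field; lra).
    apply Rmult_le_compat_l with (r := eps) in Ht; [|lra].
    replace (eps * (31 / eps)) with 31 in Ht by (field; lra). lra.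
Qed.

End MittagLeffler.

(** * Continuation of the Mellin transform *)

Lemma q_real (x : R) : q x = RtoC (exp x - 1 - x).
Proof. unfold q. now rewrite Cexp_RtoC, !RtoC_minus. Qed.

Lemma q_real_ge x : 0 <= x -> x ^ 2 / 2 <= exp x - 1 - x.
Proof. intros H. generalize (exp_ge_quadratic x H). lra. Qed.

Lemma q_real_neq_0 x : 0 < x -> q x <> 0.
Proof.
  intros H. rewrite q_real. apply RtoC_neq_0. generalize (exp_ineq1 x ltac:(lra)). lra.
Qed.

(** The change of subtraction: bounded near 0 and [O(1 / x)] at infinity, so that its Mellin
    integral converges for [-1 < Re s < 0]. *)
Definition gsub (x : R) : C := (2 * (exp (- x) - 1 + x) / (x * x) + 4 / 3 * ((exp (- x) - 1) / x))%C.

(* [hreg] with its slowly decaying part [-2/x^2 + 2/(3x)] replaced by the exponentially decaying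
   [-2 e^(-x)/x^2 - (4/3) e^(-x)/x], which has the same singularity at 0 up to [O(1)]. *)
Definition kern (x : R) : C := (hreg x - gsub x)%C.

Lemma kern_alt x : 0 < x ->
  kern x = (/ q x - 2 * (exp (- x) / (x * x)) - 4 / 3 * (exp (- x) / x))%C.
Proof.
  intros Hx. assert (Nx : RtoC x <> 0) by (apply RtoC_neq_0; lra).
  assert (Nq := q_real_neq_0 x Hx).
  unfold kern, hreg, gsub. field. auto.
Qed.

Lemma exp_neg_sub1 x : 0 < x -> Cmod (exp (- x) - 1)%C <= x /\ Cmod (exp (- x) - 1)%C <= 1.
Proof.
  intros Hx. rewrite <- RtoC_minus, Cmod_R.
  assert (exp (- x) <= 1) by (rewrite <- exp_0; apply exp_le; lra).
  rewrite Rabs_left1 by lra. generalize (exp_ge_1plus (- x)) (exp_pos (- x)). lra.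
Qed.

Lemma exp_neg_sub2 x : 0 < x -> Cmod (exp (- x) - 1 + x)%C <= x * x /\ Cmod (exp (- x) - 1 + x)%C <= x.
Proof.
  intros Hx. rewrite <- RtoC_minus, <- RtoC_plus, Cmod_R.
  assert (E1 : exp (- x) <= 1) by (rewrite <- exp_0; apply exp_le; lra).
  assert (E2 := exp_ge_1plus (- x)). assert (E3 := exp_ge_1plus x).
  rewrite Rabs_pos_eq by lra. split; [|lra].
  assert (exp (- x) * (1 + x) <= 1).
  { rewrite exp_Ropp. pose proof (exp_pos x). apply Rmult_le_reg_l with (exp x); [assumption|].
    rewrite <- Rmult_assoc, Rinv_r by lra. lra. }
  apply Rmult_le_reg_r with (1 + x); [lra|]. nra.
Qed.

Lemma Cmod_exp_neg x : Cmod (exp (- x)) = exp (- x).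
Proof. apply Cmod_RtoC_pos, Rlt_le, exp_pos. Qed.

Lemma Rdb_gsub x : 0 < x -> Rdb gsub x.
Proof.
  intros Hx. assert (Nx : RtoC x <> 0) by (apply RtoC_neq_0; lra).
  assert (B1 : Rdb (fun x => exp (- x) - 1)%C x) by (apply Rdb_minus; [apply Rdb_exp_neg|apply Rdb_const]).
  apply Rdb_plus.
  - apply Rdb_div; [now apply Cmult_neq_0| |apply Rdb_mult; apply Rdb_RtoC].
    apply Rdb_mult; [apply Rdb_const|]. apply Rdb_plus; [exact B1|apply Rdb_RtoC].
  - apply Rdb_mult; [apply Rdb_const|]. apply Rdb_div; [exact Nx|exact B1|apply Rdb_RtoC].
Qed.

Lemma Rdb_hreg x : 0 < x -> Rdb (fun x => hreg x) x.
Proof.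
  intros Hx. apply (Rdb_comp hreg); [|apply Rdb_RtoC]. now apply hreg_Cdb, q_real_neq_0.
Qed.

Lemma gsub_bound x : 0 < x -> Cmod (gsub x) <= 4.
Proof.
  intros Hx. assert (Nx : RtoC x <> 0) by (apply RtoC_neq_0; lra). unfold gsub.
  eapply Rle_trans; [apply Cmod_triangle|].
  destruct (exp_neg_sub1 x Hx) as [B1 _]. destruct (exp_neg_sub2 x Hx) as [B2 _].
  rewrite Cmod_div, !Cmod_mult, (Cmod_div _ x) by (try apply Cmult_neq_0; assumption).
  rewrite (Cmod_div 4 3) by (apply RtoC_neq_0; lra). rewrite !Cmod_RtoC_pos by lra.
  assert (P : 0 < x * x) by now apply Rmult_lt_0_compat.
  assert (2 * Cmod (exp (- x) - 1 + x) / (x * x) <= 2).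
  { apply Rmult_le_reg_r with (x * x); [exact P|]. unfold Rdiv. rewrite Rmult_assoc, Rinv_l by lra. lra. }
  assert (Cmod (exp (- x) - 1) / x <= 1).
  { apply Rmult_le_reg_r with x; [exact Hx|]. unfold Rdiv. rewrite Rmult_assoc, Rinv_l by lra. lra. }
  lra.
Qed.

Lemma inv_q_le x : 0 < x -> Cmod (/ q x) <= 2 / (x * x).
Proof.
  intros Hx. assert (P : 0 < x * x) by now apply Rmult_lt_0_compat.
  rewrite Cmod_inv by now apply q_real_neq_0.
  assert (B := q_real_ge x ltac:(lra)). rewrite q_real, Cmod_RtoC_pos by (simpl in B; lra).
  replace (2 / (x * x)) with (/ (x ^ 2 / 2)) by (field; lra). apply Rinv_le_contravar; [simpl; lra|exact B].
Qed.

Lemma hreg_bound x : 0 < x <= 1 -> Cmod (hreg x) <= 70.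
Proof.
  intros Hx. destruct (Rle_or_lt x (1 / 4)) as [H|H].
  - apply Rle_trans with 32; [|lra]. apply hreg_near_0. rewrite Cmod_RtoC_pos; lra.
  - assert (Nx : RtoC x <> 0) by (apply RtoC_neq_0; lra).
    assert (N3 : RtoC 3 <> 0) by (apply RtoC_neq_0; lra).
    assert (B1 := inv_q_le x ltac:(lra)).
    assert (P : 0 < x * x) by (apply Rmult_lt_0_compat; lra).
    assert (B2 : 2 / (x * x) <= 32).
    { apply Rmult_le_reg_r with (x * x); [exact P|]. unfold Rdiv. rewrite Rmult_assoc, Rinv_l by lra. nra. }
    assert (B3 : 2 / (3 * x) <= 3).
    { apply Rmult_le_reg_r with (3 * x); [lra|]. unfold Rdiv. rewrite Rmult_assoc, Rinv_l by lra. lra. }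
    unfold hreg. eapply Rle_trans; [apply Cmod_triangle|].
    generalize (Cmod_sub_le (/ q x) (2 / (x * x))).
    rewrite !Cmod_div, !Cmod_mult, !Cmod_RtoC_pos by (try apply Cmult_neq_0; try assumption; lra). lra.
Qed.

(** Boundedness at 0 and decay faster than any power make the Mellin transform holomorphic on all of
    [Re s > -1], beyond the points 0 and 1. In the constant, 80 covers [70 + 4] near 0, and 9 is
    [5 + 2 + 2] for the three exponentially small terms. *)
Lemma Dom_kern n : exists c, Dom kern c 0 (- INR n).
Proof.
  destruct (Dom_exp n) as [c HD]. pose proof (Dom_const_ge0 _ _ _ _ HD) as Hc.
  destruct HD as (_ & _ & D1). exists (80 + 9 * c). split; [|split].
  - intros x Hx. apply Rdb_minus; [now apply Rdb_hreg|now apply Rdb_gsub].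
  - intros x Hx. rewrite Rpower_O by lra. unfold kern. eapply Rle_trans; [apply Cmod_sub_le|].
    generalize (hreg_bound x Hx) (gsub_bound x ltac:(lra)). lra.
  - intros x Hx. assert (D := D1 x Hx). rewrite Cmod_exp_neg in D.
    assert (Nx : RtoC x <> 0) by (apply RtoC_neq_0; lra).
    rewrite kern_alt by lra. set (e := exp (- x)) in *. assert (Pe : 0 < e) by apply exp_pos.
    assert (B1 : Cmod (/ q x) <= 5 * e).
    { rewrite Cmod_inv by (apply q_real_neq_0; lra).
      assert (A := exp_ge_quadratic x ltac:(lra)). assert (P := exp_pos x).
      assert (L : exp x / 5 <= exp x - 1 - x) by (assert (0 <= (2 * x + 1) * (x - 1)) by (apply Rmult_le_pos; lra); lra).
      rewrite q_real, Cmod_RtoC_pos by lra. unfold e. rewrite exp_Ropp.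
      replace (5 * / exp x) with (/ (exp x / 5)) by (field; lra). apply Rinv_le_contravar; lra. }
    assert (B2 : Cmod (2 * (e / (x * x))) <= 2 * e).
    { rewrite Cmod_mult, Cmod_div, Cmod_mult, !Cmod_RtoC_pos by (try apply Cmult_neq_0; try assumption; lra).
      assert (X2 : 1 <= x * x) by nra.
      apply Rmult_le_compat_l; [lra|]. apply Rmult_le_reg_r with (x * x); [lra|].
      unfold Rdiv. rewrite Rmult_assoc, Rinv_l by lra. apply Rmult_le_compat_l; lra. }
    assert (B3 : Cmod (4 / 3 * (e / x)) <= 2 * e).
    { rewrite Cmod_mult, !Cmod_div, !Cmod_RtoC_pos by (try assumption; try lra; apply RtoC_neq_0; lra).
      assert (e / x <= e); [|assert (0 < e / x) by (apply Rdiv_lt_0_compat; lra); lra].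
      apply Rmult_le_reg_r with x; [lra|]. unfold Rdiv. rewrite Rmult_assoc, Rinv_l by lra. nra. }
    assert (0 <= Rpower x (- INR n)) by apply Rlt_le, Rpower_pos.
    apply Rle_trans with (9 * e).
    + eapply Rle_trans; [apply Cmod_sub_le|]. generalize (Cmod_sub_le (/ q x) (2 * (e / (x * x)))). lra.
    + nra.
Qed.

Lemma kern_Imp s : -1 < Re s -> Imp (fun x => RCpower x s * kern x)%C (mellin kern s).
Proof.
  intros Hs. destruct (nfloor_ex (Rmax 0 (Re s + 1))) as [n [_ Hn]]; [apply Rmax_l|].
  pose proof (Rmax_r 0 (Re s + 1)). destruct (Dom_kern (S n)) as [c HD].
  apply (mellin_Imp _ c 0 (- INR (S n))); [exact HD|lra|]. rewrite S_INR. lra.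
Qed.

Lemma kern_holo s : -1 < Re s -> Cdb (mellin kern) s.
Proof.
  intros Hs. destruct (nfloor_ex (Rmax 0 (Re s + 1))) as [n [_ Hn]]; [apply Rmax_l|].
  pose proof (Rmax_r 0 (Re s + 1)). destruct (Dom_kern (S n)) as [c HD].
  apply (mellin_holo _ c 0 (- INR (S n))); [exact HD|lra|]. rewrite S_INR. lra.
Qed.

(** The Mellin transform of the exponential terms [2 e^(-x) / x^2 + (4/3) e^(-x) / x], divided by
    [Gm s], by means of [Gamma(s - 1) = Gamma(s + 1) / (s (s - 1))] and
    [Gamma(s) = Gamma(s + 1) / s]. *)
Definition polar_part (s : C) : C := (2 / (s * (s - 1)) + 4 / 3 / s)%C.

Lemma Re_neq (s : C) (r : R) : Re s <> r -> s <> RtoC r.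
Proof. intros H E. apply H. rewrite E. reflexivity. Qed.

Lemma sub1_neq (s : C) : s <> 1 -> (s - 1)%C <> 0.
Proof. intros H E. apply H, Ceq_minus, E. Qed.

Lemma zeta2_integral_kern s : 1 < Re s ->
  (Gm s * zeta2_integral s = mellin kern s + Gm s * polar_part s)%C.
Proof.
  intros Hs. unfold zeta2_integral. rewrite Gm_CGamma1.
  assert (N : Gm s <> 0) by (apply Gm_neq_0; lra).
  assert (E1 := Gm_rec s ltac:(lra)).
  assert (E2 := Gm_rec (s - 1) ltac:(rewrite Re_sub1; lra)).
  assert (I1 := kern_Imp s ltac:(lra)).
  assert (I2 := Gm_Imp (s - 1) ltac:(rewrite Re_sub1; lra)).
  assert (I3 := Gm_Imp (s - 1 - 1) ltac:(rewrite !Re_sub1; lra)).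
  assert (J := Imp_plus _ _ _ _ (Imp_plus _ _ _ _ I1 (Imp_scal 2 _ _ I3)) (Imp_scal (4 / 3) _ _ I2)).
  cbv beta in J.
  assert (JJ : Imp (fun x => RCpower x s / RtoC (exp x - 1 - x))%C
      (mellin kern s + 2 * Gm (s - 1 - 1) + 4 / 3 * Gm (s - 1))%C).
  { refine (Imp_ext _ _ _ _ J). intros x Hx. cbv beta.
    assert (Nx : RtoC x <> 0) by (apply RtoC_neq_0; lra).
    assert (Nq := q_real_neq_0 x Hx). rewrite <- q_real, kern_alt, !RCpower_sub1 by exact Hx.
    field. auto. }
  rewrite (Imp_CInt _ _ JJ).
  assert (N0 : s <> 0) by (apply Re_neq; lra).
  assert (N1 := sub1_neq s (Re_neq s 1 ltac:(lra))).
  replace (Gm s * (/ Gm s * (mellin kern s + 2 * Gm (s - 1 - 1) + 4 / 3 * Gm (s - 1))))%C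
    with (mellin kern s + 2 * Gm (s - 1 - 1) + 4 / 3 * Gm (s - 1))%C by (field; exact N).
  unfold polar_part. rewrite E1, E2. field. auto.
Qed.

(** To the left of its first poles Gamma is represented by integrals of [e^(-x)] minus leading
    Taylor terms (Cauchy-Saalschutz). Two integrations by parts therefore give for [gsub] the same
    polar part as on the right, so that adding it to the transform of [kern] restores [hreg]. *)
Lemma gsub_Imp s : -1 < Re s < 0 -> Imp (fun x => RCpower x s * gsub x)%C (Gm s * polar_part s)%C.
Proof.
  intros Hs.
  assert (N0 : s <> 0) by (apply Re_neq; lra).
  assert (N1 := sub1_neq s (Re_neq s 1 ltac:(lra))).
  assert (I0 := Gm_Imp s ltac:(lra)).
  assert (B1 : forall x, 0 < x -> Rdb (fun x => exp (- x) - 1)%C x).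
  { intros x _. apply Rdb_minus; [apply Rdb_exp_neg|apply Rdb_const]. }
  assert (B2 : forall x, 0 < x -> Rdb (fun x => exp (- x) - 1 + x)%C x).
  { intros x Hx. apply Rdb_plus; [now apply B1|apply Rdb_RtoC]. }
  assert (D1 : forall x, 0 < x -> Rder (fun x => exp (- x) - 1)%C x (- exp (- x) - 0)%C).
  { intros x _. apply Der_minus; [apply Rder_exp_neg|apply Der_const]. }
  assert (A1 : Imp (fun x => s * (RCpower x (s - 1) * (exp (- x) - 1)) - RCpower x s * exp (- x))%C 0).
  { apply (Imp_FTC_zero (fun x => RCpower x s * (exp (- x) - 1))%C _ 1 (Re s + 1) (Re s)); [|lra|lra| |].
    - split; [|split].
      + intros x Hx. apply Rdb_mult; [now apply Rdb_RCpower|now apply B1].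
      + intros x Hx. rewrite Cmod_mult, Cmod_RCpower, Rpower_plus, Rpower_1, Rmult_1_l by lra.
        apply Rmult_le_compat_l; [apply Rlt_le, Rpower_pos|]. apply exp_neg_sub1; lra.
      + intros x Hx. rewrite Cmod_mult, Cmod_RCpower, Rmult_comm.
        apply Rmult_le_compat_r; [apply Rlt_le, Rpower_pos|]. apply exp_neg_sub1; lra.
    - intros x Hx.
      replace (s * (RCpower x (s - 1) * (exp (- x) - 1)) - RCpower x s * exp (- x))%C with
       (s * RCpower x (s - 1) * (exp (- x) - 1) + RCpower x s * (- exp (- x) - 0))%C by ring.
      apply (Der_mult _ _ (fun x => RCpower x s) (fun x => exp (- x) - 1)%C); [now apply Rder_RCpower|now apply D1].
    - intros x Hx. apply Rdb_minus; [|apply Rdb_mult; [now apply Rdb_RCpower|apply Rdb_exp_neg]].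
      apply Rdb_mult; [apply Rdb_const|]. apply Rdb_mult; [now apply Rdb_RCpower|now apply B1]. }
  assert (A2 : Imp (fun x => (s - 1) * (RCpower x (s - 1 - 1) * (exp (- x) - 1 + x)) - RCpower x (s - 1) * (exp (- x) - 1))%C 0).
  { apply (Imp_FTC_zero (fun x => RCpower x (s - 1) * (exp (- x) - 1 + x))%C _ 1 (Re s + 1) (Re s)); [|lra|lra| |].
    - split; [|split].
      + intros x Hx. apply Rdb_mult; [now apply Rdb_RCpower|now apply B2].
      + intros x Hx. rewrite Cmod_mult, Cmod_RCpower, Re_sub1, Rmult_1_l.
        replace (Re s + 1) with (Re s - 1 + (1 + 1)) by ring. rewrite (Rpower_plus (Re s - 1)), (Rpower_plus 1), Rpower_1 by lra.
        apply Rmult_le_compat_l; [apply Rlt_le, Rpower_pos|]. apply exp_neg_sub2; lra.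
      + intros x Hx. rewrite Cmod_mult, Cmod_RCpower, Re_sub1, Rmult_1_l.
        replace (Rpower x (Re s)) with (Rpower x (Re s - 1) * x).
        2:{ rewrite <- (Rpower_1 x) at 2 by lra. rewrite <- Rpower_plus. f_equal; ring. }
        apply Rmult_le_compat_l; [apply Rlt_le, Rpower_pos|]. apply exp_neg_sub2; lra.
    - intros x Hx.
      replace ((s - 1) * (RCpower x (s - 1 - 1) * (exp (- x) - 1 + x)) - RCpower x (s - 1) * (exp (- x) - 1))%C with
       ((s - 1) * RCpower x (s - 1 - 1) * (exp (- x) - 1 + x) + RCpower x (s - 1) * (- exp (- x) - 0 + 1))%C by ring.
      apply (Der_mult _ _ (fun x => RCpower x (s - 1)) (fun x => exp (- x) - 1 + x)%C); [now apply Rder_RCpower|].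
      apply Der_plus; [now apply D1|apply Rder_id].
    - intros x Hx. apply Rdb_minus; [|apply Rdb_mult; [now apply Rdb_RCpower|now apply B1]].
      apply Rdb_mult; [apply Rdb_const|]. apply Rdb_mult; [now apply Rdb_RCpower|now apply B2]. }
  assert (C1 : Imp (fun x => RCpower x (s - 1) * (exp (- x) - 1))%C (Gm s / s)%C).
  { replace (Gm s / s)%C with (/ s * (0 + Gm s))%C by (field; exact N0).
    refine (Imp_ext _ _ _ _ (Imp_scal (/ s) _ _ (Imp_plus _ _ _ _ A1 I0))).
    intros x Hx. cbv beta. field. exact N0. }
  assert (C2 : Imp (fun x => RCpower x (s - 1 - 1) * (exp (- x) - 1 + x))%C (Gm s / (s * (s - 1)))%C).
  { replace (Gm s / (s * (s - 1)))%C with (/ (s - 1) * (0 + Gm s / s))%C by (field; auto).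
    refine (Imp_ext _ _ _ _ (Imp_scal (/ (s - 1)) _ _ (Imp_plus _ _ _ _ A2 C1))).
    intros x Hx. cbv beta. field. exact N1. }
  replace (Gm s * polar_part s)%C with (2 * (Gm s / (s * (s - 1))) + 4 / 3 * (Gm s / s))%C
    by (unfold polar_part; field; auto).
  refine (Imp_ext _ _ _ _ (Imp_plus _ _ _ _ (Imp_scal 2 _ _ C2) (Imp_scal (4 / 3) _ _ C1))).
  intros x Hx. cbv beta. unfold gsub. rewrite !RCpower_sub1 by exact Hx. field. apply RtoC_neq_0; lra.
Qed.

Lemma is_zeta2_Cdb (zeta2 : C -> C) (s : C) : is_zeta2 zeta2 -> s <> 0 -> s <> 1 -> Cdb zeta2 s.
Proof.
  intros H N0 N1. assert (A := zeta2_holomorphic _ H s N0 N1).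
  apply locally_singleton in A. destruct A as [l Hl]. exists l. now apply Cder_is_derive.
Qed.

Lemma polar_part_Cdb (s : C) : s <> 0 -> s <> 1 -> Cdb polar_part s.
Proof.
  intros N0 N1. apply Cdb_plus.
  - apply Cdb_div; [apply Cmult_neq_0; [exact N0|now apply sub1_neq]|apply Cdb_const|].
    apply Cdb_mult; [apply Cdb_id|]. apply Cdb_minus; [apply Cdb_id|apply Cdb_const].
  - apply Cdb_div; [exact N0|apply Cdb_const|apply Cdb_id].
Qed.

Lemma cdisc_Re_Im (c : C) (r : R) (w : C) : cdisc c r w -> Rabs (Re w - Re c) < r /\ Rabs (Im w - Im c) < r.
Proof.
  intros H. split; (eapply Rle_lt_trans; [|exact H]).
  - apply (Rabs_Re_le (w - c)).
  - apply (Rabs_Im_le (w - c)).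
Qed.

Lemma neq_of_Re_Im (w : C) (x : R) : (Re w <> x \/ Im w <> 0) -> w <> RtoC x.
Proof. intros [H|H] E; apply H; rewrite E; reflexivity. Qed.

Lemma real_accum (a : R) (f : C -> C) : (forall s, cdisc a 1 s -> f s = 0) ->
  forall d, 0 < d -> exists w, w <> RtoC a /\ Cmod (w - a) < d /\ f w = 0.
Proof.
  intros H d Hd. set (x := Rmin d 1 / 2).
  pose proof (Rmin_l d 1). pose proof (Rmin_r d 1). pose proof (Rmin_pos d 1 Hd Rlt_0_1).
  exists (RtoC a + RtoC x)%C. assert (E : (RtoC a + RtoC x - RtoC a = RtoC x)%C) by ring.
  assert (Px : 0 < x) by (unfold x; lra).
  split; [|split].
  - rewrite <- RtoC_plus. intros Q. apply RtoC_inj in Q. lra.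
  - rewrite E, Cmod_RtoC_pos; unfold x in *; lra.
  - apply H. unfold cdisc. rewrite E, Cmod_RtoC_pos; unfold x in *; lra.
Qed.

(* Continuation from 2 to -3/4 along the broken line through 1/2 + i, which avoids the poles 0 and 1. *)
Lemma zeta2_continuation zeta2 : is_zeta2 zeta2 -> forall s, cdisc (RtoC (- (3 / 4))) (1 / 8) s ->
  (Gm s * zeta2 s = mellin kern s + Gm s * polar_part s)%C.
Proof.
  intros H.
  set (f := fun s => (Gm s * zeta2 s - (mellin kern s + Gm s * polar_part s))%C).
  assert (Hf : forall s, -1 < Re s -> s <> 0 -> s <> 1 -> Cdb f s).
  { intros s Hs N0 N1. assert (G := Gm_holo s Hs).
    apply Cdb_minus; [apply Cdb_mult; [exact G|now apply is_zeta2_Cdb]|].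
    apply Cdb_plus; [now apply kern_holo|]. apply Cdb_mult; [exact G|now apply polar_part_Cdb]. }
  assert (Z2 := real_accum 2 f).
  assert (Z2' : forall s, cdisc 2 1 s -> f s = 0).
  { intros s Hs. assert (R1 : 1 < Re s).
    { destruct (cdisc_Re_Im _ _ _ Hs) as [A _]. apply Rabs_def2 in A. rewrite re_RtoC in A. lra. }
    unfold f. rewrite (zeta2_eq_integral _ H) by exact R1. rewrite zeta2_integral_kern by exact R1. ring. }
  specialize (Z2 Z2').
  set (m := (1 / 2, 1) : C).
  assert (Zm := identity_segment_disc f 2 m (1 / 8) ltac:(lra)).
  assert (Zm' : forall d, 0 < d -> exists w, w <> m /\ Cmod (w - m) < d /\ f w = 0).
  { apply Zm; [|exact Z2]. intros t Ht w Hw.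
    destruct (cdisc_Re_Im _ _ _ Hw) as [A B]. apply Rabs_def2 in A, B.
    replace (Re (2 + t * (m - 2))%C) with (2 + t * (1 / 2 - 2)) in A by (unfold m, Re; simpl; ring).
    replace (Im (2 + t * (m - 2))%C) with t in B by (unfold m, Im; simpl; ring).
    apply Hf; [lra| |]; apply neq_of_Re_Im.
    - left; lra.
    (* Up to [t = 1/4] the disc lies to the right of 1; beyond that it lies above the real axis. *)
    - destruct (Rle_or_lt t (1 / 4)); [left; lra|right; lra]. }
  intros s Hs. apply Ceq_minus. change (f s = 0).
  apply (identity_segment f m (RtoC (- (3 / 4))) (1 / 8)); [lra| |exact Zm'|exact Hs].
  intros t Ht w Hw.
  destruct (cdisc_Re_Im _ _ _ Hw) as [A B]. apply Rabs_def2 in A, B.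
  replace (Re (m + t * (RtoC (- (3 / 4)) - m))%C) with (1 / 2 - t * (5 / 4)) in A by (unfold m, Re; simpl; field).
  replace (Im (m + t * (RtoC (- (3 / 4)) - m))%C) with (1 - t) in B by (unfold m, Im; simpl; ring).
  apply Hf; [lra| |]; apply neq_of_Re_Im.
  - destruct (Rle_or_lt t (3 / 4)); [right; lra|left; lra].
  - left; lra.
Qed.

(** On this disc [Re s] lies in [(-7/8, -5/8)], within the strip [(-1, -1/2)] in which the tail of
    the pole expansion can be integrated. *)
Lemma zeta2_hreg zeta2 : is_zeta2 zeta2 -> forall s, cdisc (RtoC (- (3 / 4))) (1 / 8) s ->
  Imp (fun x => RCpower x s * hreg x)%C (Gm s * zeta2 s)%C.
Proof.
  intros H s Hs. destruct (cdisc_Re_Im _ _ _ Hs) as [A _]. apply Rabs_def2 in A. rewrite re_RtoC in A.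
  rewrite (zeta2_continuation zeta2 H s Hs).
  refine (Imp_ext _ _ _ _ (Imp_plus _ _ _ _ (kern_Imp s ltac:(lra)) (gsub_Imp s ltac:(lra)))).
  intros x _. cbv beta. unfold kern. ring.
Qed.

(** * Termwise integration and the bound *)

Fixpoint csum (a : nat -> C) (n : nat) : C :=
  match n with O => RtoC 0 | S n => (csum a n + a n)%C end.

Definition Clim (u : nat -> C) (l : C) : Prop :=
  is_lim_seq (fun n => Re (u n)) (Re l) /\ is_lim_seq (fun n => Im (u n)) (Im l).

Lemma Clim_unique u l m : Clim u l -> Clim u m -> l = m.
Proof.
  intros [H1 H2] [K1 K2]. apply is_lim_seq_unique in H1, H2, K1, K2.
  rewrite H1 in K1. rewrite H2 in K2. injection K1 as E1. injection K2 as E2.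
  destruct l, m. unfold Re, Im in *. simpl in *. now subst.
Qed.

Lemma Clim_plus u v l m : Clim u l -> Clim v m -> Clim (fun n => u n + v n)%C (l + m)%C.
Proof.
  intros [H1 H2] [K1 K2]. split.
  - exact (is_lim_seq_plus' _ _ _ _ H1 K1).
  - exact (is_lim_seq_plus' _ _ _ _ H2 K2).
Qed.

Lemma Clim_const l : Clim (fun _ => l) l.
Proof. split; apply is_lim_seq_const. Qed.

Lemma Clim_scal c u l : Clim u l -> Clim (fun n => c * u n)%C (c * l)%C.
Proof.
  intros [H1 H2]. split.
  - apply (is_lim_seq_minus' (fun n => fst c * Re (u n)) (fun n => snd c * Im (u n)) (fst c * Re l) (snd c * Im l)).
    + exact (is_lim_seq_scal_l _ (fst c) _ H1).
    + exact (is_lim_seq_scal_l _ (snd c) _ H2).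
  - apply (is_lim_seq_plus' (fun n => fst c * Im (u n)) (fun n => snd c * Re (u n)) (fst c * Im l) (snd c * Re l)).
    + exact (is_lim_seq_scal_l _ (fst c) _ H2).
    + exact (is_lim_seq_scal_l _ (snd c) _ H1).
Qed.

Lemma Clim_ext u v l : (forall n, u n = v n) -> Clim u l -> Clim v l.
Proof.
  intros E [H1 H2]. split.
  - refine (is_lim_seq_ext _ _ _ _ H1). intros n; now rewrite E.
  - refine (is_lim_seq_ext _ _ _ _ H2). intros n; now rewrite E.
Qed.

(** The bound is taken from index 1 on because the tail estimates divide by [sqrt n]. *)
Lemma Clim_zero_of_bound u l e : Clim u l -> (forall n, Cmod (u (S n)) <= e n) -> is_lim_seq e 0 -> l = 0.
Proof.
  intros [H1 H2] B He. apply Cmod_eq_0, Rle_antisym; [|apply Cmod_ge_0].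
  apply Rnot_lt_le. intros P. apply is_lim_seq_spec in He.
  destruct (He (mkposreal (Cmod l / 2) ltac:(lra))) as [N0 HN]. simpl in HN.
  assert (X : Cmod (l - 0) <= Cmod l / 2).
  { apply (Cmod_dist_lim u); [exact H1|exact H2|]. exists (S N0). intros n Hn.
    destruct n as [|n]; [lia|]. replace (u (S n) - 0)%C with (u (S n)) by ring.
    eapply Rle_trans; [apply B|]. specialize (HN n ltac:(lia)). rewrite Rminus_0_r in HN.
    generalize (Rle_abs (e n)). lra. }
  replace (l - 0)%C with l in X by ring. lra.
Qed.

Definition CSeries (a : nat -> C) : C := (Series (fun n => Re (a n)), Series (fun n => Im (a n))).

(** [csum] runs over the indices below its argument and [sum_n] includes it, hence the shift by
    one. *)
Lemma csum_sum_n a n : csum a (S n) = (sum_n (fun k => Re (a k)) n, sum_n (fun k => Im (a k)) n).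
Proof.
  induction n as [|n IH].
  - rewrite !sum_O. simpl. destruct (a 0%nat). unfold Cplus, RtoC, Re, Im; simpl. f_equal; ring.
  - change (csum a (S (S n))) with (csum a (S n) + a (S n))%C. rewrite IH, !sum_Sn.
    unfold Cplus; simpl. f_equal.
Qed.

Lemma CSeries_correct a b : (forall k, Cmod (a k) <= b k) -> ex_series b ->
  Clim (csum a) (CSeries a) /\ Cmod (CSeries a) <= Series b.
Proof.
  intros H Hb.
  assert (X1 : ex_series (fun n => Re (a n))).
  { apply (ex_series_le (V := R_CompleteNormedModule) _ b); [|exact Hb]. intros n.
    eapply Rle_trans; [apply (Rabs_Re_le (a n))|apply H]. }
  assert (X2 : ex_series (fun n => Im (a n))).
  { apply (ex_series_le (V := R_CompleteNormedModule) _ b); [|exact Hb]. intros n.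
    eapply Rle_trans; [apply (Rabs_Im_le (a n))|apply H]. }
  assert (L : Clim (csum a) (CSeries a)).
  { split; apply is_lim_seq_incr_1.
    - apply (is_lim_seq_ext (sum_n (fun k => Re (a k)))); [intros n; now rewrite csum_sum_n|exact (Series_correct _ X1)].
    - apply (is_lim_seq_ext (sum_n (fun k => Im (a k)))); [intros n; now rewrite csum_sum_n|exact (Series_correct _ X2)]. }
  split; [exact L|].
  assert (Pb : forall n, 0 <= b n) by (intros n; eapply Rle_trans; [apply Cmod_ge_0|apply H]).
  assert (Bs : forall n, Cmod (csum a (S n)) <= sum_n b n).
  { induction n as [|n IH].
    - rewrite sum_O. simpl. rewrite Cplus_0_l. apply H.
    - change (csum a (S (S n))) with (csum a (S n) + a (S n))%C. rewrite sum_Sn.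
      eapply Rle_trans; [apply Cmod_triangle|]. apply Rplus_le_compat; [exact IH|apply H]. }
  assert (Bt : forall n, sum_n b n <= Series b).
  { intros n. apply (is_lim_seq_incr_compare (sum_n b)).
    - exact (Series_correct _ Hb).
    - intros m. rewrite sum_Sn. specialize (Pb (S m)). unfold plus; simpl. lra. }
  replace (CSeries a) with (CSeries a - 0)%C by ring.
  apply (Cmod_dist_lim (csum a)); [apply L|apply L|].
  exists 1%nat. intros [|n] Hn; [lia|]. replace (csum a (S n) - 0)%C with (csum a (S n)) by ring.
  eapply Rle_trans; [apply Bs|apply Bt].
Qed.

Lemma csum_plus a b n : csum (fun k => a k + b k)%C n = (csum a n + csum b n)%C.
Proof. induction n as [|n IH]; simpl; [ring|rewrite IH; ring]. Qed.

Lemma csum_scal c a n : csum (fun k => c * a k)%C n = (c * csum a n)%C.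
Proof. induction n as [|n IH]; simpl; [ring|rewrite IH; ring]. Qed.

(** With [e = ln (k + 1) - ln k >= 1 / (k + 1)] one has [k^(1-p) = (k + 1)^(1-p) exp ((p - 1) e)],
    and the exponential is at least [1 + (p - 1) e]. *)
Lemma inv_power_telescope k p : 1 < p -> 0 < k ->
  / Rpower (k + 1) p <= / (p - 1) * (Rpower k (1 - p) - Rpower (k + 1) (1 - p)).
Proof.
  intros Hp Hk. set (e := ln (k + 1) - ln k).
  assert (He : / (k + 1) <= e).
  { assert (A := exp_ge_1plus (- e)). unfold e in *.
    replace (- (ln (k + 1) - ln k)) with (ln k + - ln (k + 1)) in A by ring.
    rewrite exp_plus, exp_Ropp, !exp_ln in A by lra.
    assert (k * / (k + 1) = 1 - / (k + 1)) by (field; lra). lra. }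
  assert (E : Rpower k (1 - p) = Rpower (k + 1) (1 - p) * exp ((p - 1) * e)).
  { unfold Rpower, e. rewrite <- exp_plus. f_equal. ring. }
  assert (B := exp_ge_1plus ((p - 1) * e)). pose proof (Rpower_pos (k + 1) (1 - p)) as P.
  assert (E2 : / Rpower (k + 1) p = Rpower (k + 1) (1 - p) * / (k + 1)).
  { unfold Rminus. rewrite Rpower_plus, Rpower_1, Rpower_Ropp by lra. field. split; [lra|apply Rgt_not_eq, Rpower_pos]. }
  rewrite E2, E. apply Rmult_le_reg_l with (p - 1); [lra|].
  rewrite <- (Rmult_assoc (p - 1) (/ (p - 1))), Rinv_r, Rmult_1_l by lra.
  apply Rle_trans with (Rpower (k + 1) (1 - p) * ((p - 1) * e)).
  - rewrite <- Rmult_assoc, (Rmult_comm (p - 1)), Rmult_assoc. apply Rmult_le_compat_l; [lra|].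
    apply Rmult_le_compat_l; lra.
  - nra.
Qed.

Lemma ex_series_inv_power p : 1 < p -> ex_series (fun n => / Rpower (INR (S n)) p).
Proof.
  intros Hp. assert (Pos : forall n, 0 < / Rpower (INR (S n)) p) by (intros; apply Rinv_0_lt_compat, Rpower_pos).
  assert (B : forall n, sum_n (fun n => / Rpower (INR (S n)) p) n <= 1 + / (p - 1) * (1 - Rpower (INR (S n)) (1 - p))).
  { induction n as [|n IH].
    - rewrite sum_O. simpl. rewrite !Rpower_1_base. lra.
    - rewrite sum_Sn. change plus with Rplus.
      assert (T := inv_power_telescope (INR (S n)) p Hp (lt_0_INR _ (Nat.lt_0_succ n))).
      rewrite (S_INR (S n)). eapply Rle_trans; [apply Rplus_le_compat; [exact IH|exact T]|]. right; ring. }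
  destruct (ex_finite_lim_seq_incr (sum_n (fun n => / Rpower (INR (S n)) p)) (1 + / (p - 1))) as [l Hl].
  - intros n. rewrite sum_Sn. specialize (Pos (S n)). change plus with Rplus. lra.
  - intros n. eapply Rle_trans; [apply B|]. assert (0 < / (p - 1)) by (apply Rinv_0_lt_compat; lra).
    pose proof (Rpower_pos (INR (S n)) (1 - p)). nra.
  - exists l. exact Hl.
Qed.

Section Final.
Context (z : nat -> C) (Hz : forall k, upper_zero (z k) /\ in_strip k (z k)).

(** The sum [(- z_k)^(s-1) + (- conj z_k)^(s-1)], each branch being fixed by its logarithm; the
    conjugate logarithms have opposite arguments, both below [PI] in absolute value. *)
Definition zterm (s : C) (k : nat) : C :=
  (Cexp ((s - 1) * log_neg (z k)) + Cexp ((s - 1) * Cconj (log_neg (z k))))%C.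

Definition zsum (s : C) : C := CSeries (zterm s).

Lemma log_neg_props k : 1 <= ln (Cmod (z k)) /\ INR (S k) <= Cmod (z k) /\
  Re (log_neg (z k)) = ln (Cmod (z k)) /\ - PI < Im (log_neg (z k)) < 0.
Proof.
  pose proof (zero_Cmod_gt z Hz k) as L. pose proof PI_gt_3. pose proof (pos_INR k).
  destruct (zero_re_gt z Hz k) as [Hr _]. pose proof (zero_im_pos z Hz k) as Hi.
  destruct (log_neg_im (z k) Hr Hi) as [E B].
  assert (R1 : 3 <= Cmod (z k)) by nra.
  split; [|split; [rewrite S_INR; nra|split; [reflexivity|rewrite E; lra]]].
  rewrite <- (ln_exp 1). apply ln_le; [apply exp_pos|]. generalize exp_le_3. lra.
Qed.

(* A common shape of the logarithms [log_neg (z k)] and their conjugates. *)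
Definition log_like (k : nat) (l : C) : Prop :=
  1 <= Re l /\ INR (S k) <= exp (Re l) /\ Rabs (Im l) <= 4.

Lemma log_like_z k : log_like k (log_neg (z k)) /\ log_like k (Cconj (log_neg (z k))).
Proof.
  destruct (log_neg_props k) as (A & B & E & D). pose proof PI_4.
  assert (P : 0 < Cmod (z k)) by (generalize (lt_0_INR _ (Nat.lt_0_succ k)); lra).
  assert (Ex : exp (ln (Cmod (z k))) = Cmod (z k)) by now apply exp_ln.
  assert (Ec : Re (Cconj (log_neg (z k))) = Re (log_neg (z k))) by reflexivity.
  split; unfold log_like; rewrite ?Ec, ?Im_conj, ?Rabs_Ropp, E, Ex; repeat split; try lra; apply Rabs_le; lra.
Qed.

(** The factor [exp (c * Re l)] sets aside part of the decay in [k]; it pays for the powers of [l]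
    that differentiation in [s] produces. *)
Lemma log_like_exp k l s p c : log_like k l -> p < 0 -> 0 <= c -> Re s - 1 + c = p ->
  exp (c * Re l) * Cmod (Cexp ((s - 1) * l)) <= exp (4 * Rabs (Im s)) * / Rpower (INR (S k)) (- p).
Proof.
  intros (A & B & D) Hp Hc Ep. rewrite Cmod_Cexp, <- exp_plus.
  assert (Pk : 0 < INR (S k)) by (apply lt_0_INR; lia).
  assert (E : / Rpower (INR (S k)) (- p) = exp (p * ln (INR (S k)))).
  { rewrite <- Rpower_Ropp, Ropp_involutive. reflexivity. }
  rewrite E, <- exp_plus. apply exp_le.
  replace (Re ((s - 1) * l)) with ((Re s - 1) * Re l - Im s * Im l) by (unfold Re, Im; simpl; ring).
  assert (L : ln (INR (S k)) <= Re l).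
  { rewrite <- (ln_exp (Re l)). now apply ln_le. }
  assert (I : - (Im s * Im l) <= 4 * Rabs (Im s)).
  { eapply Rle_trans; [apply Rle_abs|]. rewrite Rabs_Ropp, Rabs_mult. pose proof (Rabs_pos (Im s)). nra. }
  assert (p * Re l <= p * ln (INR (S k))) by nra.
  replace (c * Re l + ((Re s - 1) * Re l - Im s * Im l)) with ((Re s - 1 + c) * Re l + - (Im s * Im l)) by ring.
  rewrite Ep. lra.
Qed.

Lemma log_like_Cmod k l : log_like k l -> Cmod l <= 5 * Re l.
Proof.
  intros (A & _ & D). eapply Rle_trans; [apply Cmod_le_abs|]. rewrite Rabs_pos_eq; lra.
Qed.

(** Termwise differentiation: the second-order remainder of every term is bounded by [|h|^2] times
    one summable sequence, so [Der_quadratic] applies to the series. *)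
Lemma zsum_holo s : Re s < 0 -> Cdb zsum s.
Proof.
  intros Hs. set (dl := - Re s / 12). assert (Hd : 0 < dl) by (unfold dl; lra).
  set (E4 := exp (4 * (Rabs (Im s) + dl))).
  set (b := fun k => / Rpower (INR (S k)) (1 - Re s / 2)).
  assert (Hb : ex_series b) by (apply ex_series_inv_power; lra).
  assert (Scal : forall c, ex_series (fun k => c * b k)) by (intros c; now apply (ex_series_scal_l c b)).
  assert (Pb : forall k, 0 < b k) by (intros; apply Rinv_0_lt_compat, Rpower_pos).
  assert (T0 : forall k l w c, log_like k l -> Rabs (Im w) <= Rabs (Im s) + dl -> 0 <= c ->
     Re w - 1 + c <= Re s / 2 - 1 -> exp (c * Re l) * Cmod (Cexp ((w - 1) * l)) <= E4 * b k).
  { intros k l w c Hl Hw Hc Hp. pose proof Hl as (A & B & D).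
    set (c' := Re s / 2 - Re w).
    eapply Rle_trans; [|eapply Rle_trans; [apply (log_like_exp k l w (Re s / 2 - 1) c' Hl)|]].
    - apply Rmult_le_compat_r; [apply Cmod_ge_0|]. apply exp_le, Rmult_le_compat_r; unfold c'; lra.
    - lra.
    - unfold c'; lra.
    - unfold c'; ring.
    - unfold b. replace (- (Re s / 2 - 1)) with (1 - Re s / 2) by ring.
      apply Rmult_le_compat_r; [apply Rlt_le, Rinv_0_lt_compat, Rpower_pos|].
      unfold E4. apply exp_le. lra. }
  assert (T1 : forall w k, Rabs (Im w) <= Rabs (Im s) + dl -> Re w <= Re s / 2 -> Cmod (zterm w k) <= 2 * E4 * b k).
  { intros w k Hw Hr. destruct (log_like_z k) as [L1 L2]. unfold zterm. eapply Rle_trans; [apply Cmod_triangle|].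
    generalize (T0 k _ w 0 L1 Hw ltac:(lra) ltac:(lra)) (T0 k _ w 0 L2 Hw ltac:(lra) ltac:(lra)).
    rewrite !Rmult_0_l, exp_0. lra. }
  set (dterm := fun k => (log_neg (z k) * Cexp ((s - 1) * log_neg (z k))
     + Cconj (log_neg (z k)) * Cexp ((s - 1) * Cconj (log_neg (z k))))%C).
  assert (T2 : forall k, Cmod (dterm k) <= (2 * (5 / dl) * E4) * b k).
  { intros k. destruct (log_like_z k) as [L1 L2].
    assert (G : forall l, log_like k l -> Cmod (l * Cexp ((s - 1) * l)) <= 5 / dl * (E4 * b k)).
    { intros l Hl. rewrite Cmod_mult.
      assert (Ll := log_like_Cmod k l Hl). assert (Ex := exp_ge_1plus (dl * Re l)).
      assert (Q := T0 k l s dl Hl ltac:(lra) ltac:(lra) ltac:(unfold dl; lra)).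
      pose proof (Cmod_ge_0 (Cexp ((s - 1) * l))) as Pc.
      apply Rle_trans with (5 / dl * (exp (dl * Re l) * Cmod (Cexp ((s - 1) * l)))).
      - rewrite <- Rmult_assoc. apply Rmult_le_compat_r; [exact Pc|].
        apply Rmult_le_reg_l with dl; [exact Hd|].
        replace (dl * (5 / dl * exp (dl * Re l))) with (5 * exp (dl * Re l)) by (field; lra). nra.
      - apply Rmult_le_compat_l; [|exact Q]. apply Rlt_le, Rdiv_lt_0_compat; lra. }
    unfold dterm. eapply Rle_trans; [apply Cmod_triangle|]. generalize (G _ L1) (G _ L2). lra. }
  exists (CSeries dterm).
  apply (Der_quadratic _ _ _ _ _ (Series (fun k => (2 * (25 * (4 / dl ^ 2)) * E4) * b k)) dl Hd).
  intros h Hh.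
  assert (Hhr := Rabs_Re_le h). assert (Hhi := Rabs_Im_le h).
  assert (Er : Re (s + h) = Re s + Re h) by reflexivity.
  assert (Ei : Im (s + h) = Im s + Im h) by reflexivity.
  destruct (CSeries_correct (zterm (s + h)) _ (fun k => T1 (s + h)%C k
     ltac:(rewrite Ei; eapply Rle_trans; [apply Rabs_triang|lra])
     ltac:(rewrite Er; generalize (Rle_abs (Re h)); unfold dl in *; lra)) (Scal _)) as [C1 _].
  destruct (CSeries_correct (zterm s) _ (fun k => T1 s k ltac:(lra) ltac:(lra)) (Scal _)) as [C2 _].
  destruct (CSeries_correct dterm _ T2 (Scal _)) as [C3 _].
  set (rterm := fun k => (zterm (s + h) k + (- (1) * zterm s k + - h * dterm k))%C).
  assert (T3 : forall k, Cmod (rterm k) <= Cmod h ^ 2 * ((2 * (25 * (4 / dl ^ 2)) * E4) * b k)).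
  { intros k. destruct (log_like_z k) as [L1 L2].
    assert (G : forall l, log_like k l -> Cmod (Cexp ((s - 1) * l) * (Cexp (h * l) - 1 - h * l)) <=
        Cmod h ^ 2 * (25 * (4 / dl ^ 2) * (E4 * b k))).
    { intros l Hl. rewrite Cmod_mult. pose proof Hl as (A & _ & _).
      assert (Ll := log_like_Cmod k l Hl).
      assert (Q := T0 k l s (6 * dl) Hl ltac:(lra) ltac:(lra) ltac:(unfold dl; lra)).
      pose proof (Cmod_ge_0 (Cexp ((s - 1) * l))) as Pc. pose proof (Cmod_ge_0 h) as Ph. pose proof (Cmod_ge_0 l) as Pl.
      assert (R1 : Cmod (Cexp (h * l) - 1 - h * l) <= Cmod h ^ 2 * (25 * (4 / dl ^ 2) * exp (6 * dl * Re l))).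
      { eapply Rle_trans; [apply Cexp_sub2_le|]. rewrite Cmod_mult.
        replace ((Cmod h * Cmod l) ^ 2 * exp (Cmod h * Cmod l)) with (Cmod h ^ 2 * (Cmod l ^ 2 * exp (Cmod h * Cmod l))) by ring.
        apply Rmult_le_compat_l; [apply pow2_ge_0|].
        assert (S1 : Cmod l ^ 2 <= 25 * Re l ^ 2).
        { replace (25 * Re l ^ 2) with ((5 * Re l) ^ 2) by ring. apply pow_incr. lra. }
        assert (S2 : Re l ^ 2 <= 4 / dl ^ 2 * exp (dl * Re l)).
        { assert (W := exp_ge_sqr (dl * Re l) ltac:(apply Rmult_le_pos; lra)).
          apply Rmult_le_reg_l with (dl ^ 2); [now apply pow_lt|].
          replace (dl ^ 2 * (4 / dl ^ 2 * exp (dl * Re l))) with (4 * exp (dl * Re l)) by (field; lra).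
          replace (dl ^ 2 * Re l ^ 2) with ((dl * Re l) ^ 2) by ring. exact W. }
        assert (S3 : exp (Cmod h * Cmod l) <= exp (5 * dl * Re l)) by (apply exp_le; nra).
        apply Rle_trans with (25 * (4 / dl ^ 2 * exp (dl * Re l)) * exp (5 * dl * Re l)).
        - apply Rmult_le_compat; [apply pow2_ge_0|apply Rlt_le, exp_pos|lra|exact S3].
        - right. replace (6 * dl * Re l) with (dl * Re l + 5 * dl * Re l) by ring. rewrite exp_plus. ring. }
      apply Rle_trans with (Cmod (Cexp ((s - 1) * l)) * (Cmod h ^ 2 * (25 * (4 / dl ^ 2) * exp (6 * dl * Re l)))).
      - now apply Rmult_le_compat_l.
      - replace (Cmod (Cexp ((s - 1) * l)) * (Cmod h ^ 2 * (25 * (4 / dl ^ 2) * exp (6 * dl * Re l)))) with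
         (Cmod h ^ 2 * (25 * (4 / dl ^ 2) * (exp (6 * dl * Re l) * Cmod (Cexp ((s - 1) * l))))) by ring.
        apply Rmult_le_compat_l; [apply pow2_ge_0|]. apply Rmult_le_compat_l; [|exact Q].
        assert (0 < 4 / dl ^ 2) by (apply Rdiv_lt_0_compat; [lra|now apply pow_lt]). lra. }
    assert (Ek : rterm k = (Cexp ((s - 1) * log_neg (z k)) * (Cexp (h * log_neg (z k)) - 1 - h * log_neg (z k)) +
       Cexp ((s - 1) * Cconj (log_neg (z k))) * (Cexp (h * Cconj (log_neg (z k))) - 1 - h * Cconj (log_neg (z k))))%C).
    { unfold rterm, zterm, dterm.
      replace ((s + h - 1) * log_neg (z k))%C with ((s - 1) * log_neg (z k) + h * log_neg (z k))%C by ring.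
      replace ((s + h - 1) * Cconj (log_neg (z k)))%C with ((s - 1) * Cconj (log_neg (z k)) + h * Cconj (log_neg (z k)))%C by ring.
      rewrite !Cexp_add. ring. }
    rewrite Ek. eapply Rle_trans; [apply Cmod_triangle|]. generalize (G _ L1) (G _ L2). lra. }
  destruct (CSeries_correct rterm _ T3 (ex_series_scal_l (Cmod h ^ 2) _ (Scal _))) as [C4 B4].
  assert (E : CSeries rterm = (zsum (s + h) - zsum s - CSeries dterm * h)%C).
  { apply (Clim_unique _ _ _ C4).
    replace (zsum (s + h) - zsum s - CSeries dterm * h)%C with (zsum (s + h) + (- (1) * zsum s + - h * CSeries dterm))%C by ring.
    refine (Clim_ext _ _ _ _ (Clim_plus _ _ _ _ C1 (Clim_plus _ _ _ _ (Clim_scal (- (1)) _ _ C2) (Clim_scal (- h) _ _ C3)))).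
    intros n. cbv beta. unfold rterm. rewrite csum_plus, csum_plus, !csum_scal. reflexivity. }
  rewrite <- E. eapply Rle_trans; [exact B4|]. rewrite Series_scal_l. right; ring.
Qed.

Lemma zsum_Clim s : Re s < 0 -> Clim (csum (zterm s)) (zsum s).
Proof.
  intros Hs.
  apply (CSeries_correct (zterm s) (fun k => (2 * exp (4 * Rabs (Im s))) * / Rpower (INR (S k)) (1 - Re s))).
  - intros k. destruct (log_like_z k) as [L1 L2]. unfold zterm. eapply Rle_trans; [apply Cmod_triangle|].
    generalize (log_like_exp k _ s (Re s - 1) 0 L1 ltac:(lra) ltac:(lra) ltac:(lra))
      (log_like_exp k _ s (Re s - 1) 0 L2 ltac:(lra) ltac:(lra) ltac:(lra)).
    rewrite !Rmult_0_l, exp_0. replace (- (Re s - 1)) with (1 - Re s) by ring. lra.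
  - apply (ex_series_scal_l (2 * exp (4 * Rabs (Im s))) (fun k => / Rpower (INR (S k)) (1 - Re s))).
    apply ex_series_inv_power. lra.
Qed.

(** For [x > 0] the distance from [x] to either pole is at least [k + 1], by its height, and at
    least [sqrt (k + 1) sqrt x / 2], because [Re z_k <= Im z_k] keeps it off the axis by an angle.
    The parameter [mu] selects one of the two bounds. *)
Lemma pole_real_bound k x mu : 0 < x -> mu = 1 \/ mu = / sqrt x ->
  Cmod (pole (z k) x) <= 2 * mu * / ((INR k + 1) * sqrt (INR k + 1)) /\
  Cmod (pole (Cconj (z k)) x) <= 2 * mu * / ((INR k + 1) * sqrt (INR k + 1)).
Proof.
  intros Hx Hmu. pose proof (pos_INR k) as Pk. pose proof PI_gt_3.
  pose proof (zero_Cmod_gt z Hz k) as L1. pose proof (zero_im_gt z Hz k) as L2.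
  destruct (zero_re_gt z Hz k) as [R1 R2].
  set (a := INR k + 1) in *. assert (Ha : 1 <= a) by (unfold a; lra).
  assert (Sa : 1 <= sqrt a) by (rewrite <- sqrt_1 at 1; apply sqrt_le_1_alt; lra).
  assert (Ea : sqrt a * sqrt a = a) by (apply sqrt_sqrt; lra).
  assert (Sx : 0 < sqrt x) by now apply sqrt_lt_R0.
  assert (Exx : sqrt x * sqrt x = x) by (apply sqrt_sqrt; lra).
  assert (G : forall p, Cmod p = Cmod (z k) -> Re p = Re (z k) -> Rabs (Im p) = Im (z k) ->
     Cmod (pole p x) <= 2 * mu * / (a * sqrt a)).
  { intros p E1 E2 E3.
    assert (Ip : a <= Rabs (Im p)) by (rewrite E3; nra).
    assert (Mp : a <= Cmod p) by (rewrite E1; nra).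
    assert (D1 : a <= Cmod (x - p)).
    { eapply Rle_trans; [exact Ip|]. replace (Im p) with (- Im (x - p)) by (unfold Im; simpl; ring).
      rewrite Rabs_Ropp. apply Rabs_Im_le. }
    assert (D2 : sqrt a * sqrt x / 2 <= Cmod (x - p)).
    { assert (Sq : (sqrt a * sqrt x / 2) ^ 2 <= Cmod (x - p) ^ 2).
      { replace ((sqrt a * sqrt x / 2) ^ 2) with ((sqrt a * sqrt a) * (sqrt x * sqrt x) / 4) by field.
        rewrite Ea, Exx, Cmod2_alt.
        replace (Re (x - p)) with (x - Re p) by (unfold Re; simpl; ring).
        replace (Im (x - p)) with (- Im p) by (unfold Im; simpl; ring).
        rewrite E2. replace ((- Im p) ^ 2) with (Rabs (Im p) ^ 2) by (rewrite pow2_abs; ring). rewrite E3.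
        set (u := Re (z k)) in *. set (v := Im (z k)) in *.
        assert (A1 : a <= v) by nra.
        assert (A2 : 0 <= (x - 2 * u) ^ 2) by apply pow2_ge_0.
        assert (A3 : 0 <= (a - x / 2) ^ 2) by apply pow2_ge_0.
        assert (A4 : u ^ 2 <= v ^ 2) by (apply pow_incr; lra).
        assert (A5 : a ^ 2 <= v ^ 2) by (apply pow_incr; lra).
        assert (A6 : 0 <= x ^ 2) by apply pow2_ge_0.
        assert (A7 : 0 <= (x - u) ^ 2) by apply pow2_ge_0. lra. }
      apply Rnot_lt_le. intros Lt. assert (P0 := Cmod_ge_0 (x - p)).
      assert (Cmod (x - p) ^ 2 < (sqrt a * sqrt x / 2) ^ 2); [|lra]. simpl. nra. }
    assert (Np : p <> 0) by (apply Cmod_gt_0; lra).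
    assert (Nx : (x - p)%C <> 0) by (apply Cmod_gt_0; lra).
    unfold pole. rewrite Cmod_inv, Cmod_mult by now apply Cmult_neq_0.
    assert (Paa : 0 < a * sqrt a) by (apply Rmult_lt_0_compat; lra).
    destruct Hmu as [->| ->].
    - rewrite Rmult_1_r. apply Rle_trans with (/ (a * sqrt a)).
      + apply Rinv_le_contravar; [exact Paa|]. apply Rmult_le_compat; nra.
      + assert (0 < / (a * sqrt a)) by now apply Rinv_0_lt_compat. lra.
    - replace (2 * / sqrt x * / (a * sqrt a)) with (/ (a * (sqrt a * sqrt x / 2))) by (field; lra).
      assert (0 < sqrt a * sqrt x) by (apply Rmult_lt_0_compat; lra).
      apply Rinv_le_contravar; [apply Rmult_lt_0_compat; lra|]. apply Rmult_le_compat; lra. }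
  pose proof (zero_im_pos z Hz k).
  split; apply G; [reflexivity|reflexivity|apply Rabs_pos_eq; lra|apply Cmod_conj|reflexivity|].
  rewrite Im_conj, Rabs_Ropp. apply Rabs_pos_eq. lra.
Qed.

Lemma inv_pow32_telescope a : 1 <= a -> / ((a + 1) * sqrt (a + 1)) <= 2 * (/ sqrt a - / sqrt (a + 1)).
Proof.
  intros Ha. set (u := sqrt a). set (v := sqrt (a + 1)).
  assert (Eu : u * u = a) by (apply sqrt_sqrt; lra).
  assert (Ev : v * v = a + 1) by (apply sqrt_sqrt; lra).
  assert (Hu : 1 <= u) by (unfold u; rewrite <- sqrt_1; apply sqrt_le_1_alt; lra).
  assert (Huv : u <= v) by (apply sqrt_le_1_alt; lra).
  rewrite <- Ev.
  replace (/ u - / v) with ((v * v - u * u) * / (u * v * (u + v))) by (field; lra).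
  rewrite Ev, Eu. replace (a + 1 - a) with 1 by ring. rewrite Rmult_1_l.
  replace (2 * / (u * v * (u + v))) with (/ (u * v * ((u + v) / 2))) by (field; lra).
  rewrite <- Ev.
  apply Rinv_le_contravar; [repeat apply Rmult_lt_0_compat; lra|].
  apply Rmult_le_compat; [nra|lra|nra|lra].
Qed.

(** Differences of remainders telescope to a bound independent of the number of terms, and
    [mittag_leffler] disposes of the far remainder. Both choices of [mu] are needed, one near 0 and
    one at infinity. *)
Lemma remainder_tail n x mu : (1 <= n)%nat -> 0 < x -> mu = 1 \/ mu = / sqrt x ->
  Cmod (remainder z n x) <= 8 / sqrt (INR n) * mu.
Proof.
  intros Hn Hx Hmu.
  assert (Pmu : 0 < mu).
  { destruct Hmu as [->| ->]; [lra|]. apply Rinv_0_lt_compat, sqrt_lt_R0, Hx. }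
  assert (Hn1 : 1 <= INR n) by (apply (le_INR 1), Hn).
  assert (D : forall j, Cmod (remainder z n x - remainder z (n + j) x) <= 8 * (/ sqrt (INR n) - / sqrt (INR (n + j))) * mu).
  { induction j as [|j IH].
    - rewrite Nat.add_0_r. replace (remainder z n x - remainder z n x)%C with (RtoC 0) by ring. rewrite Cmod_0. lra.
    - rewrite Nat.add_succ_r. destruct (pole_real_bound (n + j) x mu Hx Hmu) as [B1 B2].
      assert (T := inv_pow32_telescope (INR (n + j)) ltac:(rewrite plus_INR; generalize (pos_INR j); lra)).
      rewrite (S_INR (n + j)).
      replace (remainder z n x - remainder z (S (n + j)) x)%C with
        (remainder z n x - remainder z (n + j) x + pole (z (n + j)%nat) x + pole (Cconj (z (n + j)%nat)) x)%C
        by (unfold remainder; simpl; ring).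
      eapply Rle_trans; [apply Cmod_triangle3|].
      set (t := / ((INR (n + j) + 1) * sqrt (INR (n + j) + 1))) in *.
      assert (mu * t <= mu * (2 * (/ sqrt (INR (n + j)) - / sqrt (INR (n + j) + 1)))) by (apply Rmult_le_compat_l; lra).
      lra. }
  apply Rnot_lt_le. intros L.
  set (e := Cmod (remainder z n x) - 8 / sqrt (INR n) * mu).
  assert (M := mittag_leffler z Hz x Hx). apply is_lim_seq_spec in M.
  destruct (M (mkposreal e ltac:(unfold e; lra))) as [N0 HN]. specialize (HN (n + N0)%nat ltac:(lia)). simpl in HN.
  rewrite Rminus_0_r, Rabs_pos_eq in HN by apply Cmod_ge_0.
  specialize (D N0).
  assert (0 < / sqrt (INR (n + N0))).
  { apply Rinv_0_lt_compat, sqrt_lt_R0. rewrite plus_INR. generalize (pos_INR N0). lra. }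
  generalize (Cmod_triangle (remainder z n x - remainder z (n + N0) x) (remainder z (n + N0) x)).
  replace (remainder z n x - remainder z (n + N0) x + remainder z (n + N0) x)%C with (remainder z n x) by ring.
  unfold e, Rdiv in *. assert (0 < / sqrt (INR (n + N0)) * mu) by now apply Rmult_lt_0_compat. lra.
Qed.

(** The Stieltjes integral at [a = - p]. Since [Cexp (- l) = - 1 / p], the division by [p] lowers
    the exponent from [s] to [s - 1] and produces the minus sign. *)
Lemma pole_Imp s p l : -1 < Re s < 0 -> Cexp l = (- p)%C -> Rabs (Im l) < PI -> p <> 0 ->
  Imp (fun x => RCpower x s * pole p x)%C (Gm s * Gm (- s - 1) * (- Cexp ((s - 1) * l)))%C.
Proof.
  intros Hs El Hl Np.
  assert (E : Cexp ((s - 1) * l) = (- / p * Cexp (s * l))%C).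
  { replace ((s - 1) * l)%C with (s * l + - l)%C by ring. rewrite Cexp_add, Cexp_opp, El. field. exact Np. }
  rewrite E. replace (Gm s * Gm (- s - 1) * - (- / p * Cexp (s * l)))%C
     with (/ p * (Gm s * Gm (- s - 1) * Cexp (s * l)))%C by ring.
  refine (Imp_ext _ _ _ _ (Imp_scal (/ p) _ _ (stieltjes_value s l Hs Hl))).
  intros x Hx. cbv beta. rewrite El. unfold pole.
  destruct (Cexp_off_neg l Hl) as [c Ho].
  assert (N1 := off_neg_neq _ _ x Ho ltac:(lra)). rewrite El in N1.
  assert (N2 : (x - p)%C <> 0) by exact N1. field. auto.
Qed.

Lemma polesum_Imp s n : -1 < Re s < 0 ->
  Imp (fun x => RCpower x s * polesum (zeros z n) x)%C (Gm s * Gm (- s - 1) * (- csum (zterm s) n))%C.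
Proof.
  intros Hs. induction n as [|n IH].
  - simpl.
    replace (Gm s * Gm (- s - 1) * - 0)%C with (0 * Gm s)%C by ring.
    refine (Imp_ext _ _ _ _ (Imp_scal 0 _ _ (Gm_Imp s ltac:(lra)))). intros x _. cbv beta. ring.
  - destruct (log_neg_props n) as (_ & _ & _ & D). destruct (zero_re_gt z Hz n) as [Hr _].
    assert (El := Cexp_log_neg (z n) Hr).
    assert (Np : z n <> 0) by (intros Q; rewrite Q in Hr; unfold Re, RtoC in Hr; simpl in Hr; lra).
    assert (I1 := pole_Imp s (z n) _ Hs El ltac:(apply Rabs_def1; lra) Np).
    assert (I2 := pole_Imp s (Cconj (z n)) (Cconj (log_neg (z n))) Hs
       ltac:(rewrite Cexp_conj, El; unfold Cconj, Copp; simpl; reflexivity)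
       ltac:(rewrite Im_conj, Rabs_Ropp; apply Rabs_def1; lra)
       ltac:(intros Q; apply Np; rewrite <- (Cconj_conj (z n)), Q; unfold Cconj, RtoC; simpl; f_equal; ring)).
    replace (Gm s * Gm (- s - 1) * - csum (zterm s) (S n))%C with
      (Gm s * Gm (- s - 1) * - Cexp ((s - 1) * log_neg (z n)) +
       (Gm s * Gm (- s - 1) * - Cexp ((s - 1) * Cconj (log_neg (z n))) + Gm s * Gm (- s - 1) * - csum (zterm s) n))%C
      by (simpl; unfold zterm; ring).
    refine (Imp_ext _ _ _ _ (Imp_plus _ _ _ _ I1 (Imp_plus _ _ _ _ I2 IH))).
    intros x _. cbv beta. simpl. ring.
Qed.

(** Integrated against [x^s], the remainder after [n] pairs is [O(n^(-1/2))]: its dominating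
    function decays like [x^(Re s - 1/2)], and [Re s < -1/2] here. Non-vanishing of [Gm s] then
    allows it to be divided out. *)
Lemma zeta2_formula_disc zeta2 : is_zeta2 zeta2 -> forall s, cdisc (RtoC (- (3 / 4))) (1 / 8) s ->
  zeta2 s = (- (Gm (- s - 1) * zsum s))%C.
Proof.
  intros H s Hs. destruct (cdisc_Re_Im _ _ _ Hs) as [A _]. apply Rabs_def2 in A. rewrite re_RtoC in A.
  assert (I0 := zeta2_hreg zeta2 H s Hs).
  assert (NG : Gm s <> 0) by (apply Gm_neq_0; lra).
  set (K := / (Re s + 1) + / (- 1 - (Re s - / 2))).
  assert (B : forall n, Cmod (Gm s * zeta2 s + Gm s * Gm (- s - 1) * csum (zterm s) (S n)) <= 8 / sqrt (INR (S n)) * K).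
  { intros n. assert (J := Imp_minus _ _ _ _ I0 (polesum_Imp s (S n) ltac:(lra))).
    assert (Ps : 0 < 8 / sqrt (INR (S n))).
    { apply Rdiv_lt_0_compat; [lra|]. apply sqrt_lt_R0, lt_0_INR. lia. }
    assert (D : Dom (fun x => RCpower x s * remainder z (S n) x)%C (8 / sqrt (INR (S n))) (Re s) (Re s - / 2)).
    { split; [|split].
      - intros x Hx. apply Rdb_mult; [now apply Rdb_RCpower|].
        apply (Rdb_comp (remainder z (S n))); [|apply Rdb_RtoC]. now apply remainder_Cdb, q_real_neq_0.
      - intros x Hx. rewrite Cmod_mult, Cmod_RCpower, Rmult_comm. apply Rmult_le_compat_r; [apply Rlt_le, Rpower_pos|].
        rewrite <- (Rmult_1_r (8 / sqrt (INR (S n)))). apply remainder_tail; [lia|lra|now left].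
      - intros x Hx. rewrite Cmod_mult, Cmod_RCpower. unfold Rminus. rewrite Rpower_plus, Rpower_Ropp, Rpower_sqrt by lra.
        rewrite <- Rmult_assoc, (Rmult_comm (8 / sqrt (INR (S n)))), Rmult_assoc.
        apply Rmult_le_compat_l; [apply Rlt_le, Rpower_pos|]. apply remainder_tail; [lia|lra|now right]. }
    destruct (Imp_dom _ _ _ _ D ltac:(lra) ltac:(lra)) as (r & Hr & Br).
    replace (Gm s * zeta2 s + Gm s * Gm (- s - 1) * csum (zterm s) (S n))%C with r; [exact Br|].
    replace (Gm s * zeta2 s + Gm s * Gm (- s - 1) * csum (zterm s) (S n))%C with
      (Gm s * zeta2 s - Gm s * Gm (- s - 1) * - csum (zterm s) (S n))%C by ring.
    apply (Imp_unique _ _ _ Hr). refine (Imp_ext _ _ _ _ J). intros x _. cbv beta. unfold remainder. ring. }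
  assert (L := Clim_plus _ _ _ _ (Clim_const (Gm s * zeta2 s)%C) (Clim_scal (Gm s * Gm (- s - 1)) _ _ (zsum_Clim s ltac:(lra)))).
  assert (Z : (Gm s * zeta2 s + Gm s * Gm (- s - 1) * zsum s)%C = 0).
  { apply (Clim_zero_of_bound _ _ (fun n => 8 / sqrt (INR (S n)) * K) L B).
    replace (Finite 0) with (Rbar_mult (Rbar_mult 8 0) K) by (simpl; f_equal; ring).
    apply is_lim_seq_scal_r, is_lim_seq_scal_l.
    apply is_lim_seq_spec. intros eps. destruct (nfloor_ex ((/ eps) ^ 2)) as [n0 [_ Hn0]]; [apply pow2_ge_0|].
    exists n0. intros n Hn. pose proof (cond_pos eps) as Pe. apply le_INR in Hn. 
    assert (Hi : 0 < / eps) by now apply Rinv_0_lt_compat.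
    assert (Q : / eps < sqrt (INR (S n))).
    { rewrite <- (sqrt_pow2 (/ eps)) by lra. apply sqrt_lt_1_alt. rewrite S_INR. split; [apply pow2_ge_0|lra]. }
    rewrite Rminus_0_r, Rabs_pos_eq by (apply Rlt_le, Rinv_0_lt_compat; lra).
    rewrite <- (Rinv_inv eps). apply Rinv_lt_contravar; [apply Rmult_lt_0_compat; lra|exact Q]. }
  replace (zeta2 s) with (/ Gm s * (Gm s * zeta2 s + Gm s * Gm (- s - 1) * zsum s) - Gm (- s - 1) * zsum s)%C by (field; exact NG).
  rewrite Z. ring.
Qed.

Lemma zeta2_formula zeta2 s : is_zeta2 zeta2 -> Re s < 0 -> zeta2 s = (- (Gm (- s - 1) * zsum s))%C.
Proof.
  intros H Hs. set (g := fun s => (zeta2 s + Gm (- s - 1) * zsum s)%C).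
  assert (Hg : forall w, Re w < 0 -> Cdb g w).
  { intros w Hw. apply Cdb_plus.
    - apply is_zeta2_Cdb; [exact H| |]; apply Re_neq; lra.
    - apply Cdb_mult; [|now apply zsum_holo].
      apply (Cdb_comp Gm (fun s => - s - 1)%C).
      + apply Gm_holo. unfold Re in *; simpl; lra.
      + apply Cdb_minus; [|apply Cdb_const]. apply (Cdb_ext (fun s => - (1) * s)%C); [intros; ring|].
        apply Cdb_mult; [apply Cdb_const|apply Cdb_id]. }
  set (a := RtoC (- (3 / 4))).
  (* The distance to the imaginary axis from the nearer end of the segment joining [-3/4] to [s];
     discs of this radius along the segment stay in [Re s < 0]. *)
  set (dl := Rmin (3 / 4) (- Re s)).
  assert (Hd : 0 < dl) by (apply Rmin_pos; lra).
  pose proof (Rmin_l (3 / 4) (- Re s)) as D1. pose proof (Rmin_r (3 / 4) (- Re s)) as D2. fold dl in D1, D2.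
  assert (E : g s = 0).
  { apply (identity_segment g a s dl Hd).
    - intros t Ht w Hw. destruct (cdisc_Re_Im _ _ _ Hw) as [A _]. apply Rabs_def2 in A.
      replace (Re (a + t * (s - a))%C) with ((1 - t) * - (3 / 4) + t * Re s) in A by (unfold a, Re; simpl; ring).
      apply Hg. nra.
    - intros d Hd2. set (x := Rmin d (1 / 8) / 2).
      pose proof (Rmin_l d (1 / 8)). pose proof (Rmin_r d (1 / 8)). pose proof (Rmin_pos d (1 / 8) Hd2 ltac:(lra)).
      exists (a + RtoC x)%C. assert (Ex : (a + RtoC x - a = RtoC x)%C) by ring.
      assert (Px : 0 < x) by (unfold x; lra).
      split; [|split].
      + unfold a. rewrite <- RtoC_plus. intros Q. apply RtoC_inj in Q. lra.
      + rewrite Ex, Cmod_RtoC_pos; unfold x in *; lra.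
      + unfold g. rewrite (zeta2_formula_disc zeta2 H); [ring|].
        unfold cdisc. fold a. rewrite Ex, Cmod_RtoC_pos; unfold x in *; lra.
    - unfold cdisc. replace (s - s)%C with (RtoC 0) by ring. rewrite Cmod_0. exact Hd. }
  replace (zeta2 s) with (g s - Gm (- s - 1) * zsum s)%C by (unfold g; ring). rewrite E. ring.
Qed.

(** Both logarithms satisfy [|Im l| <= PI - theta], which gives the exponential factor. The power
    [Re s - 1] being negative, [|z_k| > 2 PI (k + 1)] turns the moduli into [(2 PI)^(Re s - 1)]
    times the terms of the zeta series, whose index is shifted in the same way. *)
Lemma zsum_bound s theta : Re s < 0 -> (forall k, theta <= atan (Im (z k) / Re (z k))) ->
  Cmod (zsum s) <= 2 * Rpower (2 * PI) (Re s - 1) * exp (Rabs (Im s) * (PI - theta)) * zeta (1 - Re s).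
Proof.
  intros Hs Ht. unfold zeta. rewrite <- Series_scal_l.
  apply CSeries_correct.
  - intros k. pose proof (zero_Cmod_gt z Hz k) as L. pose proof PI_gt_3. pose proof (pos_INR k).
    destruct (zero_re_gt z Hz k) as [Hr _]. pose proof (zero_im_pos z Hz k) as Hi.
    destruct (log_neg_im (z k) Hr Hi) as [E B]. specialize (Ht k).
    assert (Pk : 0 < INR (S k)) by (apply lt_0_INR; lia).
    assert (G : forall l, Re l = ln (Cmod (z k)) -> Rabs (Im l) <= PI - theta ->
      Cmod (Cexp ((s - 1) * l)) <= Rpower (2 * PI) (Re s - 1) * exp (Rabs (Im s) * (PI - theta)) * / Rpower (INR (S k)) (1 - Re s)).
    { intros l E1 E2. rewrite Cmod_Cexp.
      replace (Re ((s - 1) * l)) with ((Re s - 1) * Re l + - (Im s * Im l)) by (unfold Re, Im; simpl; ring).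
      rewrite exp_plus, E1.
      replace (Rpower (2 * PI) (Re s - 1) * exp (Rabs (Im s) * (PI - theta)) * / Rpower (INR (S k)) (1 - Re s))
       with ((Rpower (2 * PI) (Re s - 1) * Rpower (INR (S k)) (Re s - 1)) * exp (Rabs (Im s) * (PI - theta))).
      2:{ rewrite <- (Rpower_Ropp (INR (S k)) (1 - Re s)). replace (- (1 - Re s)) with (Re s - 1) by ring. ring. }
      rewrite Rpower_mult_distr by lra.
      apply Rmult_le_compat; [apply Rlt_le, exp_pos|apply Rlt_le, exp_pos| |].
      - unfold Rpower. apply exp_le. rewrite S_INR in *.
        assert (ln (2 * PI * (INR k + 1)) <= ln (Cmod (z k))) by (apply ln_le; [apply Rmult_lt_0_compat; lra|lra]). nra.
      - apply exp_le. eapply Rle_trans; [apply Rle_abs|]. rewrite Rabs_Ropp, Rabs_mult.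
        apply Rmult_le_compat_l; [apply Rabs_pos|exact E2]. }
    assert (Ia : Rabs (Im (log_neg (z k))) <= PI - theta) by (rewrite E, Rabs_left1; lra).
    unfold zterm. eapply Rle_trans; [apply Cmod_triangle|].
    generalize (G (log_neg (z k)) eq_refl Ia) (G (Cconj (log_neg (z k))) eq_refl ltac:(rewrite Im_conj, Rabs_Ropp; exact Ia)).
    lra.
  - apply (ex_series_scal_l (2 * Rpower (2 * PI) (Re s - 1) * exp (Rabs (Im s) * (PI - theta)))
      (fun k => / Rpower (INR (S k)) (1 - Re s))).
    apply ex_series_inv_power. lra.
Qed.

End Final.

Lemma zeta_pos x : 1 < x -> 0 < zeta x.
Proof.
  intros Hx. unfold zeta. assert (E := ex_series_inv_power x Hx).
  apply Rlt_le_trans with (sum_n (fun n => / Rpower (INR (S n)) x) 0).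
  - rewrite sum_O. apply Rinv_0_lt_compat, Rpower_pos.
  - apply (is_lim_seq_incr_compare (sum_n (fun n => / Rpower (INR (S n)) x))).
    + exact (Series_correct _ E).
    + intros m. rewrite sum_Sn. change plus with Rplus.
      assert (0 < / Rpower (INR (S (S m))) x) by apply Rinv_0_lt_compat, Rpower_pos. lra.
Qed.

Theorem theorem4p2 :
  forall (zeta2 : C -> C) (z1 : C) (r1 theta1 : R),
    is_zeta2 zeta2 ->
    smallest_upper_zero z1 ->
    0 < r1 -> 0 < theta1 < PI ->
    z1 = (RtoC r1 * Cexp (Ci * RtoC theta1))%C ->
    forall s : C, Re s < 0 ->
      Cmod (zeta2 s) <
        2 * Rpower (2 * PI) (Re s) * Cmod (CGamma (- s)%C)
          * exp (Rabs (Im s) * (PI - theta1)) * zeta (1 - Re s).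
Proof.
  intros zeta2 z1 r1 theta1 H H1 Hr Ht E s Hs.
  (* One zero per strip, chosen by description; the preceding results hold for any sequence of this
     kind. *)
  pose (z := fun k => proj1_sig (constructive_indefinite_description _ (zero_exists k))).
  assert (Hz : forall k, upper_zero (z k) /\ in_strip k (z k)).
  { intros k. unfold z. exact (proj2_sig (constructive_indefinite_description _ (zero_exists k))). }
  rewrite (zeta2_formula z Hz zeta2 s H Hs), Cmod_opp, Cmod_mult, Gm_CGamma.
  assert (B := zsum_bound z Hz s theta1 Hs
    (fun k => smallest_angle z1 r1 theta1 (z k) H1 Hr Ht E (proj1 (Hz k)))).
  assert (PG : 0 < Cmod (Gm (- s - 1))) by (apply Cmod_gt_0, Gm_neq_0; unfold Re in *; simpl; lra).
  assert (PZ := zeta_pos (1 - Re s) ltac:(lra)).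
  assert (PE := exp_pos (Rabs (Im s) * (PI - theta1))).
  assert (PR := Rpower_pos (2 * PI) (Re s - 1)). pose proof PI_gt_3.
  assert (ER : Rpower (2 * PI) (Re s) = Rpower (2 * PI) (Re s - 1) * (2 * PI)).
  { rewrite <- (Rpower_1 (2 * PI)) at 3 by lra. rewrite <- Rpower_plus. f_equal; ring. }
  eapply Rle_lt_trans; [apply Rmult_le_compat_l; [apply Cmod_ge_0|exact B]|].
  rewrite ER.
  set (X := Rpower (2 * PI) (Re s - 1)) in *. set (Y := exp (Rabs (Im s) * (PI - theta1))) in *.
  set (W := zeta (1 - Re s)) in *. set (V := Cmod (Gm (- s - 1))) in *.
  assert (Q : 0 < X * Y * W * V) by (repeat apply Rmult_lt_0_compat; assumption).
  replace (V * (2 * X * Y * W)) with (2 * (X * Y * W * V)) by ring.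
  replace (2 * (X * (2 * PI)) * V * Y * W) with (2 * (2 * PI) * (X * Y * W * V)) by ring.
  apply Rmult_lt_compat_r; lra.
Qed.
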